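(* Let $n\ge2$ and let $\Gamma=([n],w)$ be a weighted hypergraph with non-negative weights such that $w_B=0$ whenever $|B|<n-1$. Then the smallest eigenvalue of the Laplacian over all non-trivial irreducible representations of $\mathrm{U}(n)$ is attained in $\rho_{(1,0,\ldots,0,-1)}$ or in $\rho_{(2,0,\ldots,0,-2)}$, i.e. \[ \min_{\mathrm{triv}\ne\rho\in\mathrm{Irr}(\mathrm{U}(n))}\lambda_{\min}(\Gamma,\rho)=\lambda_{\min}\big(\Gamma,\rho_{(1,0,\ldots,0,-1)}\oplus\rho_{(2,0,\ldots,0,-2)}\big). \]
   Context: A weighted hypergraph $\Gamma=([n],w)$ is an assignment of a weight $w_B\ge0$ to every subset $B\subseteq[n]$. For $B\subseteq[n]$, $\mathrm{U}_B\le\mathrm{U}(n)$ is the subgroup of unitary matrices coinciding with the identity outside the minor with rows and columns in $B$ ($\mathrm{U}_B\cong\mathrm{U}(|B|)$), and $\mu_B$ is its Haar probability measure. For a finite-dimensional representation $\rho\colon\mathrm{U}(n)\to\mathrm{GL}_d(\mathbb{C})$, ${\cal L}(\Gamma,\rho)=\sum_{B}w_B\big[I_d-\int_{\mathrm{U}_B}\rho(A)\,d\mu_B(A)\big]$, which has real spectrum; $\lambda_{\min}(\Gamma,\rho)$ is its smallest eigenvalue. Irreducible representations of $\mathrm{U}(n)$ are indexed by non-increasing $\mu\in\mathbb{Z}^n$ (highest weights), $\rho_\mu$ being the one with highest weight $\mu$, and $\mathrm{triv}=\rho_{(0,\ldots,0)}$. *)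

(* Defs.v *)
From HB Require Import structures.
From mathcomp Require Import all_boot all_order all_algebra.
From mathcomp Require Import all_classical all_reals all_analysis.
From mathcomp Require Import complex.
Unset Printing Implicit Defensive.
Import Order.TTheory GRing.Theory Num.Theory ComplexField.
Local Open Scope classical_set_scope.
Local Open Scope ring_scope.

(* complex numbers over a realType R are R[i]; make them (and hence matrices
   over them) pointed, as required by the generated sigma-algebra construction *)
HB.instance Definition _ (R : realType) := isPointed.Build R[i] 0.

(* The sigma-algebra on n x n complex matrices generated by the coordinate maps
   A |-> Re (A i j) and A |-> Im (A i j) (Borel sets of R); this is the Borel
   sigma-algebra of C^(n x n). *)
Definition mx_gen (R : realType) (n : nat) : set (set 'M[R[i]]_n) :=
  [set E | exists (i j : 'I_n) (b : bool) (S : set R), measurable S /\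
      E = [set A : 'M[R[i]]_n |
             S (if b then complex.Re (A i j) else complex.Im (A i j))]].

Notation mxT R n := (g_sigma_algebraType (mx_gen R n)).

Section Defs.
Context {R : realType}.
Local Notation C := (R[i]).

(* U(n) : unitary n x n matrices *)
Definition unitary {n : nat} : set 'M[C]_n :=
  [set A | A *m (map_mx (fun z : C => z^*) A)^T = 1%:M].

(* U_B : unitary matrices coinciding with the identity outside the B x B minor *)
Definition UB {n : nat} (B : {set 'I_n}) : set 'M[C]_n :=
  [set A | unitary A /\
     forall i j : 'I_n, (i \notin B) || (j \notin B) -> A i j = (i == j)%:R].

(* mu is the Haar probability measure of U_B, viewed as a Borel probability
   measure on n x n complex matrices: it is concentrated on U_B and invariant
   under left translation by elements of U_B (this characterizes it uniquely). *)
Definition is_haar {n : nat} (B : {set 'I_n}) (mu : probability (mxT R n) R) : Prop :=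
  (forall S : set (mxT R n), measurable S -> S `&` UB B = set0 -> mu S = 0%E) /\
  (forall g : 'M[C]_n, UB B g ->
     forall S : set (mxT R n), measurable S ->
       mu [set A : mxT R n | S (g *m A)] = mu S).

(* a finite-dimensional (measurable, hence continuous) representation of U(n),
   acting on row vectors of C^d *)
Definition is_rep {n d : nat} (rho : 'M[C]_n -> 'M[C]_d) : Prop :=
  rho 1%:M = 1%:M /\
  (forall A B, unitary A -> unitary B -> rho (A *m B) = rho A *m rho B) /\
  (forall k l : 'I_d,
     measurable_fun (unitary : set (mxT R n)) (fun A => complex.Re (rho A k l)) /\
     measurable_fun (unitary : set (mxT R n)) (fun A => complex.Im (rho A k l))).

(* irreducible: nonzero, and no invariant subspaces besides 0 and C^d *)
Definition irreducible {n d : nat} (rho : 'M[C]_n -> 'M[C]_d) : Prop :=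
  (0 < d)%N /\
  forall (m : nat) (W : 'M[C]_(m, d)),
    (forall A, unitary A -> (W *m rho A <= W)%MS) ->
    \rank W = 0%N \/ \rank W = d.

(* not (isomorphic to) the trivial representation *)
Definition nontrivial {n d : nat} (rho : 'M[C]_n -> 'M[C]_d) : Prop :=
  exists A, unitary A /\ rho A <> 1%:M.

(* lam : Z^n is a weight of rho (w.r.t. the diagonal maximal torus) *)
Definition is_weight {n d : nat} (rho : 'M[C]_n -> 'M[C]_d) (lam : 'I_n -> int) : Prop :=
  exists v : 'rV[C]_d, v != 0 /\
    forall t : 'I_n -> C, (forall i, `|t i| = 1) ->
      v *m rho (diag_mx (\row_i t i)) = (\prod_i (t i ^ lam i)) *: v.

(* dominance order: mu - lam is a non-negative combination of e_i - e_(i+1) *)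
Definition dom_le {n : nat} (lam mu : 'I_n -> int) : Prop :=
  (forall k : nat, 0 <= \sum_(i < n | (i < k)%N) (mu i - lam i)) /\
  \sum_(i < n) lam i = \sum_(i < n) mu i.

(* rho is the irreducible representation rho_mu with highest weight mu *)
Definition has_highest_weight {n d : nat} (rho : 'M[C]_n -> 'M[C]_d)
    (mu : 'I_n -> int) : Prop :=
  irreducible rho /\ is_weight rho mu /\
  forall lam, is_weight rho lam -> dom_le lam mu.

(* the weight (c, 0, ..., 0, -c) *)
Definition wt_c0c (n : nat) (c : int) : 'I_n -> int :=
  fun i => if (i == 0%N :> nat) then c else if (i == n.-1 :> nat) then - c else 0.

(* direct sum of two representations *)
Definition dsum {n d1 d2 : nat} (rho1 : 'M[C]_n -> 'M[C]_d1)
    (rho2 : 'M[C]_n -> 'M[C]_d2) : 'M[C]_n -> 'M[C]_(d1 + d2) :=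
  fun A => block_mx (rho1 A) 0 0 (rho2 A).

(* int_{U_B} rho(A) d mu_B(A), entrywise *)
Definition haar_avg {n d : nat} (mu : probability (mxT R n) R)
    (rho : 'M[C]_n -> 'M[C]_d) : 'M[C]_d :=
  \matrix_(k, l) Complex (Rintegral mu setT (fun A : mxT R n => complex.Re (rho A k l)))
                         (Rintegral mu setT (fun A : mxT R n => complex.Im (rho A k l))).

(* L(Gamma, rho) = sum_B w_B [I_d - int_{U_B} rho dmu_B] *)
Definition laplacian {n d : nat} (w : {set 'I_n} -> R)
    (mu : {set 'I_n} -> probability (mxT R n) R) (rho : 'M[C]_n -> 'M[C]_d) : 'M[C]_d :=
  \sum_(B : {set 'I_n}) (real_complex R (w B)) *: (1%:M - haar_avg (mu B) rho).

(* x is the smallest eigenvalue of L (all eigenvalues being real and >= x) *)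
Definition is_lambda_min {d : nat} (L : 'M[C]_d) (x : R) : Prop :=
  eigenvalue L (real_complex R x) /\ forall y : C, eigenvalue L y -> real_complex R x <= y.

End Defs.

(* Main.v *)
(* Write K_i for the unitary group of [n] minus {i} and P_i for the projection
   given by its Haar mean. On a nontrivial irreducible rho the Laplacian is
   W - \sum_i w_i P_i. The pair (U(n), K_i) is a Gelfand pair, so P_i is zero or
   of rank one, P_i = x_i y_i with y_i x_i = 1, and y_i x_j = c for all i <> j,
   because P_i rho(g) P_i only depends on the entry g_ii. Hence the nonzero
   eigenvalues of \sum_i w_i P_i are those of the real symmetric matrix S_c with
   entries sqrt(w_i w_j) (1 if i = j, c if i <> j), and the largest eigenvalue
   of S_c is a convex function of c.

   Let f(z) be the spherical function, c = f(0). If c <> 0, then f is invariant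
   under phases and f(z) = A(|z|^2) for a polynomial A of some degree m >= 1.
   The product formula c f(z) = E f(s k_11), |z|^2 + s^2 = 1, compared at top
   degree, yields c = (-1)^m b_m, where b_m = E |k_11|^(2m) decreases with m.
   So c lies between -b_1 and b_2, and convexity leaves the two end points.

   For the highest weight (a, 0, .., 0, -a), the degree is a, by comparing the
   weights that occur in y_0 rho(g); it remains to see that P_0 <> 0. Matrix
   entries of rho are polynomials in g and g^*, so rho extends to the Zariski
   closure of the pairs (g, g^* ), which contains the elementary matrices. For a
   highest weight vector v and its dual y, an LDU decomposition gives
   v N rho(k) N' y = |1 + k_nn|^(2a) (v y) with elementary N and N', and this has
   a nonzero mean over k. *)
Require Import Defs.
From HB Require Import structures.
From mathcomp Require Import all_boot all_order all_algebra.
From mathcomp Require Import all_classical all_reals all_analysis.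
From mathcomp Require Import complex measurable_realfun.
From mathcomp Require Import perm ring lra zify.
From mathcomp Require spectral sesquilinear.
Import Order.TTheory GRing.Theory Num.Theory ComplexField.
Local Open Scope classical_set_scope.
Local Open Scope ring_scope.
Set Implicit Arguments.
Unset Strict Implicit.

(** * Haar means *)

(** Two obstacles shape the argument. A representation is only assumed measurable on the unitary
    group and is arbitrary elsewhere, while Haar means are integrals over all matrices; and neither
    continuity nor unitarity nor polynomiality of [rho] is given. Boundedness comes from the
    invariant measure. Polynomiality comes from a moment argument: if every matrix entry were
    orthogonal to all polynomials in the entries of g and of its adjoint, every entry would vanish
    almost everywhere, against invertibility. One nonzero moment yields a vector with polynomial
    orbit, and irreducibility spreads this to all vectors. The mean of [rho] times its conjugate
    transpose replaces an invariant inner product. Vectors are rows acted on from the right, so the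
    lower triangular elementary matrices are the ones that raise weights and fix a highest weight
    vector. *)

Section NonMeasurableOffConull.
Local Open Scope ereal_scope.
Import HBNNSimple.
Context d (T : measurableType d) (R : realType).
Variables (mu : {measure set T -> \bar R}) (U : set T).
Hypotheses (mU : measurable U) (muU : mu (~` U) = 0).

(** Neither function is assumed measurable. The integral of a nonnegative function is a supremum
    over the simple functions below it, and cutting such a simple function by the indicator of [U]
    keeps its integral and puts it below [g]. *)
Lemma le_ge0_integral_conull (f g : T -> \bar R) :
  (forall x, 0 <= f x) -> (forall x, 0 <= g x) ->
  (forall x, U x -> f x = g x) -> \int[mu]_x f x <= \int[mu]_x g x.
Proof.
move=> f0 g0 fg; rewrite !ge0_integralTE//.
apply/ge_ereal_sup => _ [h /= hf <-].
apply: ereal_sup_ubound; exists (proj_nnsfun h mU) => [x /=|].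
  rewrite mindicE; have [/set_mem xU|xU] := boolP (x \in U).
    by rewrite mulr1 -fg.
  by rewrite mulr0.
have split (k : {nnsfun T >-> R}) :
    \int[mu]_x (k x)%:E = \int[mu]_(x in U) (k x)%:E.
  have mk D : measurable_fun D (fun x => (k x)%:E).
    exact/measurable_EFinP/measurable_funTS.
  rewrite -(setUv U) ge0_integral_setU//.
  - by rewrite [X in _ + X]null_set_integral ?adde0//; exact: measurableC.
  - exact: measurableC.
  - by move=> x _; rewrite lee_fin fun_ge0.
  - by apply/disj_setPCl.
rewrite -!integralT_nnsfun split [RHS]split.
by apply: eq_integral => x xU; rewrite /= mindicE xU mulr1.
Qed.

(** Meant for integrands that are measurable on [U] only, such as the entries of a representation;
    positive and negative parts are treated separately. *)
Lemma integral_conull (f : T -> \bar R) :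
  \int[mu]_x f x = \int[mu]_(x in U) f x.
Proof.
have pos (h : T -> \bar R) : (forall x, 0 <= h x) ->
    \int[mu]_x h x = \int[mu]_x (h \_ U) x.
  move=> h0; have hU x : 0 <= (h \_ U) x by rewrite /patch; case: ifP.
  have e x : U x -> h x = (h \_ U) x by move=> Ux; rewrite /patch mem_set.
  apply/eqP; rewrite eq_le; apply/andP; split; apply: le_ge0_integral_conull => //.
  by move=> x Ux; rewrite e.
rewrite [RHS]integral_mkcond integralE [RHS]integralE.
by rewrite pos// [X in _ - X]pos// funepos_restrict funeneg_restrict.
Qed.

End NonMeasurableOffConull.

Section Haar.
Context {R : realType} {n : nat}.
Local Notation C := R[i].
Local Notation M := 'M[C]_n.
Local Notation T := (mxT R n).
Local Notation Re := complex.Re.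
Local Notation Im := complex.Im.
Implicit Types (B : {set 'I_n}) (f h : M -> C).

Definition star {m p : nat} (A : 'M[C]_(m, p)) : 'M[C]_(p, m) :=
  (map_mx (fun z : C => z^*) A)^T.

Lemma starE m p (A : 'M[C]_(m, p)) i j : star A i j = (A j i)^*.
Proof. by rewrite !mxE. Qed.

Lemma starK m p (A : 'M[C]_(m, p)) : star (star A) = A.
Proof. by apply/matrixP => i j; rewrite !starE conjCK. Qed.

Lemma starM m p q (A : 'M[C]_(m, p)) (D : 'M[C]_(p, q)) :
  star (A *m D) = star D *m star A.
Proof.
apply/matrixP => i j; rewrite starE !mxE rmorph_sum; apply: eq_bigr => k _.
by rewrite rmorphM !starE mulrC.
Qed.

Lemma star1 m : star (1%:M : 'M[C]_m) = 1%:M.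
Proof. by apply/matrixP => i j; rewrite starE !mxE eq_sym rmorph_nat. Qed.

Lemma starD m p (A D : 'M[C]_(m, p)) : star (A + D) = star A + star D.
Proof. by apply/matrixP => i j; rewrite !(starE, mxE) rmorphD. Qed.

Lemma starN m p (A : 'M[C]_(m, p)) : star (- A) = - star A.
Proof. by apply/matrixP => i j; rewrite !(starE, mxE) rmorphN. Qed.

Lemma starZ m p a (A : 'M[C]_(m, p)) : star (a *: A) = a^* *: star A.
Proof. by apply/matrixP => i j; rewrite !(starE, mxE) rmorphM. Qed.

Lemma unitaryE (A : M) : unitary A <-> A *m star A = 1%:M.
Proof. by []. Qed.

Lemma unitary_star_mul (A : M) : unitary A -> star A *m A = 1%:M.
Proof. by move=> /unitaryE/mulmx1C. Qed.

Lemma unitary1 : unitary (1%:M : M).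
Proof. by apply/unitaryE; rewrite star1 mulmx1. Qed.

Lemma unitaryM (A D : M) : unitary A -> unitary D -> unitary (A *m D).
Proof.
move=> /unitaryE hA /unitaryE hD; apply/unitaryE.
by rewrite starM mulmxA -[A *m D *m _]mulmxA hD mulmx1.
Qed.

Lemma unitary_star (A : M) : unitary A -> unitary (star A).
Proof. by move=> hA; apply/unitaryE; rewrite starK unitary_star_mul. Qed.

Lemma UB1 B : UB B (1%:M : M).
Proof. by split=> [|i j _]; [exact: unitary1|rewrite mxE]. Qed.

Lemma UB_unitary B (A : M) : UB B A -> unitary A. Proof. by case. Qed.

Lemma UB_star B (A : M) : UB B A -> UB B (star A).
Proof.
move=> [uA hA]; split; first exact: unitary_star.
by move=> i j hij; rewrite starE hA 1?orbC// eq_sym rmorph_nat.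
Qed.

Lemma UBM B (A D : M) : UB B A -> UB B D -> UB B (A *m D).
Proof.
move=> [uA hA] [uD hD]; split; first exact: unitaryM.
move=> i j /orP[hi|hj].
  rewrite mxE (bigD1 i)//= hA ?hi// eqxx mul1r big1 ?addr0; last first.
    by move=> k ki; rewrite hA ?hi// eq_sym (negbTE ki) mul0r.
  by rewrite hD// hi.
rewrite mxE (bigD1 j)//= hD ?hj ?orbT// eqxx mulr1 big1 ?addr0; last first.
  by move=> k ki; rewrite hD ?hj ?orbT// (negbTE ki) mulr0.
by rewrite hA// hj orbT.
Qed.

Lemma UB_sub B1 B2 (A : M) : B1 \subset B2 -> UB B1 A -> UB B2 A.
Proof.
move=> s [uA hA]; split=> // i j /orP[hi|hj]; apply: hA.
  by rewrite (contra (fintype.subsetP s _) hi).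
by rewrite (contra (fintype.subsetP s _) hj) orbT.
Qed.

Lemma UB_setT (A : M) : unitary A -> UB (finset.setT : {set 'I_n}) A.
Proof. by move=> uA; split=> // i j; rewrite !inE. Qed.

Lemma unitary_entry_le (A : M) i j : unitary A -> `|A i j| <= 1.
Proof.
move=> /unitaryE/matrixP/(_ i i); rewrite !mxE eqxx mulr1n => h.
rewrite -(@expr_le1 _ 2)// -h (bigD1 j)//= starE -normCK lerDl.
by apply: sumr_ge0 => k _; rewrite starE -normCK exprn_ge0.
Qed.

Lemma normr_Re_le (z : C) : (`|Re z|%:C)%C <= `|z|.
Proof. exact: normc_ge_Re. Qed.

Lemma normr_Im_le (z : C) : (`|Im z|%:C)%C <= `|z|.
Proof.
have := normc_ge_Re (z * 'i%C); rewrite normrM ReiNIm normrN => /le_trans; apply.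
suff -> : `|'i%C : C| = 1 by rewrite mulr1.
by rewrite normc_def/= expr0n/= add0r expr1n sqrtr1.
Qed.

Lemma measurable_Re_entry i j : measurable_fun setT (fun A : T => Re (A i j)).
Proof.
move=> _ S mS; rewrite setTI; apply: sub_sigma_algebra.
by exists i, j, true, S.
Qed.

Lemma measurable_Im_entry i j : measurable_fun setT (fun A : T => Im (A i j)).
Proof.
move=> _ S mS; rewrite setTI; apply: sub_sigma_algebra.
by exists i, j, false, S.
Qed.

Definition cmeas (D : set T) f :=
  measurable_fun D (fun A : T => Re (f A)) /\
  measurable_fun D (fun A : T => Im (f A)).

Lemma cmeas_entry D i j : cmeas D (fun A => A i j).
Proof.
by split; apply: measurable_funTS;
   [exact: measurable_Re_entry|exact: measurable_Im_entry].
Qed.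

Lemma cmeas_cst D c : cmeas D (fun=> c).
Proof. by split; exact: measurable_cst. Qed.

Lemma cmeasD D f h : cmeas D f -> cmeas D h -> cmeas D (fun A => f A + h A).
Proof.
move=> [f1 f2] [h1 h2]; split.
  by under eq_fun do rewrite raddfD; exact: measurable_funD.
by under eq_fun do rewrite raddfD; exact: measurable_funD.
Qed.

Lemma ReM (x y : C) : Re (x * y) = Re x * Re y - Im x * Im y.
Proof. by case: x y => a b [c d]. Qed.

Lemma ImM (x y : C) : Im (x * y) = Re x * Im y + Im x * Re y.
Proof. by case: x y => a b [c d]. Qed.

Lemma ReJ (x : C) : Re (x^*) = Re x. Proof. by case: x. Qed.
Lemma ImJ (x : C) : Im (x^*) = - Im x. Proof. by case: x. Qed.

Lemma cmeasM D f h : cmeas D f -> cmeas D h -> cmeas D (fun A => f A * h A).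
Proof.
move=> [f1 f2] [h1 h2]; split.
  under eq_fun do rewrite ReM.
  by apply: measurable_funB; apply: measurable_funM.
under eq_fun do rewrite ImM.
by apply: measurable_funD; apply: measurable_funM.
Qed.

Lemma cmeasJ D f : cmeas D f -> cmeas D (fun A => (f A)^*).
Proof.
move=> [f1 f2]; split.
  by under eq_fun do rewrite ReJ.
by under eq_fun do rewrite ImJ; exact: measurable_funN.
Qed.

Lemma cmeas_sum D (I : Type) (s : seq I) (F : I -> M -> C) :
  (forall i, cmeas D (F i)) -> cmeas D (fun A => \sum_(i <- s) F i A).
Proof.
move=> h; elim: s => [|i s IH].
  by under [fun A => _]eq_fun do rewrite big_nil; exact: cmeas_cst.
by under [fun A => _]eq_fun do rewrite big_cons; exact: cmeasD.
Qed.

Lemma measurable_mx_fun (phi : T -> T) :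
  (forall i j, cmeas setT (fun A => phi A i j)) -> measurable_fun setT phi.
Proof.
move=> h; apply: (@measurability _ _ T T setT phi (mx_gen R n)) => //.
move=> _ [_ [i [j [b [S [mS ->]]]]] <-].
by case: b; [have := (h i j).1 measurableT S mS|have := (h i j).2 measurableT S mS].
Qed.

Lemma measurable_lmul (g : M) : measurable_fun setT (fun A : T => g *m A : T).
Proof.
apply: measurable_mx_fun => i j.
under eq_fun do rewrite mxE; apply: cmeas_sum => k.
by apply: cmeasM; [exact: cmeas_cst|exact: cmeas_entry].
Qed.

Lemma measurable_star : measurable_fun setT (fun A : T => star A : T).
Proof.
apply: measurable_mx_fun => i j.
by under eq_fun do rewrite starE; apply: cmeasJ; exact: cmeas_entry.
Qed.

Lemma cmeas_level (F : M -> C) c : cmeas setT F ->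
  measurable ([set A | F A = c] : set T).
Proof.
move=> [h1 h2].
rewrite (_ : [set A | _] = ((fun A : T => Re (F A)) @^-1` [set Re c]) `&`
    ((fun A : T => Im (F A)) @^-1` [set Im c])).
  by apply: measurableI; rewrite -[X in measurable X]setTI;
     [apply: h1|apply: h2] => //; exact: measurable_set1.
apply/seteqP; split => A /= => [->//|[]].
by case: (F A) c => a b [a' b'] /= -> ->.
Qed.

Lemma measurable_levels (I : finType) (F : I -> M -> C) (c : I -> C) :
  (forall i, cmeas setT (F i)) ->
  measurable ([set A | forall i, F i A = c i] : set T).
Proof.
move=> h.
rewrite (_ : [set A | _] = \bigcap_(i in [set: I]) [set A | F i A = c i]).
  by apply: fin_bigcap_measurable => // i _; exact: cmeas_level.
by apply/seteqP; split => A /= hA i => [_|]; [exact: hA|exact: (hA i)].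
Qed.

Lemma measurable_unitary : measurable (unitary : set T).
Proof.
rewrite (_ : unitary = [set A : M | forall ij : 'I_n * 'I_n,
    (A *m star A) ij.1 ij.2 = (1%:M : M) ij.1 ij.2]).
  apply: measurable_levels => -[i j] /=.
  under eq_fun do rewrite mxE; apply: cmeas_sum => k.
  apply: cmeasM; first exact: cmeas_entry.
  under eq_fun do rewrite starE; apply: cmeasJ; exact: cmeas_entry.
apply/seteqP; split => A /= => [/unitaryE -> //|h].
by apply/unitaryE/matrixP => i j; exact: (h (i, j)).
Qed.

Lemma measurable_UB B : measurable (UB B : set T).
Proof.
(* Index pairs inside [B] carry the vacuous equation 0 = 0, so that the set is a finite intersection
   of level sets. *)
rewrite (_ : UB B = unitary `&` [set A : M | forall ij : 'I_n * 'I_n,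
   (if (ij.1 \notin B) || (ij.2 \notin B) then A ij.1 ij.2 else 0) =
   (if (ij.1 \notin B) || (ij.2 \notin B) then (ij.1 == ij.2)%:R else 0)]).
  apply: measurableI; first exact: measurable_unitary.
  apply: measurable_levels => -[i j] /=.
  by case: ((i \notin B) || (j \notin B)); [exact: cmeas_entry|exact: cmeas_cst].
apply/seteqP; split => A /= [uA h]; split => //.
  by move=> -[i j] /=; case: ifP => // /h.
by move=> i j hij; have := h (i, j); rewrite /= hij.
Qed.

(** The integrands for which means over [UB B] behave linearly. Only values on [UB B] are
    constrained, since a representation is arbitrary off the unitary group. *)
Definition bmf B f :=
  cmeas (UB B) f /\
  exists r : R, forall A, UB B A -> `|Re (f A)| <= r /\ `|Im (f A)| <= r.

Lemma bmf_bound B f (r : R) : cmeas (UB B) f ->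
  (forall A, UB B A -> `|f A| <= (r%:C)%C) -> bmf B f.
Proof.
move=> mf h; split=> //; exists r => A uA; rewrite -!lecR.
by split; apply: le_trans (h A uA); [exact: normr_Re_le|exact: normr_Im_le].
Qed.

Lemma bmf_norm_bound B f : bmf B f ->
  exists2 r : R, 0 <= r & forall A, UB B A -> `|f A| <= (r%:C)%C.
Proof.
move=> [_ [r h]]; exists (`|r| + `|r|); first exact: addr_ge0.
move=> A uA; have [h1 h2] := h A uA.
rewrite [f A]complexE (le_trans (ler_normD _ _))// rmorphD lerD//.
  rewrite normc_def/= expr0n/= addr0 sqrtr_sqr lecR.
  exact: le_trans h1 (ler_norm _).
rewrite normrM (_ : `|'i%C : C| = 1) ?mul1r; last first.
  by rewrite normc_def/= expr0n/= add0r expr1n sqrtr1.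
rewrite normc_def/= expr0n/= addr0 sqrtr_sqr lecR.
exact: le_trans h2 (ler_norm _).
Qed.

Lemma bmf_cst B c : bmf B (fun=> c).
Proof.
split; first exact: cmeas_cst.
exists (`|Re c| + `|Im c|) => A _; split; first by rewrite lerDl.
by rewrite lerDr.
Qed.

Lemma bmf_entry B i j : bmf B (fun A => A i j).
Proof.
apply: (@bmf_bound _ _ 1); first exact: cmeas_entry.
by move=> A [uA _]; exact: unitary_entry_le.
Qed.

Lemma bmfD B f h : bmf B f -> bmf B h -> bmf B (fun A => f A + h A).
Proof.
move=> bf bh; have [r _ hr] := bmf_norm_bound bf.
have [s _ hs] := bmf_norm_bound bh.
apply: (@bmf_bound _ _ (r + s)); first exact: cmeasD bf.1 bh.1.
by move=> A uA; rewrite rmorphD (le_trans (ler_normD _ _))// lerD ?hr ?hs.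
Qed.

Lemma bmfM B f h : bmf B f -> bmf B h -> bmf B (fun A => f A * h A).
Proof.
move=> bf bh; have [r _ hr] := bmf_norm_bound bf.
have [s _ hs] := bmf_norm_bound bh.
apply: (@bmf_bound _ _ (r * s)); first exact: cmeasM bf.1 bh.1.
by move=> A uA; rewrite rmorphM normrM ler_pM ?hr ?hs.
Qed.

Lemma bmfJ B f : bmf B f -> bmf B (fun A => (f A)^*).
Proof.
move=> bf; have [r _ hr] := bmf_norm_bound bf.
apply: (@bmf_bound _ _ r); first exact: cmeasJ bf.1.
by move=> A uA; rewrite norm_conjC hr.
Qed.

Lemma bmf_sum B (I : Type) (s : seq I) (F : I -> M -> C) :
  (forall i, bmf B (F i)) -> bmf B (fun A => \sum_(i <- s) F i A).
Proof.
move=> h; elim: s => [|i s IH].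
  by under [fun A => _]eq_fun do rewrite big_nil; exact: bmf_cst.
by under [fun A => _]eq_fun do rewrite big_cons; exact: bmfD.
Qed.

Lemma bmfX B f k : bmf B f -> bmf B (fun A => f A ^+ k).
Proof.
move=> bf; elim: k => [|k IH].
  by under [fun A => _]eq_fun do rewrite expr0; exact: bmf_cst.
by under [fun A => _]eq_fun do rewrite exprS; exact: bmfM.
Qed.

Lemma cmeas_comp B f (phi : T -> T) : measurable_fun setT phi ->
  (forall A, UB B A -> UB B (phi A)) -> cmeas (UB B) f ->
  cmeas (UB B) (fun A => f (phi A)).
Proof.
move=> mphi sub [m1 m2]; split.
  apply: (@measurable_comp _ _ _ T T R (UB B) (fun A : T => Re (f A)) (UB B) phi) => //.
  - exact: measurable_UB.
  - by move=> _ [A uA <-]; exact: sub.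
  - exact: measurable_funTS.
apply: (@measurable_comp _ _ _ T T R (UB B) (fun A : T => Im (f A)) (UB B) phi) => //.
- exact: measurable_UB.
- by move=> _ [A uA <-]; exact: sub.
- exact: measurable_funTS.
Qed.

Lemma bmf_comp B f (phi : T -> T) : measurable_fun setT phi ->
  (forall A, UB B A -> UB B (phi A)) -> bmf B f -> bmf B (fun A => f (phi A)).
Proof.
move=> mphi sub [mf [r h]]; split; first exact: cmeas_comp.
by exists r => A uA; apply: h; exact: sub.
Qed.

Lemma bmf_star B f : bmf B f -> bmf B (fun A => f (star A)).
Proof. by apply: bmf_comp => [|A]; [exact: measurable_star|exact: UB_star]. Qed.

End Haar.

Section HaarMean.
Context {R : realType} {n : nat}.
Local Notation C := R[i].
Local Notation M := 'M[C]_n.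
Local Notation T := (mxT R n).
Local Notation Re := complex.Re.
Local Notation Im := complex.Im.

Definition cint (mu : probability T R) (f : M -> C) : C :=
  Complex (Rintegral mu setT (fun A : T => Re (f A)))
          (Rintegral mu setT (fun A : T => Im (f A))).

Variables (B : {set 'I_n}) (mu : probability T R).
Hypothesis hmu : is_haar B mu.

Lemma haar_conull : mu (~` (UB B : set T)) = 0%E.
Proof.
apply: hmu.1; first by apply: measurableC; exact: measurable_UB.
by rewrite setICl.
Qed.

Lemma haar_UB : mu (UB B : set T) = 1%E.
Proof.
have := @probability_setT _ _ _ mu.
rewrite -(setUv (UB B : set T)) measureU; last 3 first.
- exact: measurable_UB.
- by apply: measurableC; exact: measurable_UB.
- by rewrite setICr.
by rewrite [X in (_ + X)%E](_ : _ = 0%E) ?adde0//; exact: haar_conull.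
Qed.

Lemma Rint_UB (f : T -> R) :
  Rintegral mu setT f = Rintegral mu (UB B : set T) f.
Proof.
rewrite /Rintegral (integral_conull (U := (UB B : set T)))//.
  exact: measurable_UB.
exact: haar_conull.
Qed.

Lemma bounded_integrable_UB (f : T -> R) (r : R) :
  measurable_fun (UB B : set T) f -> (forall A, UB B A -> `|f A| <= r) ->
  mu.-integrable (UB B : set T) (EFin \o f).
Proof.
move=> mf h; apply: measurable_bounded_integrable => //.
- exact: measurable_UB.
- by rewrite [X in (X < _)%E](_ : _ = 1%E) ?ltry//; exact: haar_UB.
- exists r; split; first exact: num_real.
  by move=> y ry A uA; exact: le_trans (h A uA) (ltW ry).
Qed.

Lemma bmf_integrable_Re (f : M -> C) : bmf B f ->
  mu.-integrable (UB B : set T) (EFin \o (fun A : T => Re (f A))).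
Proof.
by move=> [[m _] [r h]]; apply: (@bounded_integrable_UB _ r) => // A /h[].
Qed.

Lemma bmf_integrable_Im (f : M -> C) : bmf B f ->
  mu.-integrable (UB B : set T) (EFin \o (fun A : T => Im (f A))).
Proof.
by move=> [[_ m] [r h]]; apply: (@bounded_integrable_UB _ r) => // A /h[].
Qed.

Lemma eq_cint (f h : M -> C) : (forall A, UB B A -> f A = h A) ->
  cint mu f = cint mu h.
Proof.
move=> e; rewrite /cint !Rint_UB.
by congr Complex; apply: eq_Rintegral => A /set_mem /e ->.
Qed.

Lemma cintD (f h : M -> C) : bmf B f -> bmf B h ->
  cint mu (fun A => f A + h A) = cint mu f + cint mu h.
Proof.
move=> bf bh; rewrite /cint !Rint_UB.
have mU := measurable_UB (R := R) B.
rewrite -[RHS]/(Complex _ _) /= -!RintegralD//.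
- by congr Complex; apply: eq_Rintegral => A _; case: (f A) (h A) => ? ? [].
- exact: bmf_integrable_Im.
- exact: bmf_integrable_Im.
- exact: bmf_integrable_Re.
- exact: bmf_integrable_Re.
Qed.

Lemma cintZ (c : C) (f : M -> C) : bmf B f ->
  cint mu (fun A => c * f A) = c * cint mu f.
Proof.
move=> bf; rewrite /cint !Rint_UB.
have mU := measurable_UB (R := R) B.
have iR := bmf_integrable_Re bf; have iI := bmf_integrable_Im bf.
have bc := bmfM (bmf_cst B c) bf.
case: c bc => a b bc; rewrite -[RHS]/(Complex _ _) /=.
rewrite -!RintegralZl// -?RintegralB// -?RintegralD//; last 4 first.
- exact: (integrableZl mU a iI).
- exact: (integrableZl mU b iR).
- exact: (integrableZl mU a iR).
- exact: (integrableZl mU b iI).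
congr Complex; apply: eq_Rintegral => A _; case: (f A) => //= x y.
Qed.

Lemma cint_cst (c : C) : cint mu (fun=> c) = c.
Proof.
rewrite /cint !Rint_UB !Rintegral_cst; last 2 first.
- exact: measurable_UB.
- exact: measurable_UB.
by rewrite [X in fine X](_ : _ = 1%E) ?mulr1; [case: c|exact: haar_UB].
Qed.

Lemma cintZr (c : C) (f : M -> C) : bmf B f ->
  cint mu (fun A => f A * c) = cint mu f * c.
Proof.
move=> bf; rewrite mulrC -cintZ//.
by congr cint; apply/funext => A; rewrite mulrC.
Qed.

Lemma cint_sum (I : Type) (s : seq I) (F : I -> M -> C) :
  (forall i, bmf B (F i)) ->
  cint mu (fun A => \sum_(i <- s) F i A) = \sum_(i <- s) cint mu (F i).
Proof.
move=> h; elim: s => [|i s IH].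
  under [fun A => _]eq_fun do rewrite big_nil.
  by rewrite big_nil cint_cst.
under [fun A => _]eq_fun do rewrite big_cons.
by rewrite big_cons cintD ?IH//; exact: bmf_sum.
Qed.

Lemma cintJ (f : M -> C) : bmf B f ->
  cint mu (fun A => (f A)^*) = (cint mu f)^*.
Proof.
move=> bf; rewrite /cint.
under [X in Complex X _]eq_Rintegral do rewrite ReJ.
under [X in Complex _ X]eq_Rintegral do rewrite ImJ -mulN1r.
rewrite !Rint_UB RintegralZl//; last first.
  exact: bmf_integrable_Im.
  exact: measurable_UB.
by rewrite mulN1r.
Qed.

Lemma cint_ge0 (f : M -> C) : (forall A, UB B A -> 0 <= f A) ->
  0 <= cint mu f.
Proof.
move=> f0; rewrite /cint !Rint_UB.
have -> : Rintegral mu (UB B : set T) (fun A : T => Im (f A)) = 0.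
  transitivity (Rintegral mu (UB B : set T) (cst 0)).
    by apply: eq_Rintegral => A /set_mem /f0 /ger0_Im ->.
  by rewrite Rintegral_cst ?mul0r//; exact: measurable_UB.
rewrite lecE/= eqxx/=; apply: Rintegral_ge0 => A /f0.
by rewrite lecE/= => /andP[].
Qed.

Lemma cint_lmul (g : M) (f : M -> C) : UB B g -> bmf B f ->
  cint mu (fun A => f (g *m A)) = cint mu f.
Proof.
move=> ug bf.
have inv (F : T -> R) (r : R) : measurable_fun (UB B : set T) F ->
    (forall A, UB B A -> `|F A| <= r) ->
    Rintegral mu (UB B : set T) (fun A : T => F (g *m A : T)) =
    Rintegral mu (UB B : set T) F.
  (* The change of variables asks for a function measurable on the whole space, so [F] is first
     extended by zero; the extension has the same integral because [UB B] has full measure. *)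
  move=> mF hF; pose F' : T -> R := patch (fun=> 0) (UB B : set T) F.
  have mF' : measurable_fun setT F'.
    by apply/(measurable_restrictT _ _).1 => //; exact: measurable_UB.
  have F'r A : `|F' A| <= Num.max r 0.
    rewrite /F' /patch; case: ifPn => [/set_mem/hF h|_].
      by rewrite le_max h.
    by rewrite normr0 le_max lexx orbT.
  have e1 A : (UB B : set T) A -> F A = F' A.
    by move=> uA; rewrite /F' /patch mem_set.
  transitivity (Rintegral mu setT (fun A : T => F' (g *m A : T))).
    rewrite Rint_UB; apply: eq_Rintegral => A /set_mem uA.
    by apply: e1; exact: UBM.
  transitivity (Rintegral mu setT F'); last first.
    rewrite Rint_UB; apply: eq_Rintegral => A /set_mem uA.
    exact/esym/e1.
  rewrite /Rintegral; congr fine.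
  have mT : measurable (setT : set T) by exact: measurableT.
  have mEF : measurable_fun setT (EFin \o F') by exact/measurable_EFinP.
  have iF : mu.-integrable setT ((EFin \o F') \o (fun A : T => g *m A : T)).
    apply: measurable_bounded_integrable => //.
    - by rewrite [X in (X < _)%E](_ : _ = 1%E) ?ltry//; exact: probability_setT.
    - exact: (measurableT_comp mF' (measurable_lmul g)).
    - exists (Num.max r 0); split; first exact: num_real.
      by move=> y ry A _; exact: le_trans (F'r _) (ltW ry).
  have := @integral_pushforward _ _ T T R (fun A : T => g *m A : T)
    (measurable_lmul g) mu setT (EFin \o F') mEF iF mT.
  rewrite preimage_setT => <-; apply: (eq_measure_integral mu) => [|mphi S mS _]; first exact: measurable_lmul.
  exact: (hmu.2 g ug S mS).
have [[m1 m2] [r h]] := bf.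
rewrite /cint !Rint_UB.
rewrite (inv (fun A : T => Re (f A)) r m1) ?(inv (fun A : T => Im (f A)) r m2)//.
- by move=> A /h[].
- by move=> A /h[].
Qed.

End HaarMean.

Section BoundedRep.
Context {R : realType} {n : nat}.
Local Notation C := R[i].
Local Notation M := 'M[C]_n.
Local Notation T := (mxT R n).
Local Notation Re := complex.Re.
Local Notation Im := complex.Im.
Local Notation full := (finset.setT : {set 'I_n}).

Variables (d : nat) (rho : M -> 'M[C]_d).
Hypothesis hrho : is_rep rho.

Lemma rep1 : rho 1%:M = 1%:M. Proof. by case: hrho. Qed.

Lemma repM A D : unitary A -> unitary D -> rho (A *m D) = rho A *m rho D.
Proof. by case: hrho => _ [h _]; exact: h. Qed.

Lemma rep_star_mul A : unitary A -> rho (star A) *m rho A = 1%:M.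
Proof.
move=> uA; rewrite -repM//; last exact: unitary_star.
by rewrite unitary_star_mul// rep1.
Qed.

Lemma rep_mul_star A : unitary A -> rho A *m rho (star A) = 1%:M.
Proof. by move=> /rep_star_mul/mulmx1C. Qed.

Lemma rep_cmeas B k l : cmeas (UB B) (fun A => rho A k l).
Proof.
have [_ [_ /(_ k l) [h1 h2]]] := hrho.
have mU := measurable_unitary (R := R) (n := n).
have sub : (UB B : set T) `<=` unitary by move=> A [].
by split; [exact: measurable_funS mU sub h1|exact: measurable_funS mU sub h2].
Qed.

(** The adjoint is measured as well because an element will be recovered as (A x) x^-1 with [A x]
    and [x] both of bounded size, and x^-1 is the adjoint of [x]. *)
Let size (A : M) : R := \sum_k \sum_l
  (`|Re (rho A k l)| + `|Im (rho A k l)| +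
   (`|Re (rho (star A) k l)| + `|Im (rho (star A) k l)|)).

Let msize : measurable_fun (UB full : set T) size.
Proof.
apply: measurable_sum => k; apply: measurable_sum => l.
have h := rep_cmeas full k l.
have h' : cmeas (UB full) (fun A => rho (star A) k l).
  apply: (cmeas_comp (f := fun A => rho A k l)) => //.
    exact: measurable_star.
  by move=> A; exact: UB_star.
have nm (f : T -> R) : measurable_fun (UB full : set T) f ->
    measurable_fun (UB full : set T) (fun A => `|f A|).
  by move=> mf; exact: (measurableT_comp (@normr_measurable R setT) mf).
by apply: measurable_funD; apply: measurable_funD; apply: nm;
   [case: h|case: h|case: h'|case: h'].
Qed.

Let size_ge A k l : `|rho A k l| <= ((size A)%:C)%C /\
  `|rho (star A) k l| <= ((size A)%:C)%C.
Proof.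
have nle (z : C) : `|z| <= ((`|Re z| + `|Im z|)%:C)%C.
  rewrite {1}[z]complexE (le_trans (ler_normD _ _))// rmorphD lerD//.
    by rewrite normc_def/= expr0n/= addr0 sqrtr_sqr lecR.
  rewrite normrM (_ : `|'i%C : C| = 1) ?mul1r; last first.
    by rewrite normc_def/= expr0n/= add0r expr1n sqrtr1.
  by rewrite normc_def/= expr0n/= addr0 sqrtr_sqr lecR.
have s0 k' l' : 0 <= `|Re (rho A k' l')| + `|Im (rho A k' l')| +
   (`|Re (rho (star A) k' l')| + `|Im (rho (star A) k' l')|).
  by rewrite !addr_ge0.
have le : `|Re (rho A k l)| + `|Im (rho A k l)| +
   (`|Re (rho (star A) k l)| + `|Im (rho (star A) k l)|) <= size A.
  rewrite /size (bigD1 k)//= (bigD1 l)//= -[leRHS]addrA lerDl addr_ge0//.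
    exact: sumr_ge0.
  by apply: sumr_ge0 => k' _; apply: sumr_ge0.
split; apply: le_trans (nle _) _; rewrite lecR; apply: le_trans le.
  by rewrite lerDl addr_ge0.
by rewrite lerDr addr_ge0.
Qed.

(* If more than half of the group lies in E, then every group element is a
   quotient of two elements of E. *)
Lemma rep_bounded (mu : probability T R) : is_haar full mu ->
  exists2 r : R, 0 <= r & forall A k l, unitary A -> `|rho A k l| <= (r%:C)%C.
Proof.
move=> hmu.
pose E (N : nat) : set T := UB full `&` [set A : T | size A <= N%:R].
have mE N : measurable (E N).
  rewrite (_ : E N = UB full `&` size @^-1` [set` `]-oo, N%:R]]).
    by apply: (msize (measurable_UB _)); exact: measurable_itv.
  by congr (_ `&` _); apply/seteqP; split => A /=; rewrite in_itv.
have ndE : {homo E : a b / (a <= b)%N >-> (a <= b)%O}.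
  move=> a b ab; apply/subsetPset => A [uA hA]; split=> //=.
  by rewrite (le_trans hA)// ler_nat.
have uE : \bigcup_N E N = (UB full : set T).
  apply/seteqP; split=> [A [N _ []]//|A uA].
  exists (Num.bound `|size A|) => //; split=> //=.
  apply: le_trans (ler_norm _) (ltW _); exact: archi_boundP.
have [N hN] : exists N, (2^-1%:E < mu (E N))%E.
  have := @nondecreasing_cvg_mu _ _ _ mu E mE.
  rewrite uE => /(_ (measurable_UB _) ndE).
  rewrite [X in _ --> X](_ : _ = 1%E); last exact: haar_UB.
  move=> /fine_cvgP[_ /cvgrPdist_lt/(_ 2^-1)].
  rewrite invr_gt0 ltr0n => /(_ isT) [N _ /(_ N (leqnn N))] /=.
  move=> h; exists N; move: h.
  have fN : mu (E N) \is a fin_num by exact: fin_num_measure.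
  rewrite -[mu (E N)]fineK// lte_fin/= ltr_norml => /andP[_].
  by move: (fine _) => x; lra.
exists (\sum_(i < d) N%:R * N%:R); first by apply: sumr_ge0 => i _; exact: mulr_ge0.
move=> A k l uA.
have [x [[ux hx] [uAx hAx]]] : exists x, E N x /\ E N (A *m x).
  apply: contrapT => hno.
  have mE' : measurable ([set x : T | E N (A *m x)]).
    by rewrite -[X in measurable X]setTI; apply: measurable_lmul.
  have e : mu [set x : T | E N (A *m x)] = mu (E N).
    by apply: hmu.2 => //; exact: UB_setT.
  have dis : E N `&` [set x : T | E N (A *m x)] = set0.
    by rewrite -subset0 => x [h1 h2]; apply: hno; exists x.
  have : (mu (E N `|` [set x : T | E N (A *m x)]) <= 1)%E.
    by apply: probability_le1; exact: measurableU.
  rewrite measureU// [X in (_ + X)%E]e leNgt => /negP; apply.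
  have -> : (1 = 2^-1%:E + 2^-1%:E :> \bar R)%E.
    by rewrite -EFinD; congr EFin; lra.
  exact: lteD.
have -> : rho A = rho (A *m x) *m rho (star x).
  have {}ux := ux.1.
  rewrite -repM ?mulmxA//; last 2 first.
  - exact: unitaryM.
  - exact: unitary_star.
  by rewrite -mulmxA ux mulmx1.
rewrite mxE rmorph_sum; apply: le_trans (ler_norm_sum _ _ _) _.
apply: ler_sum => i _; rewrite normrM rmorphM ler_pM//.
  by apply: le_trans (size_ge _ _ _).1 _; rewrite lecR.
by apply: le_trans (size_ge _ _ _).2 _; rewrite lecR.
Qed.

Lemma rep_bmf (mu : probability T R) B k l : is_haar full mu ->
  bmf B (fun A => rho A k l).
Proof.
move=> /rep_bounded[r _ h]; apply: (@bmf_bound _ _ _ _ r).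
  exact: rep_cmeas.
by move=> A [uA _]; exact: h.
Qed.

End BoundedRep.

(** * Polynomial approximation of a step function *)

Section BernsteinStep.
Import numFieldNormedType.Exports.
Context {R : realType}.

(** For s < 1, each of the [L] terms of the geometric sum (1 - s^L) / (1 - s) is at least s^L. This
    bounds L s^L independently of [L]. *)
Lemma mul_expr_le (s : R) (L : nat) : 0 <= s <= 1 ->
  (1 - s) * (L%:R * s ^+ L) <= 1 - s ^+ L.
Proof.
move=> /andP[s0 s1]; elim: L => [|L IH]; first by rewrite mul0r mulr0 expr0 subrr.
have sL0 : 0 <= s ^+ L by exact: exprn_ge0.
have sL1 : s ^+ L.+1 <= 1 by exact: exprn_ile1.
have := ler_wpM2l s0 IH; rewrite exprS -natr1.
move: sL1; rewrite exprS; set u := s ^+ L; set v := L%:R => sL1 h.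
have : 0 <= (1 - s) * (1 - s * u) by rewrite mulr_ge0// subr_ge0.
nra.
Qed.

(** Chosen so that [step_exp L] times y^(2L) is L (2y)^(2L), which tends to 0 for 0 <= y < 1/2 and
    to infinity for y >= 1/2; the step thus sits at 1/2. *)
Definition step_exp (L : nat) := (L * 4 ^ L)%N.

Definition step_poly (L : nat) (y : R) : R := (1 - (y ^+ 2) ^+ L) ^+ step_exp L.

Lemma bernoulli_le (x : R) k : 0 <= x <= 1 -> 1 - k%:R * x <= (1 - x) ^+ k.
Proof.
move=> /andP[x0 x1]; elim: k => [|k IH]; first by rewrite mul0r subr0 expr0.
have := ler_wpM2l (_ : 0 <= 1 - x) IH; rewrite subr_ge0 => /(_ x1).
rewrite exprS -natr1; apply: le_trans.
have h : 0 <= k%:R * x * x by rewrite !mulr_ge0.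
by move: h; set v : R := k%:R; lra.
Qed.

(** Since (1 - x) (1 + (k+1) x) <= 1 + k x. It makes (1 - x)^k small when k x is large. *)
Lemma inv_bernoulli (x : R) k : 0 <= x <= 1 ->
  (1 - x) ^+ k * (1 + k%:R * x) <= 1.
Proof.
move=> /andP[x0 x1]; elim: k => [|k IH]; first by rewrite mul0r addr0 expr0 mulr1.
have e0 : 0 <= (1 - x) ^+ k by rewrite exprn_ge0// subr_ge0.
apply: le_trans IH; rewrite exprS -natr1 mulrAC mulrC ler_wpM2l//.
have h : 0 <= (k%:R : R) * x * x by rewrite !mulr_ge0.
by move: h; set v : R := k%:R; nra.
Qed.

Lemma step_poly_bounds L y : 0 <= y <= 1 -> 0 <= step_poly L y <= 1.
Proof.
move=> /andP[y0 y1].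
have h0 : 0 <= (y ^+ 2) ^+ L by rewrite exprn_ge0// exprn_ge0.
have h1 : (y ^+ 2) ^+ L <= 1 by rewrite exprn_ile1 ?exprn_ge0// exprn_ile1.
by rewrite /step_poly; apply/andP; split; [apply: exprn_ge0|apply: exprn_ile1]; lra.
Qed.

Lemma step_poly_cvg (y : R) : 0 <= y <= 1 ->
  step_poly L y @[L --> \oo] --> ((y < 2^-1)%R%:R : R).
Proof.
move=> y01; have /andP[y0 y1] := y01.
have z0 : 0 <= y ^+ 2 by exact: exprn_ge0.
have zL L : 0 <= (y ^+ 2) ^+ L <= 1.
  by rewrite exprn_ge0//= exprn_ile1// exprn_ile1.
have zE L : (step_exp L)%:R * (y ^+ 2) ^+ L = L%:R * ((2 * y) ^+ L) ^+ 2.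
  rewrite /step_exp natrM natrX -mulrA -exprMn; congr (_ * _).
  by rewrite -exprM mulnC exprM; congr (_ ^+ _); ring.
have [yl|yg] := ltP y 2^-1.
  have s0 : 0 <= 2 * y by lra.
  have s1 : 2 * y < 1 by lra.
  have hs : 0 < 1 - 2 * y by lra.
  (* With s = 2y < 1, Bernoulli gives the lower bound 1 - L s^(2L), and L s^L <= 1/(1 - s) leaves
     one factor s^L that tends to 0. *)
  apply: (@squeeze_cvgr _ _ _ _ (fun L => 1 - (1 - 2 * y)^-1 * (2 * y) ^+ L) (cst 1)).
  - near=> L; have /andP[_ ->] := step_poly_bounds L y01; rewrite andbT.
    apply: le_trans (bernoulli_le (step_exp L) (zL L)).
    rewrite lerD2l lerN2 zE expr2 mulrA ler_wpM2r ?exprn_ge0//.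
    rewrite -div1r ler_pdivlMr// mulrC.
    have : (1 - 2 * y) * (L%:R * (2 * y) ^+ L) <= 1 - (2 * y) ^+ L.
      by apply: mul_expr_le; rewrite s0 ltW.
    move=> /le_trans; apply; rewrite gerBl; exact: exprn_ge0.
  - rewrite -[X in _ --> X]subr0; apply: cvgB; first exact: cvg_cst.
    rewrite -[X in _ --> X](mulr0 (1 - 2 * y)^-1); apply: cvgMl_tmp.
    by apply: cvg_expr; rewrite ger0_norm.
  - exact: cvg_cst.
(* Here 2y >= 1, so the step polynomial is at most 1/(1 + L (2y)^(2L)) <= 1/(L + 1). *)
apply: (@squeeze_cvgr _ _ _ _ (cst 0) (fun L => harmonic L)).
- near=> L; have /andP[-> _] := step_poly_bounds L y01; rewrite /= /harmonic/=.
  have := inv_bernoulli (step_exp L) (zL L); rewrite zE -/(step_poly L y) => h.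
  have g1 : 1 <= ((2 * y) ^+ L) ^+ 2 by rewrite exprn_ege1// exprn_ege1//; lra.
  have s0 : 0 <= step_poly L y by have /andP[] := step_poly_bounds L y01.
  rewrite -div1r ler_pdivlMr ?ltr0n//; apply: le_trans h; rewrite ler_wpM2l//.
  by rewrite -natr1 addrC lerD2l ler_peMr.
- exact: cvg_cst.
- exact: cvg_harmonic.
Unshelve. all: by end_near.
Qed.

End BernsteinStep.

(** * Polynomiality of irreducible representations *)

Section Moments.
Import numFieldNormedType.Exports.
Context {R : realType} {n : nat}.
Local Notation C := R[i].
Local Notation M := 'M[C]_n.
Local Notation T := (mxT R n).
Local Notation Re := complex.Re.
Local Notation Im := complex.Im.
Local Notation full := (finset.setT : {set 'I_n}).
Local Notation U := (UB full : set T).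

Inductive rpoly : (M -> R) -> Prop :=
| rpoly_cst c : rpoly (fun=> c)
| rpoly_Re i j : rpoly (fun A => Re (A i j))
| rpoly_Im i j : rpoly (fun A => Im (A i j))
| rpolyD p q : rpoly p -> rpoly q -> rpoly (fun A => p A + q A)
| rpolyM p q : rpoly p -> rpoly q -> rpoly (fun A => p A * q A).

Lemma rpolyX p k : rpoly p -> rpoly (fun A => p A ^+ k).
Proof.
move=> hp; elim: k => [|k IH].
  by under [fun A => _]eq_fun do rewrite expr0; exact: rpoly_cst.
by under [fun A => _]eq_fun do rewrite exprS; exact: rpolyM.
Qed.

Definition rbm (f : M -> R) := measurable_fun U (f : T -> R) /\
  exists r : R, forall A, UB full A -> `|f A| <= r.

Lemma rbm_cst c : rbm (fun=> c).
Proof. by split; [exact: measurable_cst|exists `|c|]. Qed.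

Lemma rbmD f g : rbm f -> rbm g -> rbm (fun A => f A + g A).
Proof.
move=> [mf [r hr]] [mg [s hs]]; split; first exact: measurable_funD.
by exists (r + s) => A uA; apply: le_trans (ler_normD _ _) _; rewrite lerD ?hr ?hs.
Qed.

Lemma rbmM f g : rbm f -> rbm g -> rbm (fun A => f A * g A).
Proof.
move=> [mf [r hr]] [mg [s hs]]; split; first exact: measurable_funM.
by exists (r * s) => A uA; rewrite normrM ler_pM ?hr ?hs.
Qed.

Lemma rbm_poly p : rpoly p -> rbm p.
Proof.
elim=> {p} [c|i j|i j|p q _ hp _ hq|p q _ hp _ hq].
- exact: rbm_cst.
- have [[h _] [r hr]] := bmf_entry (R := R) full i j.
  by split=> //; exists r => A /hr[].
- have [[_ h] [r hr]] := bmf_entry (R := R) full i j.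
  by split=> //; exists r => A /hr[].
- exact: rbmD.
- exact: rbmM.
Qed.

Lemma rbm_indic (S : set T) : measurable S -> rbm (\1_S : M -> R).
Proof.
move=> mS; split; first exact/measurable_funTS/measurable_indic.
by exists 1 => A _; rewrite indicE; case: (_ \in _); rewrite ?normr1 ?normr0.
Qed.

Variables (mu : probability T R).
Hypothesis hmu : is_haar full mu.
Local Notation Int f := (Rintegral mu U (f : T -> R)).

Lemma rbm_integrable f : rbm f -> mu.-integrable U (EFin \o f).
Proof. by move=> [mf [r h]]; exact: (@bounded_integrable_UB _ _ _ _ hmu _ r). Qed.

Lemma IntD f g : rbm f -> rbm g -> Int (fun A => f A + g A) = Int f + Int g.
Proof.
move=> bf bg; apply: RintegralD; first exact: measurable_UB.
  exact: rbm_integrable.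
exact: rbm_integrable.
Qed.

Lemma IntB f g : rbm f -> rbm g -> Int (fun A => f A - g A) = Int f - Int g.
Proof.
move=> bf bg; apply: RintegralB; first exact: measurable_UB.
  exact: rbm_integrable.
exact: rbm_integrable.
Qed.

Lemma Int_cvg0 (h_ : nat -> M -> R) (h : M -> R) (r : R) :
  (forall N, measurable_fun U (h_ N : T -> R)) ->
  (forall N A, UB full A -> `|h_ N A| <= r) ->
  (forall A, UB full A -> h_ N A @[N --> \oo] --> h A) ->
  (forall N, Int (h_ N) = 0) ->
  [/\ measurable_fun U (h : T -> R), forall A, UB full A -> `|h A| <= r & Int h = 0].
Proof.
move=> mh hr hc h0.
have mU := measurable_UB (R := R) full.
have mlim : measurable_fun U (h : T -> R).
  by apply: (measurable_fun_cvg (h := fun N => h_ N : T -> R)).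
split=> //.
  move=> A uA; have /cvg_norm c := hc A uA.
  by apply: (cvgr_to_le c); apply: nearW => N; exact: hr.
have := @dominated_convergence _ T R mu U mU (fun N => EFin \o (h_ N : T -> R))
  (EFin \o (h : T -> R)) (cst r%:E).
move=> [].
- by move=> N; exact/measurable_EFinP.
- exact/measurable_EFinP.
- apply: aeW => A uA; apply/cvg_EFin; last exact: hc.
  exact: nearW.
- by apply: (bounded_integrable_UB hmu (f := cst r) (r := `|r|)).
- by apply: aeW => A N uA; rewrite /= lee_fin; exact: hr.
move=> _ _ hlim; rewrite /Rintegral.
have e N : (\int[mu]_(x in U) (EFin \o (h_ N : T -> R)) x = 0)%E.
  have : (\int[mu]_(x in U) (EFin \o (h_ N : T -> R)) x \is a fin_num)%E.
    apply: integrable_fin_num; first exact: mU.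
    by apply: rbm_integrable; split=> //; exists r; exact: hr.
  by move=> /fineK <-; have := h0 N; rewrite /Rintegral => ->.
have : (cst 0%E : nat -> \bar R) @ \oo --> (\int[mu]_(x in U) (EFin \o h) x)%E.
  by apply: cvg_trans hlim; apply: near_eq_cvg; apply: nearW => N; rewrite /= e.
by move=> /(cvg_unique _ (cvg_cst _)) <-.
Qed.

Variable f : M -> R.
Hypothesis bf : rbm f.

(** Multipliers that preserve the orthogonality of [f] to polynomials. They form a module over the
    polynomials, closed under bounded pointwise limits; the aim is to reach every measurable
    indicator from h = 1. *)
Definition orth (h : M -> R) :=
  rbm h /\ forall p, rpoly p -> Int (fun A => h A * p A * f A) = 0.

Lemma orthMp h p : orth h -> rpoly p -> orth (fun A => h A * p A).
Proof.
move=> [bh hh] hp; split; first exact/rbmM/rbm_poly.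
move=> q hq; rewrite -(hh _ (rpolyM hp hq)); congr Rintegral.
by apply/funext => A; rewrite !mulrA.
Qed.

Lemma orthB h h' : orth h -> orth h' -> orth (fun A => h A - h' A).
Proof.
move=> [bh hh] [bh' hh']; split.
  have -> : (fun A => h A - h' A) = (fun A => h A + (-1) * h' A).
    by apply/funext => A; rewrite mulN1r.
  exact/rbmD/rbmM/bh'/rbm_cst.
move=> p hp; have bp := rbm_poly hp.
rewrite -[RHS](subr0 0) -{1}(hh p hp) -{1}(hh' p hp) -IntB.
- by congr Rintegral; apply/funext => A; rewrite !mulrBl.
- exact/rbmM/bf/rbmM.
- exact/rbmM/bf/rbmM.
Qed.

Lemma orth_lim (h_ : nat -> M -> R) h r : (forall N, orth (h_ N)) ->
  (forall N A, UB full A -> `|h_ N A| <= r) ->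
  (forall A, UB full A -> h_ N A @[N --> \oo] --> h A) -> orth h.
Proof.
move=> oh hr hc.
have lim p : rpoly p -> rbm h /\ Int (fun A => h A * p A * f A) = 0.
  move=> hp; have [mpf [s hs]] := rbmM (rbm_poly hp) bf.
  have [||||_ _ e] := @Int_cvg0 (fun N A => h_ N A * p A * f A)
     (fun A => h A * p A * f A) (r * s).
  - by move=> N; have [] := rbmM (rbmM (oh N).1 (rbm_poly hp)) bf.
  - by move=> N A uA; rewrite -mulrA normrM ler_pM ?hr ?hs.
  - move=> A uA; under eq_fun do rewrite -mulrA.
    by rewrite -mulrA; apply: cvgMr_tmp; exact: hc.
  - by move=> N; exact: (oh N).2.
  split=> //; split.
    by apply: (measurable_fun_cvg (h := fun N => h_ N : T -> R)) => // N;
       exact: (oh N).1.1.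
  exists r => A uA; have /cvg_norm c := hc A uA.
  by apply: (cvgr_to_le c); apply: nearW => N; exact: hr.
split; first exact: (lim _ (rpoly_cst 0)).1.
by move=> p /lim[].
Qed.

(** Demanding this of every [h], not of h = 1 alone, makes these sets stable under intersection,
    because indicators multiply; hence they form a sigma-algebra at once. *)
Definition orth_set (S : set T) :=
  measurable S /\ forall h, orth h -> orth (fun A => h A * \1_S A).

Lemma orth_set0 : orth_set set0.
Proof.
split; first exact: measurable0.
move=> h oh; have := orthB oh oh; congr orth; apply/funext => A.
by rewrite indic0 mulr0 subrr.
Qed.

Lemma orth_setC S : orth_set S -> orth_set (~` S).
Proof.
move=> [mS hS]; split; first exact: measurableC.
move=> h oh; have := orthB oh (hS h oh); congr orth; apply/funext => A.
rewrite !indicE in_setC; case: (A \in S); rewrite /= ?mulr1 ?mulr0 ?subrr//.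
by rewrite subr0.
Qed.

Lemma orth_set_bigcup (S : nat -> set T) :
  (forall k, orth_set (S k)) -> orth_set (\bigcup_k S k).
Proof.
move=> oS; suff oC : orth_set (~` \bigcup_k S k) by rewrite -[X in orth_set X]setCK; exact: orth_setC.
split; first by apply/measurableC/bigcupT_measurable => k; exact: (oS k).1.
move=> h oh; have [_ [r hr]] := oh.1.
(* The indicator of the complement of the union is the pointwise limit of finite products of
   indicators, all bounded by 1. *)
pose h_ N A := h A * \prod_(k < N) (\1_(~` S k) A : R).
have prod01 N A : \prod_(k < N) (\1_(~` S k) A : R) = (A \in ~` \big[setU/set0]_(k < N) S k)%:R.
  elim: N => [|N IH]; first by rewrite !big_ord0 setC0 in_setT.
  rewrite !big_ord_recr/= IH indicE setCU in_setI -natrM.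
  by rewrite mulnb.
apply: (@orth_lim h_ _ r).
- move=> N; rewrite /h_; elim: N => [|N IH].
    by under [fun A => _]eq_fun do rewrite big_ord0 mulr1.
  under [fun A => _]eq_fun do rewrite big_ord_recr/= mulrA.
  exact: (orth_setC (oS N)).2.
- move=> N A uA; rewrite /h_ prod01 normrM; apply: le_trans (hr A uA).
  by rewrite ler_piMr//; case: (_ \in _); rewrite ?normr1 ?normr0.
- move=> A uA; rewrite /h_; apply: cvgMl_tmp; rewrite indicE.
  have [/set_mem hA|] := boolP (A \in ~` \bigcup_k S k).
    apply: cvg_near_cst; apply: nearW => N; rewrite prod01 mem_set//.
    by move=> /= hb; apply: hA; move: hb; rewrite -bigcup_mkord => -[k _ Sk]; exists k.
  rewrite in_setC negbK => /set_mem[k _ Sk].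
  apply: cvg_near_cst; exists k.+1 => // N /= kN.
  rewrite prod01 memNset//= => /= hb; apply: hb.
  by rewrite -bigcup_mkord; exists k.
Qed.

Lemma orth_sigma_algebra : sigma_algebra setT orth_set.
Proof.
split; first exact: orth_set0.
- by move=> S hS; rewrite setTD; exact: orth_setC.
- exact: orth_set_bigcup.
Qed.

(* Polynomials approximate the indicator of a half-line, boundedly. *)
Lemma orth_set_ray (X : M -> R) (a : R) : rpoly X ->
  (forall A, UB full A -> `|X A| <= 1) -> measurable_fun setT (X : T -> R) ->
  orth_set (X @^-1` `]-oo, a[).
Proof.
move=> hX X1 mX; split.
  by rewrite -[X in measurable X]setTI; apply: mX => //; exact: measurable_itv.
move=> h oh; have [_ [r hr]] := oh.1.
(* An affine change of [X] that maps [-1, 1] into [0, 1] and the threshold [a] to 1/2, where the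
   step polynomials jump. *)
pose y A := 2^-1 + (X A - a) * (2 * (1 + `|a|))^-1.
have a0 : 0 < 1 + `|a| by rewrite ltr_pwDl.
have y01 A : UB full A -> 0 <= y A <= 1.
  move=> uA; have : `|X A - a| <= 1 + `|a|.
    by apply: le_trans (ler_normB _ _) _; rewrite lerD2r X1.
  rewrite ler_norml => /andP[h1 h2].
  have e : (X A - a) * (2 * (1 + `|a|))^-1 = (X A - a) / (1 + `|a|) * 2^-1.
    by rewrite invfM; ring.
  have : -1 <= (X A - a) / (1 + `|a|) by rewrite ler_pdivlMr// mulN1r.
  have : (X A - a) / (1 + `|a|) <= 1 by rewrite ler_pdivrMr// mul1r.
  by rewrite /y e; move: (_ / _) => u ? ?; apply/andP; split; lra.
have hy : rpoly y.
  by apply: rpolyD; [exact: rpoly_cst|]; apply: rpolyM; [|exact: rpoly_cst];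
     apply: rpolyD; [|exact: rpoly_cst].
have yE A : (y A < 2^-1) = (A \in X @^-1` `]-oo, a[).
  rewrite /y -{2}[2^-1]addr0 ltrD2l pmulr_llt0 ?invr_gt0 ?mulr_gt0// subr_lt0.
  by apply/idP/idP => [?|/set_mem]; [apply/mem_set|]; rewrite /= in_itv.
apply: (@orth_lim (fun L A => h A * step_poly L (y A)) _ r).
- move=> L; apply: orthMp => //; apply: rpolyX.
  have -> : (fun A => 1 - (y A ^+ 2) ^+ L) = (fun A => 1 + (-1) * (y A ^+ 2) ^+ L).
    by apply/funext => A; rewrite mulN1r.
  apply: rpolyD; first exact: rpoly_cst.
  apply: rpolyM; first exact: rpoly_cst.
  exact/rpolyX/rpolyX.
- move=> L A uA; rewrite normrM; apply: le_trans (hr A uA).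
  have /andP[s0 s1] := step_poly_bounds L (y01 A uA).
  by rewrite ler_piMr// ger0_norm.
- move=> A uA; apply: cvgMl_tmp; rewrite indicE -yE.
  exact: step_poly_cvg (y01 A uA).
Qed.

Lemma orth_set_coord (X : M -> R) : rpoly X ->
  (forall A, UB full A -> `|X A| <= 1) -> measurable_fun setT (X : T -> R) ->
  forall S : set R, measurable S -> orth_set (X @^-1` S).
Proof.
move=> hX X1 mX S mS.
have e := congr1 (fun G : set (set R) => G S) (RGenInftyO.measurableE R).
have : <<s (@RGenInftyO.G R) >> S := eq_ind _ id mS _ e.
apply: (@smallest_sub _ (sigma_algebra setT) _ [set S : set R | orth_set (X @^-1` S)]).
  split.
  - by rewrite /= preimage_set0; exact: orth_set0.
  - by move=> A oA; rewrite /= setTD preimage_setC; exact: orth_setC.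
  - by move=> A oA; rewrite /= preimage_bigcup; exact: orth_set_bigcup.
by move=> _ [a ->]; exact: orth_set_ray.
Qed.

Lemma orth_set_measurable (S : set T) : measurable S -> orth_set S.
Proof.
apply: (@smallest_sub _ (sigma_algebra setT) _ orth_set).
  exact: orth_sigma_algebra.
move=> _ [i [j [b [S' [mS' ->]]]]].
have e1 A : UB full A -> `|Re (A i j)| <= 1 /\ `|Im (A i j)| <= 1.
  move=> [uA _]; have := unitary_entry_le i j uA.
  by split; rewrite -lecR; [apply: le_trans (normr_Re_le _) _|apply: le_trans (normr_Im_le _) _].
case: b.
  apply: (orth_set_coord (X := fun A => Re (A i j))) => //.
  - exact: rpoly_Re.
  - by move=> A /e1[].
  - exact: measurable_Re_entry.
apply: (orth_set_coord (X := fun A => Im (A i j))) => //.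
- exact: rpoly_Im.
- by move=> A /e1[].
- exact: measurable_Im_entry.
Qed.

Hypothesis f_orth : forall p, rpoly p -> Int (fun A => p A * f A) = 0.

(** The part of the group where f > 0 is measurable, so its indicator is an admissible multiplier
    and the positive part of f has integral 0; moreover |f| is twice the positive part minus f. *)
Lemma Int_norm_orth : Int (fun A => `|f A|) = 0.
Proof.
have o1 : orth (fun=> 1).
  split; first exact: rbm_cst.
  by move=> p /f_orth <-; congr Rintegral; apply/funext => A; rewrite mul1r.
pose Sp : set T := U `&` f @^-1` `]0, +oo[.
have mSp : measurable Sp by apply: (bf.1 (measurable_UB _)); exact: measurable_itv.
have s0 : Int (fun A => \1_Sp A * f A) = 0.
  have [_ h] := (orth_set_measurable mSp).2 _ o1.
  rewrite -[RHS](h _ (rpoly_cst 1)); congr Rintegral.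
  by apply/funext => A; rewrite mul1r mulr1.
have i0 : Int f = 0.
  by rewrite -[RHS](f_orth (rpoly_cst 1)); congr Rintegral; apply/funext => A; rewrite mul1r.
have bs : rbm (fun A => \1_Sp A * f A) by apply: rbmM => //; exact: rbm_indic.
transitivity (Int (fun A => (\1_Sp A * f A + \1_Sp A * f A) - f A)).
  apply: eq_Rintegral => A /set_mem uA; rewrite indicE.
  have [/set_mem[_ /=]|/negP hA] := boolP (A \in Sp).
    by rewrite in_itv/= andbT => f0; rewrite ger0_norm ?ltW// mul1r addrK.
  rewrite mul0r add0r sub0r ler0_norm// leNgt; apply/negP => f0; apply: hA.
  by apply/mem_set; split=> //=; rewrite in_itv/= andbT.
by rewrite IntB ?IntD// ?s0 ?i0 ?addr0 ?subr0//; exact: rbmD.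
Qed.

End Moments.

(** * Irreducibility as an induction principle and as a cancellation rule *)

Section Irreducible.
Context {R : realType} {n : nat}.
Local Notation C := R[i].
Local Notation M := 'M[C]_n.

(** [irreducible] speaks of row spaces of matrices. A linear subspace given by a predicate is one:
    among the matrices whose row space satisfies the predicate, take one of maximal rank; no further
    vector of the subspace can enlarge it. *)
Lemma subspace_mx (K : fieldType) (d : nat) (P : 'rV[K]_d -> Prop) :
  P 0 -> (forall u v, P u -> P v -> P (u + v)) ->
  (forall a v, P v -> P (a *: v)) ->
  exists W : 'M[K]_d, forall v, (v <= W)%MS <-> P v.
Proof.
move=> P0 PD PZ.
pose Q r := `[< exists W : 'M[K]_d, (forall v : 'rV_d, (v <= W)%MS -> P v) /\ \rank W = r >].
have exQ : exists r, Q r.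
  exists 0%N; apply/asboolP; exists 0; split; last exact: mxrank0.
  by move=> v; rewrite submx0 => /eqP ->.
have ubQ r : Q r -> (r <= d)%N by move=> /asboolP[W [_ <-]]; exact: rank_leq_row.
have [r /asboolP[W [hW rW]] maxr] := ex_maxnP exQ ubQ.
exists W => v; split; first exact: hW.
move=> Pv; have hWv : Q (\rank (W + v)%MS).
  apply/asboolP; exists (W + v)%MS; split=> // u /sub_addsmxP[[a b] ->] /=.
  apply: PD; first by apply: hW; exact: submxMl.
  by rewrite [b]mx11_scalar mul_scalar_mx; exact: PZ.
have := maxr _ hWv; rewrite -rW => hr.
have /andP[_ h] : (W == W + v)%MS.
  by rewrite -(geq_leqif (mxrank_leqif_eq (addsmxSl W v))).
by apply: submx_trans h; exact: addsmxSr.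
Qed.

Variables (d : nat) (rho : M -> 'M[C]_d).
Hypotheses (hrho : is_rep rho) (irr : irreducible rho).

(** The vectors with property [P] form an invariant subspace, which is everything as soon as it is
    not zero. Irreducibility is mostly used in this form. *)
Lemma irr_ind (P : 'rV[C]_d -> Prop) :
  P 0 -> (forall u v, P u -> P v -> P (u + v)) ->
  (forall a v, P v -> P (a *: v)) ->
  (forall A v, unitary A -> P v -> P (v *m rho A)) ->
  (exists2 v, v != 0 & P v) -> forall v, P v.
Proof.
move=> P0 PD PZ PS [v0 v00 Pv0] v.
have [W hW] := subspace_mx P0 PD PZ.
have stab A : unitary A -> (W *m rho A <= W)%MS.
  move=> uA; apply/row_subP => i; apply/hW; rewrite row_mul.
  by apply: PS => //; apply/hW; exact: row_sub.
have [r0|rd] := irr.2 _ W stab.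
  have := (hW v0).2 Pv0; move/eqP: r0; rewrite mxrank_eq0 => /eqP ->.
  by rewrite submx0 (negbTE v00).
by apply/hW; apply: submx_full; rewrite /row_full rd.
Qed.

(** Irreducibility is assumed for rows. The rows that annihilate an invariant subspace of columns
    form an invariant subspace of rows, which cannot be everything because [P] has a nonzero member;
    hence it is zero. *)
Lemma irr_col (P : 'cV[C]_d -> Prop) :
  P 0 -> (forall u v, P u -> P v -> P (u + v)) ->
  (forall a v, P v -> P (a *: v)) ->
  (forall A v, unitary A -> P v -> P (rho A *m v)) ->
  (exists2 v, v != 0 & P v) -> forall v, P v.
Proof.
move=> P0 PD PZ PS [v0 v00 Pv0] v.
have [||| W hW] := @subspace_mx _ d (fun u => P u^T).
- by rewrite trmx0.
- by move=> u w hu hw; rewrite linearD; exact: PD.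
- by move=> a u hu; rewrite linearZ; exact: PZ.
have hK (y : 'rV[C]_d) : (y <= kermx W^T)%MS <-> forall x, P x -> y *m x = 0.
  split=> [/sub_kermxP h x Px|h].
    have : (x^T <= W)%MS by apply/hW; rewrite trmxK.
    move=> /submxP[D hD]; rewrite -[x]trmxK hD trmx_mul mulmxA h mul0mx //.
  apply/sub_kermxP; apply/trmx_inj; rewrite trmx_mul trmxK trmx0.
  apply/row_matrixP => i; rewrite row_mul row0; apply/trmx_inj.
  rewrite trmx_mul trmxK trmx0; apply: h; apply/hW; exact: row_sub.
have stab A : unitary A -> (kermx W^T *m rho A <= kermx W^T)%MS.
  move=> uA; apply/row_subP => i; apply/hK => x Px; rewrite row_mul -mulmxA.
  by have h := (hK _).1 (row_sub i (kermx W^T)); exact: h (PS A x uA Px).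
have [r0|rd] := irr.2 _ _ stab.
  have : row_full W.
    move: r0; rewrite mxrank_ker mxrank_tr => /eqP; rewrite subn_eq0 => h.
    by rewrite /row_full eqn_leq h rank_leq_col.
  by move=> fW; rewrite -[v]trmxK; apply/hW; exact: submx_full.
have W0 : W = 0.
  apply/eqP; rewrite -mxrank_eq0 -mxrank_tr.
  by move/eqP: rd; rewrite mxrank_ker; have := rank_leq_row W^T; have := irr.1; lia.
have := (hW v0^T).2; rewrite trmxK W0 submx0 => /(_ Pv0).
by rewrite trmx_eq0 (negbTE v00).
Qed.

Lemma irr_nondeg (y : 'rV[C]_d) (x : 'cV[C]_d) :
  (forall A, unitary A -> y *m rho A *m x = 0) -> y = 0 \/ x = 0.
Proof.
move=> h; have [->|y0] := eqVneq y 0; [by left|right].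
have all0 : forall v : 'rV[C]_d, forall A, unitary A -> v *m rho A *m x = 0.
  apply: (irr_ind (P := fun v => forall A, unitary A -> v *m rho A *m x = 0)).
  - by move=> A _; rewrite !mul0mx.
  - by move=> u v hu hv A uA; rewrite !mulmxDl hu// hv// addr0.
  - by move=> a v hv A uA; rewrite -!scalemxAl hv// scaler0.
  - by move=> A v uA hv D uD; rewrite -(mulmxA v) -(repM hrho)//; apply: hv; exact: unitaryM.
  - by exists y.
apply/row_matrixP => i; rewrite row0 rowE -(all0 (delta_mx 0 i) 1%:M (unitary1)) (rep1 hrho) mulmx1.
by [].
Qed.

(** A cancellation rule that takes the place of Schur's lemma: to identify an operator it is enough
    to test it after [Y *m rho A] for one nonzero [Y] and all unitary [A]. *)
Lemma irr_mx0 m p (Y : 'M[C]_(m, d)) (X : 'M[C]_(d, p)) :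
  (forall A, unitary A -> Y *m rho A *m X = 0) -> Y = 0 \/ X = 0.
Proof.
move=> h; have [->|/eqP] := eqVneq Y 0; [by left|].
move=> Y0; have /existsNP[i hi] : ~ forall i, row i Y = 0.
  by move=> r0; apply: Y0; apply/row_matrixP => i; rewrite r0 row0.
right.
apply/trmx_inj/row_matrixP => j; rewrite -tr_col trmx0 row0.
have [|e|->] := @irr_nondeg (row i Y) (col j X); last by rewrite trmx0.
  by move=> A uA; rewrite colE mulmxA -!row_mul h// mul0mx row0.
by case: hi.
Qed.

End Irreducible.

(** * Polynomials in a matrix and its adjoint *)

Section PolyFun.
Context {R : realType}.
Local Notation C := R[i].

(** The second matrix stands for the adjoint of the first but is kept independent, so that these
    functions can also be evaluated at pairs (X, X^-1) with X not unitary. *)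
Inductive polyf {n : nat} : ('M[C]_n -> 'M[C]_n -> C) -> Prop :=
| polyf_cst c : polyf (fun _ _ => c)
| polyf_X i j : polyf (fun X _ => X i j)
| polyf_Y i j : polyf (fun _ Y => Y i j)
| polyfD p q : polyf p -> polyf q -> polyf (fun X Y => p X Y + q X Y)
| polyfM p q : polyf p -> polyf q -> polyf (fun X Y => p X Y * q X Y).

Definition polymx {n a b} (F : 'M[C]_n -> 'M[C]_n -> 'M[C]_(a, b)) :=
  forall k l, polyf (fun X Y => F X Y k l).

Section Closure.
Context {n : nat}.
Local Notation M := 'M[C]_n.

Lemma eq_polyf (p q : M -> M -> C) : (forall X Y, p X Y = q X Y) ->
  polyf p -> polyf q.
Proof.
by move=> e; congr polyf; apply/funext => X; apply/funext => Y; exact: e.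
Qed.

Lemma polyf_sum (I : Type) (s : seq I) (P : pred I) (F : I -> M -> M -> C) :
  (forall i, polyf (F i)) -> polyf (fun X Y => \sum_(i <- s | P i) F i X Y).
Proof.
move=> h; elim: s => [|i s IH].
  by apply: eq_polyf (polyf_cst 0) => X Y; rewrite big_nil.
have [Pi|Pi] := boolP (P i).
  by apply: eq_polyf (polyfD (h i) IH) => X Y; rewrite big_cons Pi.
by apply: eq_polyf IH => X Y; rewrite big_cons (negbTE Pi).
Qed.

Lemma polyfX (p : M -> M -> C) k : polyf p -> polyf (fun X Y => p X Y ^+ k).
Proof.
move=> hp; elim: k => [|k IH].
  by apply: eq_polyf (polyf_cst 1) => X Y; rewrite expr0.
by apply: eq_polyf (polyfM hp IH) => X Y; rewrite exprS.
Qed.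

Lemma polyfN (p : M -> M -> C) : polyf p -> polyf (fun X Y => - p X Y).
Proof.
by move=> hp; apply: eq_polyf (polyfM (polyf_cst (-1)) hp) => X Y; rewrite mulN1r.
Qed.

Lemma polyfB (p q : M -> M -> C) : polyf p -> polyf q ->
  polyf (fun X Y => p X Y - q X Y).
Proof. by move=> hp hq; apply: polyfD => //; exact: polyfN. Qed.

Lemma polymx_cst a b (A : 'M[C]_(a, b)) : polymx (fun _ _ : M => A).
Proof. by move=> k l; exact: polyf_cst. Qed.

Lemma polymx_X : polymx (fun X _ : M => X).
Proof. by move=> k l; exact: polyf_X. Qed.

Lemma polymx_Y : polymx (fun _ Y : M => Y).
Proof. by move=> k l; exact: polyf_Y. Qed.

Lemma polymxM a b c (F : M -> M -> 'M[C]_(a, b)) (G : M -> M -> 'M[C]_(b, c)) :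
  polymx F -> polymx G -> polymx (fun X Y => F X Y *m G X Y).
Proof.
move=> hF hG k l; apply: (@eq_polyf (fun X Y => \sum_j F X Y k j * G X Y j l)).
  by move=> X Y; rewrite mxE.
by apply: polyf_sum => j; exact: polyfM.
Qed.

Lemma polymxD a b (F G : M -> M -> 'M[C]_(a, b)) :
  polymx F -> polymx G -> polymx (fun X Y => F X Y + G X Y).
Proof.
move=> hF hG k l; apply: eq_polyf (polyfD (hF k l) (hG k l)) => X Y.
by rewrite mxE.
Qed.

Lemma polymxB a b (F G : M -> M -> 'M[C]_(a, b)) :
  polymx F -> polymx G -> polymx (fun X Y => F X Y - G X Y).
Proof.
move=> hF hG k l; apply: eq_polyf (polyfB (hF k l) (hG k l)) => X Y.
by rewrite !mxE.
Qed.

Lemma polymxZ a b p (F : M -> M -> 'M[C]_(a, b)) :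
  polyf p -> polymx F -> polymx (fun X Y => p X Y *: F X Y).
Proof.
by move=> hp hF k l; apply: eq_polyf (polyfM hp (hF k l)) => X Y; rewrite !mxE.
Qed.

End Closure.

Lemma polyf_comp n m (p : 'M[C]_m -> 'M[C]_m -> C) (F G : 'M[C]_n -> 'M[C]_n -> 'M[C]_m) :
  polyf p -> polymx F -> polymx G -> polyf (fun X Y => p (F X Y) (G X Y)).
Proof.
move=> hp hF hG; elim: hp => {p} [c|i j|i j|p q _ hp _ hq|p q _ hp _ hq].
- exact: polyf_cst.
- exact: hF.
- exact: hG.
- exact: polyfD.
- exact: polyfM.
Qed.

Lemma polymx_comp n m a b (P : 'M[C]_m -> 'M[C]_m -> 'M[C]_(a, b))
    (F G : 'M[C]_n -> 'M[C]_n -> 'M[C]_m) :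
  polymx P -> polymx F -> polymx G -> polymx (fun X Y => P (F X Y) (G X Y)).
Proof. by move=> hP hF hG k l; exact: polyf_comp (hP k l) hF hG. Qed.

Context {n : nat}.
Local Notation M := 'M[C]_n.

Lemma polyf_conj (p : M -> M -> C) : polyf p ->
  polyf (fun X Y => (p (star X) (star Y))^*).
Proof.
elim=> {p} [c|i j|i j|p q _ hp _ hq|p q _ hp _ hq].
- exact: polyf_cst.
- by apply: eq_polyf (polyf_X j i) => X Y; rewrite starE conjCK.
- by apply: eq_polyf (polyf_Y j i) => X Y; rewrite starE conjCK.
- by apply: eq_polyf (polyfD hp hq) => X Y; rewrite rmorphD.
- by apply: eq_polyf (polyfM hp hq) => X Y; rewrite rmorphM.
Qed.

Lemma polyf_bmf B (p : M -> M -> C) : polyf p -> bmf B (fun A => p A (star A)).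
Proof.
elim=> {p} [c|i j|i j|p q _ hp _ hq|p q _ hp _ hq].
- exact: bmf_cst.
- exact: bmf_entry.
- by under [fun A => _]eq_fun do rewrite starE; exact/bmfJ/bmf_entry.
- exact: bmfD.
- exact: bmfM.
Qed.

(** The translates of one polynomial span a finite-dimensional space of polynomials. The order
    [Y' *m Y] is that of the adjoint of a product. *)
Lemma polyf_split (p : M -> M -> C) : polyf p ->
  exists (I : finType) (a b : I -> M -> M -> C),
    [/\ forall i, polyf (a i), forall i, polyf (b i) &
      forall X Y X' Y', p (X *m X') (Y' *m Y) = \sum_i a i X Y * b i X' Y'].
Proof.
elim=> {p} [c|i j|i j|p q _ hp _ hq|p q _ hp _ hq].
- exists unit, (fun _ _ _ => c), (fun _ _ _ => 1).
  split; try by move=> _; exact: polyf_cst.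
  by move=> *; rewrite (big_pred1 tt) ?mulr1//; case.
- exists 'I_n, (fun k X _ => X i k), (fun k X _ => X k j).
  split=> [k|k|X Y X' Y']; try exact: polyf_X.
  by rewrite mxE.
- exists 'I_n, (fun k _ Y => Y k j), (fun k _ Y => Y i k).
  split=> [k|k|X Y X' Y']; try exact: polyf_Y.
  by rewrite mxE; apply: eq_bigr => k _; rewrite mulrC.
- have [I [a [b [ha hb e]]]] := hp; have [J [a' [b' [ha' hb' e']]]] := hq.
  exists (I + J)%type, (fun k => match k with inl i => a i | inr j => a' j end),
    (fun k => match k with inl i => b i | inr j => b' j end).
  split; try by case.
  by move=> X Y X' Y'; rewrite big_sumType/= e e'.
- have [I [a [b [ha hb e]]]] := hp; have [J [a' [b' [ha' hb' e']]]] := hq.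
  exists (I * J)%type, (fun k X Y => a k.1 X Y * a' k.2 X Y),
    (fun k X Y => b k.1 X Y * b' k.2 X Y).
  split; try by move=> [i j]; exact: polyfM.
  move=> X Y X' Y'; rewrite e e' mulr_suml -(pair_bigA _ (fun i j =>
    a i X Y * a' j X Y * (b i X' Y' * b' j X' Y')))/=.
  by apply: eq_bigr => i _; rewrite mulr_sumr; apply: eq_bigr => j _; rewrite mulrACA.
Qed.

Lemma rpoly_polyf (p : M -> R) : rpoly p ->
  exists2 q : M -> M -> C, polyf q & forall A, ((p A)%:C)%C = q A (star A).
Proof.
elim=> {p} [c|i j|i j|p q _ [p' hp ep] _ [q' hq eq]|p q _ [p' hp ep] _ [q' hq eq]].
- by exists (fun _ _ => (c%:C)%C) => //; exact: polyf_cst.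
- exists (fun X Y => (X i j + Y j i) * (2%:R)^-1).
    by apply: polyfM (polyf_cst _); apply: polyfD; [exact: polyf_X|exact: polyf_Y].
  by move=> A; rewrite starE; exact: ReJ_add.
- exists (fun X Y => (Y j i - X i j) * ((2%:R)^-1 * 'i%C)).
    by apply: polyfM (polyf_cst _); apply: polyfB; [exact: polyf_Y|exact: polyf_X].
  by move=> A; rewrite starE mulrA; exact: ImJ_sub.
- exists (fun X Y => p' X Y + q' X Y); first exact: polyfD.
  by move=> A; rewrite -ep -eq -rmorphD.
- exists (fun X Y => p' X Y * q' X Y); first exact: polyfM.
  by move=> A; rewrite -ep -eq -rmorphM.
Qed.

End PolyFun.

(** * Matrix entries of an irreducible representation are polynomials *)

Section RepPolynomial.
Context {R : realType} {n : nat}.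
Local Notation C := R[i].
Local Notation M := 'M[C]_n.
Local Notation T := (mxT R n).
Local Notation Re := complex.Re.
Local Notation Im := complex.Im.
Local Notation full := (finset.setT : {set 'I_n}).
Variables (mu : probability T R) (d : nat) (rho : M -> 'M[C]_d).
Hypotheses (hmu : is_haar full mu) (hrho : is_rep rho) (irr : irreducible rho).

(** If all moments vanished, every entry would have absolute mean 0. But a row of rho(A) times the
    matching column of rho(A^-1) is 1, and the latter is bounded by r, so that r times the absolute
    size of the row is at least 1 at every A. *)
Lemma rep_poly_moment : exists p k l,
  polyf p /\ cint mu (fun A => p A (star A) * rho A k l) <> 0.
Proof.
apply: contrapT => hno.
have h0 p k l : polyf p -> cint mu (fun A => p A (star A) * rho A k l) = 0.
  by move=> hp; apply: contrapT => h; apply: hno; exists p, k, l.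
have hb k l := rep_bmf hrho full k l hmu.
have bR k l : rbm (fun A => Re (rho A k l)).
  by have [[h _] [r hr]] := hb k l; split=> //; exists r => A /hr[].
have bI k l : rbm (fun A => Im (rho A k l)).
  by have [[_ h] [r hr]] := hb k l; split=> //; exists r => A /hr[].
have mom p k l : rpoly p ->
    Rintegral mu (UB full : set T) (fun A : T => p A * Re (rho A k l)) = 0 /\
    Rintegral mu (UB full : set T) (fun A : T => p A * Im (rho A k l)) = 0.
  move=> /rpoly_polyf[q hq e]; have := h0 q k l hq.
  rewrite /cint !(Rint_UB hmu) => -[e1 e2]; split.
    rewrite -[RHS]e1; apply: eq_Rintegral => A _; rewrite -e.
    by case: (rho A k l) => a b /=; rewrite mul0r subr0.
  rewrite -[RHS]e2; apply: eq_Rintegral => A _; rewrite -e.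
  by case: (rho A k l) => a b /=; rewrite mul0r addr0.
have nR k l := Int_norm_orth hmu (bR k l) (fun p hp => (mom p k l hp).1).
have nI k l := Int_norm_orth hmu (bI k l) (fun p hp => (mom p k l hp).2).
have rbn f : rbm f -> rbm (fun A : M => `|f A|).
  move=> [mf [r hr]]; split; first exact: (measurableT_comp (@normr_measurable R setT) mf).
  by exists r => A uA; rewrite normr_id; exact: hr.
have [r r0 hr] := rep_bounded hrho hmu.
pose k0 : 'I_d := Ordinal irr.1.
pose N A := \sum_l (`|Re (rho A k0 l)| + `|Im (rho A k0 l)|).
have rbN (s : seq 'I_d) : rbm (fun A => \sum_(l <- s) (`|Re (rho A k0 l)| + `|Im (rho A k0 l)|)) /\
   Rintegral mu (UB full : set T) (fun A : T => \sum_(l <- s) (`|Re (rho A k0 l)| + `|Im (rho A k0 l)|)) = 0.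
  elim: s => [|l s [IH IH']].
    under [fun A => _]eq_fun do rewrite big_nil.
    split; first exact: rbm_cst.
    by rewrite Rintegral_cst ?mul0r//; exact: measurable_UB.
  have b1 : rbm (fun A => `|Re (rho A k0 l)| + `|Im (rho A k0 l)|).
    by apply: rbmD; exact: rbn.
  under [fun A => _]eq_fun do rewrite big_cons.
  split; first exact: rbmD.
  rewrite (IntD hmu b1 IH) IH' addr0 (IntD hmu (rbn _ (bR k0 l)) (rbn _ (bI k0 l))).
  by rewrite nR nI addr0.
have [bN iN] := rbN (index_enum 'I_d).
have ge1 A : UB full A -> 1 <= N A * r.
  move=> [uA _]; have /matrixP/(_ k0 k0) := rep_mul_star hrho uA.
  rewrite !mxE eqxx mulr1n => e; rewrite -lecR [X in X <= _](_ : _ = 1)//.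
  have -> : 1 = `|\sum_j rho A k0 j * rho (star A) j k0| by rewrite e normr1.
  apply: le_trans (ler_norm_sum _ _ _) _.
  rewrite rmorphM rmorph_sum mulr_suml; apply: ler_sum => l _.
  rewrite normrM ler_pM//; last by apply: hr; exact: unitary_star.
  rewrite {1}[rho A k0 l]complexE (le_trans (ler_normD _ _))// rmorphD lerD//.
    by rewrite normc_def/= expr0n/= addr0 sqrtr_sqr lecR.
  rewrite normrM (_ : `|'i%C : C| = 1) ?mul1r; last first.
    by rewrite normc_def/= expr0n/= add0r expr1n sqrtr1.
  by rewrite normc_def/= expr0n/= addr0 sqrtr_sqr lecR.
have : Rintegral mu (UB full : set T) (fun=> 1) <=
       Rintegral mu (UB full : set T) (fun A : T => N A * r).
  apply: le_Rintegral => //; first exact: measurable_UB.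
  - by apply: rbm_integrable => //; exact: rbm_cst.
  - by apply: rbm_integrable => //; apply: rbmM => //; exact: rbm_cst.
rewrite Rintegral_cst; last exact: measurable_UB.
rewrite [X in fine X](_ : _ = 1%E); last exact: (haar_UB hmu).
rewrite RintegralZr; last 2 first.
- exact: measurable_UB.
- exact: rbm_integrable.
by rewrite iN mul0r mulr1 leNgt ltr01.
Qed.

(** The mean of p(D) times column [l] of rho(D) is a nonzero column x. By translation invariance
    rho(A) x is the mean of p(A^-1 D) times that column, which is polynomial in A since translates
    of p split. The columns with polynomial orbit form an invariant subspace. *)
Lemma rep_polynomial : exists2 Phi : M -> M -> 'M[C]_d, polymx Phi &
  forall A, unitary A -> rho A = Phi A (star A).
Proof.
have [p [k [l [hp hne]]]] := rep_poly_moment.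
have hb k' l' := rep_bmf hrho full k' l' hmu.
pose P (x : 'cV[C]_d) := exists2 F : M -> M -> 'cV[C]_d, polymx F &
  forall A, unitary A -> rho A *m x = F A (star A).
have allP : forall x, P x.
  apply: (irr_col irr).
  - by exists (fun _ _ => 0); [exact: polymx_cst|move=> A _; rewrite mulmx0].
  - move=> u v [F hF eF] [G hG eG]; exists (fun X Y => F X Y + G X Y).
      exact: polymxD.
    by move=> A uA; rewrite mulmxDr eF// eG.
  - move=> a v [F hF eF]; exists (fun X Y => a *: F X Y).
      by apply: polymxZ => //; exact: polyf_cst.
    by move=> A uA; rewrite -scalemxAr eF.
  - move=> A v uA [F hF eF].
    exists (fun X Y => F (X *m A) (star A *m Y)).
      apply: polymx_comp => //.
        by apply: polymxM; [exact: polymx_X|exact: polymx_cst].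
      by apply: polymxM; [exact: polymx_cst|exact: polymx_Y].
    move=> D uD; rewrite mulmxA -(repM hrho)// eF ?starM//; exact: unitaryM.
  exists (\col_m cint mu (fun A => p A (star A) * rho A m l)).
    by apply/eqP => /colP/(_ k); rewrite !mxE.
  have [I [a [b [ha hb' e]]]] := polyf_split hp.
  (* [p] is translated by the adjoint of A, hence the swapped arguments of [a]. *)
  exists (fun X Y => \col_m \sum_i a i Y X * cint mu (fun A => b i A (star A) * rho A m l)).
    move=> m j; apply: (@eq_polyf _ _ (fun X Y => \sum_i a i Y X *
        cint mu (fun A => b i A (star A) * rho A m l))).
      by move=> X Y; rewrite mxE.
    apply: polyf_sum => i; apply: polyfM (polyf_cst _).
    by apply: (polyf_comp (F := fun X Y => Y) (G := fun X Y => X)) (ha i) _ _;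
       [exact: polymx_Y|exact: polymx_X].
  move=> A uA; apply/colP => m; rewrite !mxE.
  have bp : bmf full (fun D => p D (star D)) by exact: polyf_bmf.
  have br j : bmf full (fun D => p D (star D) * rho D j l) by exact: bmfM.
  have bb i : bmf full (fun D => b i D (star D) * rho D m l).
    by apply: bmfM => //; exact: polyf_bmf.
  under eq_bigr => j _ do rewrite mxE -(cintZ hmu _ (br j)).
  rewrite -(cint_sum hmu); last by move=> j; apply: bmfM; [exact: bmf_cst|exact: br].
  under [RHS]eq_bigr => i _ do rewrite -(cintZ hmu _ (bb i)).
  rewrite -(cint_sum hmu); last by move=> i; apply: bmfM; [exact: bmf_cst|exact: bb].
  have uA' := unitary_star uA.
  transitivity (cint mu (fun D => p (star A *m D) (star D *m A) * rho D m l)).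
    rewrite -[RHS](cint_lmul hmu (g := A)); last 2 first.
    - exact: UB_setT.
    - apply: bmfM => //.
      apply: (polyf_bmf full (p := fun X Y => p (star A *m X) (Y *m A))).
      apply: (polyf_comp (F := fun X Y => star A *m X) (G := fun X Y => Y *m A)) hp _ _.
        by apply: polymxM; [exact: polymx_cst|exact: polymx_X].
      by apply: polymxM; [exact: polymx_Y|exact: polymx_cst].
    apply: (eq_cint hmu) => D [uD _].
    rewrite starM mulmxA unitary_star_mul// mul1mx -mulmxA unitary_star_mul// mulmx1.
    rewrite (repM hrho)// mxE mulr_sumr; apply: eq_bigr => j _.
    by rewrite mulrCA.
  under [fun D => _]eq_fun do rewrite e mulr_suml.
  by apply: (eq_cint hmu) => D _; apply: eq_bigr => i _; rewrite mulrA.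
have {}allP (j : 'I_d) := allP (delta_mx j 0).
have /choice[F hF] : forall j : 'I_d, exists F : M -> M -> 'cV[C]_d, polymx F /\
    forall A, unitary A -> rho A *m delta_mx j 0 = F A (star A).
  by move=> j; have [F h1 h2] := allP j; exists F.
exists (fun X Y => \matrix_(i, j) F j X Y i 0).
  by move=> i j; apply: eq_polyf ((hF j).1 i 0) => X Y; rewrite mxE.
move=> A uA; apply/matrixP => i j; rewrite mxE -(hF j).2//.
by rewrite -colE mxE.
Qed.

End RepPolynomial.

(** * Invariant projections and double cosets *)

Section MatrixMean.
Context {R : realType} {n : nat}.
Local Notation C := R[i].
Local Notation M := 'M[C]_n.
Local Notation T := (mxT R n).
Local Notation full := (finset.setT : {set 'I_n}).

Definition mint {a b} (mu : probability T R) (F : M -> 'M[C]_(a, b)) : 'M[C]_(a, b) :=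
  \matrix_(k, l) cint mu (fun A => F A k l).

Definition bmx {a b} B (F : M -> 'M[C]_(a, b)) := forall k l, bmf B (fun A => F A k l).

Section OneMean.
Variables (B : {set 'I_n}) (mu : probability T R).
Hypothesis hmu : is_haar B mu.

Lemma bmx_cst a b (D : 'M[C]_(a, b)) : bmx B (fun=> D).
Proof. by move=> k l; exact: bmf_cst. Qed.

Lemma bmxM a b c (F : M -> 'M[C]_(a, b)) (G : M -> 'M[C]_(b, c)) :
  bmx B F -> bmx B G -> bmx B (fun A => F A *m G A).
Proof.
move=> hF hG k l; under [fun A => _]eq_fun do rewrite mxE.
by apply: bmf_sum => j; exact: bmfM.
Qed.

Lemma eq_mint a b (F G : M -> 'M[C]_(a, b)) :
  (forall A, UB B A -> F A = G A) -> mint mu F = mint mu G.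
Proof.
by move=> e; apply/matrixP => k l; rewrite !mxE; apply: (eq_cint hmu) => A /e ->.
Qed.

Lemma mint_cst a b (D : 'M[C]_(a, b)) : mint mu (fun=> D) = D.
Proof. by apply/matrixP => k l; rewrite !mxE (cint_cst hmu). Qed.

Lemma mintMl a b c (D : 'M[C]_(a, b)) (F : M -> 'M[C]_(b, c)) : bmx B F ->
  mint mu (fun A => D *m F A) = D *m mint mu F.
Proof.
move=> hF; apply/matrixP => k l; rewrite !mxE.
under [fun A => _]eq_fun do rewrite mxE.
rewrite (cint_sum hmu); last by move=> j; apply: bmfM; [exact: bmf_cst|exact: hF].
by apply: eq_bigr => j _; rewrite (cintZ hmu)// mxE.
Qed.

Lemma mintMr a b c (D : 'M[C]_(b, c)) (F : M -> 'M[C]_(a, b)) : bmx B F ->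
  mint mu (fun A => F A *m D) = mint mu F *m D.
Proof.
move=> hF; apply/matrixP => k l; rewrite !mxE.
under [fun A => _]eq_fun do rewrite mxE.
rewrite (cint_sum hmu); last by move=> j; apply: bmfM; [exact: hF|exact: bmf_cst].
by apply: eq_bigr => j _; rewrite (cintZr hmu)// mxE.
Qed.

Lemma mint_lmul a b g (F : M -> 'M[C]_(a, b)) : UB B g -> bmx B F ->
  mint mu (fun A => F (g *m A)) = mint mu F.
Proof.
move=> ug hF; apply/matrixP => k l; rewrite !mxE.
exact: (cint_lmul hmu (f := fun A => F A k l)).
Qed.

Lemma mint_entry a b (F : M -> 'M[C]_(a, b)) k l :
  mint mu F k l = cint mu (fun A => F A k l).
Proof. by rewrite mxE. Qed.

End OneMean.

Variables (d : nat) (rho : M -> 'M[C]_d) (muT : probability T R).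
Hypotheses (hrho : is_rep rho) (hmuT : is_haar full muT).

Lemma rep_bmx B : bmx B rho.
Proof. by move=> k l; exact: rep_bmf hmuT. Qed.

Lemma haar_avgE mu : haar_avg mu rho = mint mu rho.
Proof. by []. Qed.

Section Projection.
Variables (B : {set 'I_n}) (mu : probability T R).
Hypothesis hmu : is_haar B mu.
Local Notation P := (haar_avg mu rho).

Lemma avg_lmul g : UB B g -> rho g *m P = P.
Proof.
move=> ug; rewrite haar_avgE -(mintMl hmu _ (rep_bmx B)).
rewrite -[RHS](mint_lmul hmu ug (rep_bmx B)).
by apply: (eq_mint hmu) => A uA; rewrite (repM hrho (UB_unitary ug) (UB_unitary uA)).
Qed.

(* The average of rho (star A) is right invariant; it equals the average of
   rho since the product of the two can be computed in two ways. *)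
Lemma avg_rmul g : UB B g -> P *m rho g = P.
Proof.
move=> ug.
have bs : bmx B (fun A => rho (star A)).
  by move=> k l; exact: (bmf_star (rep_bmx B k l)).
pose Q := mint mu (fun A => rho (star A)).
have Qr h : UB B h -> Q *m rho h = Q.
  move=> uh; rewrite /Q -(mintMr hmu _ bs).
  rewrite -[RHS](mint_lmul hmu (UB_star uh) bs).
  apply: (eq_mint hmu) => A uA; rewrite starM starK (repM hrho)//.
    exact/unitary_star/(UB_unitary uA).
  exact: UB_unitary uh.
have QP : Q *m P = P.
  rewrite /Q -(mintMr hmu _ bs) -[RHS](mint_cst hmu).
  by apply: (eq_mint hmu) => A uA; rewrite avg_lmul//; exact: UB_star.
have QQ : Q *m P = Q.
  rewrite haar_avgE -(mintMl hmu _ (rep_bmx B)) -[RHS](mint_cst hmu).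
  by apply: (eq_mint hmu) => A uA; rewrite Qr.
by rewrite -QP QQ Qr.
Qed.

Lemma avg_fixl m (v : 'M[C]_(m, d)) : (forall g, UB B g -> v *m rho g = v) -> v *m P = v.
Proof.
move=> h; rewrite haar_avgE -(mintMl hmu _ (rep_bmx B)) -[RHS](mint_cst hmu).
by apply: (eq_mint hmu) => A; exact: h.
Qed.

Lemma avg_fixr m (v : 'M[C]_(d, m)) : (forall g, UB B g -> rho g *m v = v) -> P *m v = v.
Proof.
move=> h; rewrite haar_avgE -(mintMr hmu _ (rep_bmx B)) -[RHS](mint_cst hmu).
by apply: (eq_mint hmu) => A; exact: h.
Qed.

Lemma avg_idem : P *m P = P.
Proof. by apply: avg_fixl => g; exact: avg_rmul. Qed.

Lemma avg_sandwich a b (Y : 'M[C]_(a, d)) (X : 'M[C]_(d, b)) :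
  Y *m P *m X = mint mu (fun A => Y *m rho A *m X).
Proof.
have bY : bmx B (fun A => Y *m rho A) by apply: bmxM (bmx_cst _ _) (rep_bmx B).
by rewrite (mintMr hmu _ bY) (mintMl hmu _ (rep_bmx B)).
Qed.

End Projection.

(** The product of [haar_avg mu' rho] with the conjugated projection equals its right factor, which
    every element of [UB B'] fixes, and also its left factor, by averaging right invariance over
    [UB B]. *)
Lemma avg_conj B B' (mu mu' : probability T R) s : is_haar B mu -> is_haar B' mu' ->
  unitary s -> (forall g, UB B g -> UB B' (s *m g *m star s)) ->
  (forall g, UB B' g -> UB B (star s *m g *m s)) ->
  haar_avg mu' rho = rho s *m haar_avg mu rho *m rho (star s).
Proof.
move=> h h' us hs hs'; set P := haar_avg mu rho; set P' := haar_avg mu' rho.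
have us' := unitary_star us.
have Pl g : UB B' g -> rho g *m (rho s *m P *m rho (star s)) = rho s *m P *m rho (star s).
  move=> ug; rewrite !mulmxA -(repM hrho)//; last exact: UB_unitary ug.
  have -> : g *m s = s *m (star s *m g *m s).
    by rewrite !mulmxA ((unitaryE s).1 us) mul1mx.
  rewrite (repM hrho)// -?(mulmxA (rho s)) ?(avg_lmul h)//; first exact: hs'.
  exact: UB_unitary (hs' _ ug).
have Pr g : UB B g -> P' *m rho (s *m g *m star s) = P'.
  by move=> /hs/(avg_rmul h').
transitivity (P' *m (rho s *m P *m rho (star s))); last exact: avg_fixr Pl.
rewrite !mulmxA (avg_sandwich h) -[LHS](mint_cst h).
apply: (eq_mint h) => g ug; rewrite -{1}(Pr g ug) !(repM hrho)// ?mulmxA//.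
- exact: UB_unitary ug.
- by apply: unitaryM => //; exact: UB_unitary ug.
Qed.

(** Every row of the mean is a fixed vector; a nonzero one would make all vectors fixed. *)
Lemma avg_full0 : irreducible rho -> nontrivial rho -> haar_avg muT rho = 0.
Proof.
move=> irr [A0 [uA0 hA0]]; apply: contrapT => P0; apply: hA0.
have fixall : forall v : 'rV[C]_d, forall A, unitary A -> v *m rho A = v.
  apply: (irr_ind irr (P := fun v => forall A, unitary A -> v *m rho A = v)).
  - by move=> A _; rewrite mul0mx.
  - by move=> u v hu hv A uA; rewrite mulmxDl hu// hv.
  - by move=> a v hv A uA; rewrite -scalemxAl hv.
  - by move=> A v uA hv D uD; rewrite (hv A uA) hv.
  have /existsNP[i hi] : ~ forall i, row i (haar_avg muT rho) = 0.
    by move=> r0; apply: P0; apply/row_matrixP => i; rewrite r0 row0.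
  exists (row i (haar_avg muT rho)); first exact/eqP.
  by move=> A uA; rewrite -row_mul (avg_rmul hmuT)//; exact: UB_setT.
by apply/row_matrixP => i; rewrite rowE fixall// row1.
Qed.

End MatrixMean.

(** * Householder reflections and double cosets *)

Section Householder.
Context {R : realType} {n : nat}.
Local Notation C := R[i].
Local Notation M := 'M[C]_n.
Implicit Types (u w : 'rV[C]_n).

Lemma mul_star_eq0 u : u *m star u = 0 -> u = 0.
Proof.
move=> /matrixP/(_ 0 0); rewrite !mxE => /eqP.
rewrite psumr_eq0 => [/allP h|j _]; last by rewrite starE -normCK exprn_ge0.
apply/rowP => j; have := h j (mem_index_enum _).
by rewrite /= starE -normCK sqrf_eq0 normr_eq0 mxE => /eqP.
Qed.

(** Multiplying by the adjoint leaves the coefficient |v|^2 / |s|^2 - 1/s - 1/s^* in front of the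
    rank-one matrix, and this vanishes exactly when 2 Re s = |v|^2. *)
Lemma reflection_unitary (v : 'rV[C]_n) (s : C) : s != 0 ->
  s + s^* = (v *m star v) 0 0 -> unitary (1%:M - s^-1 *: (star v *m v)).
Proof.
move=> s0 e; apply/unitaryE.
rewrite starD starN starZ star1 starM starK.
rewrite mulmxBr mulmx1 mulmxBl mul1mx -scalemxAl -scalemxAr.
rewrite -(mulmxA (star v)) (mulmxA v) [v *m star v]mx11_scalar -e.
rewrite mul_scalar_mx -scalemxAr !scalerA.
rewrite -[RHS]subr0 -!addrA; congr (_ + _); rewrite -opprD; congr (- _).
rewrite -scalerBl -scalerDl; apply/eqP; rewrite scaler_eq0; apply/orP; left.
rewrite fmorphV/=; apply/eqP.
have s0' : s^* != 0 by rewrite conjC_eq0.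
by field; rewrite s0 s0'.
Qed.

(* The factor 2 / |u - w|^2 of a real Householder reflection maps u to w only if
   u *m star w is real; this one is correct whenever |u| = |w|. *)
Definition householder u w : M :=
  1%:M - ((u *m star (u - w)) 0 0)^-1 *: (star (u - w) *m (u - w)).

Section SameNorm.
Variables (u w : 'rV[C]_n).
Hypothesis uw : u *m star u = w *m star w.
Let v := u - w.
Let s := (u *m star v) 0 0.
Let q := (v *m star v) 0 0.

Let sE : u *m star v = s%:M. Proof. exact: mx11_scalar. Qed.
Let qE : v *m star v = q%:M. Proof. exact: mx11_scalar. Qed.

Let s_q : s + s^* = q.
Proof.
have -> : s^* = (star (u *m star v)) 0 0 by rewrite starE.
rewrite starM starK -[LHS]/(_ + _) /s /q.
have -> : v *m star v = u *m star v + v *m star u.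
  rewrite /v starD starN !(mulmxBr, mulmxBl) uw.
  move: (w *m star w) (u *m star w) (w *m star u) => a b c.
  by apply/matrixP => i j; rewrite !mxE; ring.
by rewrite [in RHS]mxE.
Qed.

Let s0_v : s = 0 -> v = 0.
Proof.
by move=> s0; apply: mul_star_eq0; rewrite qE -s_q s0 rmorph0 addr0 raddf0.
Qed.

Lemma householder_unitary : unitary (householder u w).
Proof.
rewrite /householder -/v -/s.
(* The case s = 0 is the case u = w; the inverse of 0 being 0, the formula then gives the
   identity. *)
have [s0|s0] := eqVneq s 0.
  by rewrite s0 invr0 scale0r subr0; exact: unitary1.
by apply: reflection_unitary.
Qed.

Lemma householder_map : u *m householder u w = w.
Proof.
rewrite /householder -/v -/s.
have [s0|s0] := eqVneq s 0.
  rewrite s0 invr0 scale0r subr0 mulmx1.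
  by apply/eqP; rewrite -subr_eq0; apply/eqP; exact: s0_v.
rewrite mulmxBr mulmx1 -scalemxAr mulmxA sE mul_scalar_mx scalerA mulVf// scale1r.
by rewrite /v opprB addrC subrK.
Qed.

Lemma householder_UB (B : {set 'I_n}) : (forall i, i \notin B -> u 0 i = 0) ->
  (forall i, i \notin B -> w 0 i = 0) -> UB B (householder u w).
Proof.
move=> hu hw; split; first exact: householder_unitary.
have hv i : i \notin B -> v 0 i = 0 by move=> hi; rewrite !mxE hu// hw// subr0.
move=> i j hij; rewrite /householder -/v !mxE big_ord1 starE.
case/orP: hij => h; first by rewrite (hv _ h) rmorph0 mul0r mulr0 subr0.
by rewrite (hv _ h) !mulr0 subr0.
Qed.

End SameNorm.

(** The Hermitian product of rows [j] and [i] is the entry [A j i], so orthonormality of the rows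
    makes column [i] trivial along with row [i]. *)
Lemma UB_fix_row (B : {set 'I_n}) i (A : M) : UB B A -> row i A = delta_mx 0 i -> UB (B :\ i)%SET A.
Proof.
move=> [uA hA] hi; split=> // a b.
have hc j : A j i = (j == i)%:R.
  have /matrixP/(_ j i) := (unitaryE A).1 uA.
  rewrite !mxE => <-; rewrite (bigD1 i)//= big1 ?addr0.
    by have /rowP/(_ i) := hi; rewrite starE !mxE !eqxx => ->; rewrite rmorph1 mulr1.
  move=> k ki; have /rowP/(_ k) := hi; rewrite starE !mxE eqxx (negbTE ki) => ->.
  by rewrite rmorph0 mulr0.
rewrite !inE !negb_and !negbK => /orP[/orP[/eqP->|h]|/orP[/eqP->|h]].
- by have /rowP/(_ b) := hi; rewrite !mxE eqxx eq_sym.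
- by apply: hA; rewrite h.
- exact: hc.
- by apply: hA; rewrite h orbT.
Qed.

(** Rows [i] of [h] and [g], with the common diagonal entry removed, have the same length and are
    supported off [i]. A Householder reflection [k'] in the smaller group carries one to the other;
    then [h *m k'] and [g] share row [i], and their quotient fixes the i-th basis vector. *)
Lemma double_coset (B : {set 'I_n}) i (g h : M) : i \in B -> UB B g -> UB B h -> g i i = h i i ->
  exists k k', [/\ UB (B :\ i)%SET k, UB (B :\ i)%SET k' & g = k *m h *m k'].
Proof.
move=> iB ug uh e.
pose u := row i h - h i i *: delta_mx 0 i; pose w := row i g - g i i *: delta_mx 0 i.
have nrm (A : M) : UB B A ->
    (row i A - A i i *: delta_mx 0 i) *m star (row i A - A i i *: delta_mx 0 i) =
    (1 - A i i * (A i i)^*)%:M.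
  move=> [/unitaryE uA _].
  have r1 : row i A *m star (row i A) = 1%:M.
    have /matrixP/(_ i i) := uA; rewrite !mxE eqxx => e1.
    rewrite [LHS]mx11_scalar; congr (_%:M); rewrite mxE -[RHS]e1.
    by apply: eq_bigr => j _; rewrite !starE mxE.
  have r2 : row i A *m star (delta_mx 0 i) = (A i i)%:M.
    rewrite [LHS]mx11_scalar; congr (_%:M); rewrite mxE (bigD1 i)//= big1 ?addr0.
      by rewrite starE !mxE !eqxx /= rmorph1 mulr1.
    by move=> j ji; rewrite starE !mxE (negbTE ji) andbF rmorph0 mulr0.
  have r3 : delta_mx 0 i *m star (row i A) = (A i i)^*%:M.
    rewrite -[LHS]starK starM starK r2 [LHS]mx11_scalar; congr (_%:M).
    by rewrite starE mxE eqxx.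
  have r4 : (delta_mx 0 i : 'rV[C]_n) *m star (delta_mx 0 i) = 1%:M.
    rewrite [LHS]mx11_scalar; congr (_%:M); rewrite mxE (bigD1 i)//= big1 ?addr0.
      by rewrite !mxE !eqxx /= mul1r rmorph1.
    by move=> j ji; rewrite !mxE (negbTE ji) andbF mul0r.
  rewrite starD starN starZ mulmxBr !mulmxBl -!scalemxAl -!scalemxAr r1 r2 r3 r4.
  rewrite !scale_scalar_mx; apply/matrixP => a b; rewrite !ord1 !mxE eqxx !mulr1n mulr1.
  by ring.
have uw : u *m star u = w *m star w by rewrite !nrm// e.
have supp (A : M) j : UB B A -> j \notin (B :\ i)%SET ->
    (row i A - A i i *: delta_mx 0 i) 0 j = 0.
  move=> [_ hA]; rewrite !inE negb_and negbK !mxE /= => /orP[/eqP->|hj].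
    by rewrite eqxx mulr1 subrr.
  have ji : j != i by apply: contra hj => /eqP ->.
  by rewrite hA ?hj ?orbT// eq_sym (negbTE ji) mulr0 subr0.
pose k' := householder u w.
have uk' : UB (B :\ i)%SET k'.
  by apply: householder_UB => // j hj; exact: supp.
have uk'B : UB B k' by apply: UB_sub uk'; exact: subD1set.
have hr : row i (h *m k') = row i g.
  have ek : (delta_mx 0 i : 'rV[C]_n) *m k' = delta_mx 0 i.
    rewrite -rowE; apply/rowP => j; rewrite mxE [RHS]mxE eqxx/=.
    by rewrite uk'.2 ?inE ?eqxx// eq_sym.
  rewrite row_mul -[row i h](subrK (h i i *: delta_mx 0 i)) -/u.
  by rewrite mulmxDl householder_map// -scalemxAl ek -e subrK.
have uhk : UB B (h *m k') by exact: UBM.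
exists (g *m star (h *m k')), k'; split=> //.
  apply: UB_fix_row; first by apply: UBM => //; exact: UB_star.
  by rewrite row_mul -hr -row_mul ((unitaryE _).1 (UB_unitary uhk)) row1.
by rewrite -!mulmxA unitary_star_mul ?mulmx1//; exact: UB_unitary uhk.
Qed.

End Householder.

(** * Embedding small unitary groups *)

Section Embedding.
Context {R : realType}.
Local Notation C := R[i].

Lemma poly_inj_root (F : idomainType) (p : {poly F}) (f : nat -> F) :
  injective f -> (forall k, p.[f k] = 0) -> p = 0.
Proof.
move=> injf h; apply/eqP; apply: contraT => p0.
have := @max_poly_roots _ p [seq f k | k <- iota 0 (size p)] p0.
rewrite size_map size_iota ltnn => -> //.
  by apply/allP => _ /mapP[k _ ->]; rewrite /root h.
by rewrite map_inj_uniq ?iota_uniq.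
Qed.

Context {n m : nat}.

Definition incl_mx (f : 'I_m -> 'I_n) : 'M[C]_(m, n) :=
  \matrix_(a, j) (f a == j)%:R.

(** Written as a correction of the identity, so that products and adjoints reduce to [incl_mxK]. *)
Definition emb (f : 'I_m -> 'I_n) (A : 'M[C]_m) : 'M[C]_n :=
  1%:M + (incl_mx f)^T *m (A - 1%:M) *m incl_mx f.

Variable f : 'I_m -> 'I_n.
Hypothesis injf : injective f.
Local Notation N := (incl_mx f).

Lemma incl_mxK : N *m N^T = 1%:M.
Proof.
apply/matrixP => a b; rewrite !mxE (bigD1 (f a))//= big1 ?addr0.
  by rewrite !mxE eqxx mul1r (inj_eq injf) eq_sym.
by move=> j ja; rewrite !mxE eq_sym (negbTE ja) mul0r.
Qed.

Lemma incl_mx_emb A : N *m emb f A = A *m N.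
Proof.
by rewrite mulmxDr mulmx1 !mulmxA incl_mxK mul1mx mulmxBl mul1mx addrC subrK.
Qed.

Lemma emb_incl_mx A : emb f A *m N^T = N^T *m A.
Proof.
by rewrite mulmxDl mul1mx -!mulmxA incl_mxK mulmx1 mulmxBr mulmx1 addrC subrK.
Qed.

Lemma embM A D : emb f A *m emb f D = emb f (A *m D).
Proof.
rewrite {1}/emb mulmxDl mul1mx -(mulmxA _ N) incl_mx_emb {1}/emb -addrA.
congr (_ + _); rewrite !mulmxA -mulmxDl; congr (_ *m _).
by rewrite -!mulmxA -mulmxDr; congr (_ *m _); rewrite mulmxBl mul1mx addrC addrA subrK.
Qed.

Lemma emb1 : emb f 1%:M = 1%:M.
Proof. by rewrite /emb subrr mulmx0 mul0mx addr0. Qed.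

Lemma star_incl_mx : star N = N^T.
Proof. by apply/matrixP => i j; rewrite starE !mxE rmorph_nat. Qed.

Lemma emb_star A : star (emb f A) = emb f (star A).
Proof.
have sN : star N^T = N by rewrite -star_incl_mx starK.
by rewrite /emb starD star1 !starM star_incl_mx sN starD starN star1 mulmxA.
Qed.

Lemma incl_mx_sandwich (D : 'M[C]_n) a b : (N *m D *m N^T) a b = D (f a) (f b).
Proof.
rewrite mxE (bigD1 (f b))//= big1 ?addr0.
  rewrite !mxE eqxx mulr1 (bigD1 (f a))//= big1 ?addr0.
    by rewrite mxE eqxx mul1r.
  by move=> j ja; rewrite mxE eq_sym (negbTE ja) mul0r.
by move=> j jb; rewrite [X in _ * X]mxE [X in _ * X]mxE eq_sym (negbTE jb) mulr0.
Qed.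

Lemma embE a b A : emb f A (f a) (f b) = A a b.
Proof. by rewrite -incl_mx_sandwich incl_mx_emb -mulmxA incl_mxK mulmx1. Qed.

Lemma emb_out A i j : (forall a, f a != i) \/ (forall a, f a != j) ->
  emb f A i j = (i == j)%:R.
Proof.
move=> h; rewrite mxE [X in X + _]mxE -[RHS]addr0; congr (_ + _).
case: h => h.
  rewrite -mulmxA mxE big1// => a _.
  by rewrite [X in X * _]mxE [X in X * _]mxE (negbTE (h a)) mul0r.
rewrite mxE big1// => a _.
by rewrite [X in _ * X]mxE (negbTE (h a)) mulr0.
Qed.

Lemma emb_unitary A : unitary A -> unitary (emb f A).
Proof.
by move=> /unitaryE uA; apply/unitaryE; rewrite emb_star embM uA emb1.
Qed.

Lemma emb_UB (B : {set 'I_n}) A : unitary A -> (forall a, f a \in B) -> UB B (emb f A).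
Proof.
move=> uA hB; split; first exact: emb_unitary.
move=> i j /orP[h|h]; apply: emb_out; [left|right] => a.
  by apply: contra h => /eqP <-.
by apply: contra h => /eqP <-.
Qed.

Lemma emb_comm A (g : 'M[C]_n) : N *m g = N -> g *m N^T = N^T ->
  g *m emb f A = emb f A *m g.
Proof.
move=> h1 h2; rewrite mulmxDr mulmxDl mulmx1 mul1mx !mulmxA h2.
by rewrite -(mulmxA _ N g) h1.
Qed.

Lemma polymx_emb p (F : 'M[C]_p -> 'M[C]_p -> 'M[C]_m) :
  polymx F -> polymx (fun X Y => emb f (F X Y)).
Proof.
move=> hF; apply: polymxD; first exact: polymx_cst.
apply: polymxM; last exact: polymx_cst.
apply: polymxM; first exact: polymx_cst.
by apply: polymxB => //; exact: polymx_cst.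
Qed.

End Embedding.

Section TwoByTwo.
Context {R : realType} {n : nat}.
Local Notation C := R[i].

Definition mx2 (a b c e : C) : 'M[C]_2 :=
  \matrix_(i, j) if i == 0 then (if j == 0 then a else b)
                 else (if j == 0 then c else e).

Lemma mx2P (A D : 'M[C]_2) : A 0 0 = D 0 0 -> A 0 1 = D 0 1 -> A 1 0 = D 1 0 ->
  A 1 1 = D 1 1 -> A = D.
Proof.
move=> h1 h2 h3 h4; apply/matrixP => i j.
have o2 (k : 'I_2) : k = 0 \/ k = 1.
  by case: k => -[|[|//]] ?; [left|right]; exact: val_inj.
by case: (o2 i) (o2 j) => -> [] ->.
Qed.

Lemma mul_mx2 a b c e a' b' c' e' : mx2 a b c e *m mx2 a' b' c' e' =
  mx2 (a * a' + b * c') (a * b' + b * e') (c * a' + e * c') (c * b' + e * e').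
Proof. by apply: mx2P; rewrite !mxE !big_ord_recl big_ord0 !mxE /= addr0. Qed.

Lemma star_mx2 a b c e : star (mx2 a b c e) = mx2 (a^*) (c^*) (b^*) (e^*).
Proof. by apply: mx2P; rewrite starE !mxE. Qed.

Lemma mx2_1 : mx2 1 0 0 1 = 1%:M.
Proof. by apply: mx2P; rewrite !mxE. Qed.

Definition pair_incl (i j : 'I_n) (a : 'I_2) : 'I_n := if a == 0 then i else j.

Lemma pair_incl_inj i j : i != j -> injective (pair_incl i j).
Proof.
move=> ij a b; rewrite /pair_incl.
have o2 (k : 'I_2) : k = 0 \/ k = 1.
  by case: k => -[|[|//]] ?; [left|right]; exact: val_inj.
by case: (o2 a) (o2 b) => -> [] -> //= /eqP; rewrite ?(negbTE ij)// eq_sym (negbTE ij).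
Qed.

Definition emb2 (i j : 'I_n) (A : 'M[C]_2) : 'M[C]_n := emb (pair_incl i j) A.

Lemma mx2_refl_unitary (z s : C) : s^* = s -> z * z^* + s * s = 1 ->
  unitary (mx2 z s s (- z^*)).
Proof.
move=> hs e; apply/unitaryE; rewrite star_mx2 mul_mx2 -mx2_1 !hs rmorphN /= conjCK.
by congr mx2; rewrite -?e; ring.
Qed.

End TwoByTwo.

Definition sandwich {F : nzRingType} {d : nat} (P X : 'M[F]_d) := P *m X *m P.

(** [X] preserves the nonzero row space of [P], where it has an eigenvector over an algebraically
    closed field; [P] fixes the rows of that space. *)
Lemma idem_eigenvector {F : numClosedFieldType} {d : nat} (P X : 'M[F]_d) :
  P *m P = P -> P != 0 -> X *m P = X ->
  exists c (y : 'rV[F]_d), [/\ y != 0, y *m P = y & y *m X = c *: y].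
Proof.
move=> PP P0 XP; pose V := row_base P.
have r0 : (0 < \rank P)%N by rewrite lt0n mxrank_eq0.
have VP : V *m P = V.
  have /submxP[W ->] : (V <= P)%MS by rewrite eq_row_base.
  by rewrite -mulmxA PP.
have stab : (V *m X <= V)%MS.
  by rewrite -XP mulmxA (submx_trans (submxMl _ P))// eq_row_base.
have [c /eigenvalueP[u hu u0]] := spectral.eigenvalue_closed (V *m X *m pinvmx V) r0.
exists c, (u *m V); split.
- by rewrite mulmx_free_eq0 ?row_base_free.
- by rewrite -mulmxA VP.
- by rewrite -mulmxA -{1}(mulmxKpV stab) mulmxA hu -scalemxAl.
Qed.

(** * Spherical functions *)

Section Spherical.
Context {R : realType} {n : nat}.
Local Notation C := R[i].
Local Notation M := 'M[C]_n.
Local Notation T := (mxT R n).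
Local Notation full := (finset.setT : {set 'I_n}).
Variable mu : {set 'I_n} -> probability T R.
Hypothesis hmu : forall B, is_haar B (mu B).
Variables (i0 i1 : 'I_n).
Hypothesis i01 : i0 != i1.
Local Notation K := (~: [set i0])%SET.

Lemma full_D1 : (full :\ i0)%SET = K. Proof. by rewrite finset.setTD. Qed.

(** Unitary when s is real and |z|^2 + s^2 = 1: the representative of the double coset of elements
    with corner z. *)
Definition Gmx (z s : C) : M := emb2 i0 i1 (mx2 z s s (- z^*)).

Lemma pinj : injective (pair_incl i0 i1). Proof. exact: pair_incl_inj. Qed.

Lemma Gmx_unitary z s : s^* = s -> z * z^* + s * s = 1 -> unitary (Gmx z s).
Proof. by move=> hs e; apply: emb_unitary; [exact: pinj|exact: mx2_refl_unitary]. Qed.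

Lemma Gmx_corner z s : Gmx z s i0 i0 = z.
Proof. by have := embE pinj 0 0 (mx2 z s s (- z^*)); rewrite [RHS]mxE. Qed.

(** [k] fixes the basis vector of [i0], so its minor on [i0] and [i1] is diag(1, k_11), and the
    corner of the product involves no other entries of [k]. *)
Lemma Gmx_mid z s z' s' k : UB K k ->
  (Gmx z s *m k *m Gmx z' s') i0 i0 = z * z' + s * s' * k i1 i1.
Proof.
move=> [_ hk]; set G := _ *m _ *m _.
have -> : G i0 i0 = (incl_mx (pair_incl i0 i1) *m G *m (incl_mx (pair_incl i0 i1))^T) 0 0.
  by rewrite incl_mx_sandwich.
rewrite /G !mulmxA (incl_mx_emb pinj) -(mulmxA _ (Gmx z' s')) (emb_incl_mx pinj).
have -> : mx2 z s s (- z^*) *m incl_mx (pair_incl i0 i1) *m k *m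
    ((incl_mx (pair_incl i0 i1))^T *m mx2 z' s' s' (- z'^*)) =
  mx2 z s s (- z^*) *m (incl_mx (pair_incl i0 i1) *m k *m
    (incl_mx (pair_incl i0 i1))^T) *m mx2 z' s' s' (- z'^*).
  by rewrite !mulmxA.
have -> : incl_mx (pair_incl i0 i1) *m k *m (incl_mx (pair_incl i0 i1))^T =
    mx2 1 0 0 (k i1 i1).
  apply: mx2P; rewrite incl_mx_sandwich [RHS]mxE /pair_incl //=.
  - by rewrite hk ?inE ?eqxx.
  - by rewrite hk ?inE ?eqxx// (negbTE i01).
  - by rewrite hk ?inE ?eqxx ?orbT// eq_sym (negbTE i01).
by rewrite !mul_mx2 mxE /=; ring.
Qed.

Definition moment (j : nat) : C := cint (mu K) (fun k => (k i1 i1 * (k i1 i1)^*) ^+ j).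

Lemma moment_bmf j : bmf K (fun k : M => (k i1 i1 * (k i1 i1)^*) ^+ j).
Proof. by apply/bmfX/bmfM; [exact: bmf_entry|exact/bmfJ/bmf_entry]. Qed.

Lemma moment_ge0 j : 0 <= moment j.
Proof.
by apply: (cint_ge0 (hmu K)) => A _; rewrite exprn_ge0// -normCK exprn_ge0.
Qed.

Lemma moment_le j : moment j.+1 <= moment j.
Proof.
rewrite -subr_ge0 -mulN1r -(cintZ (hmu K) _ (moment_bmf _)) -(cintD (hmu K)).
- apply: (cint_ge0 (hmu K)) => A [uA _]; rewrite mulN1r subr_ge0 exprS.
  rewrite ler_piMl//; first by rewrite exprn_ge0// -normCK exprn_ge0.
  by rewrite -normCK exprn_ile1//; exact: unitary_entry_le.
- exact: moment_bmf.
- by apply: bmfM; [exact: bmf_cst|exact: moment_bmf].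
Qed.

Lemma moment_homo j k : (j <= k)%N -> moment k <= moment j.
Proof.
elim: k => [|k IH]; first by rewrite leqn0 => /eqP ->.
rewrite leq_eqVlt => /orP[/eqP -> //|]; rewrite ltnS => /IH.
exact/le_trans/moment_le.
Qed.

Definition dg (i : 'I_n) (t : C) : M := diag_mx (\row_j if j == i then t else 1).

Lemma dgE i t a b : dg i t a b = (if a == i then t else 1) *+ (a == b).
Proof. by rewrite !mxE. Qed.

Lemma mul_dg i t (A : M) a b : (dg i t *m A) a b = (if a == i then t else 1) * A a b.
Proof. by rewrite mul_diag_mx !mxE. Qed.

Lemma dg_mul i t (A : M) a b : (A *m dg i t) a b = A a b * (if b == i then t else 1).
Proof. by rewrite mul_mx_diag !mxE. Qed.

Lemma dg_unitary i t : t * t^* = 1 -> unitary (dg i t).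
Proof.
move=> ht; apply/unitaryE/matrixP => a b; rewrite mul_dg starE dgE mxE.
have [->|ab] := eqVneq a b; last by rewrite rmorph0 mulr0.
by rewrite !mulr1n; case: ifP => // _; rewrite rmorph1 mulr1.
Qed.

Lemma dg_comm t k : UB K k -> dg i0 t *m k = k *m dg i0 t.
Proof.
move=> [_ hk]; apply/matrixP => a b; rewrite mul_dg dg_mul.
have [->|ai] := eqVneq a i0.
  have [->|bi] := eqVneq b i0; first by rewrite mulrC.
  by rewrite hk ?inE ?eqxx// eq_sym (negbTE bi) mulr0 mul0r.
have [->|bi] := eqVneq b i0; last by rewrite mulrC.
by rewrite hk ?inE ?eqxx ?orbT// (negbTE ai) mulr0 mul0r.
Qed.

Variables (d : nat) (rho : M -> 'M[C]_d).
Hypotheses (hrho : is_rep rho) (irr : irreducible rho).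
Local Notation P := (haar_avg (mu K) rho).
Let hT := hmu full.

Lemma P_lmul g : UB K g -> rho g *m P = P.
Proof. exact: (avg_lmul hrho hT (hmu K)). Qed.

Lemma P_rmul g : UB K g -> P *m rho g = P.
Proof. exact: (avg_rmul hrho hT (hmu K)). Qed.

Lemma P_idem : P *m P = P.
Proof. exact: (avg_idem hrho hT (hmu K)). Qed.

Local Notation D g := (sandwich P (rho g)).

Let PD g : P *m D g = D g.
Proof. by rewrite /sandwich !mulmxA P_idem. Qed.

Let D_corner g h : unitary g -> unitary h -> g i0 i0 = h i0 i0 -> D g = D h.
Proof.
move=> ug uh e; have := double_coset (finset.in_setT i0) (UB_setT ug) (UB_setT uh) e.
rewrite full_D1 => -[k [k' [hk hk' ->]]].
have uk := UB_unitary hk; have uk' := UB_unitary hk'.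
rewrite /sandwich (repM hrho (unitaryM uk uh) uk') (repM hrho uk uh).
by rewrite !mulmxA (P_rmul hk) -!mulmxA (P_lmul hk').
Qed.

Let rep3 g k h : unitary g -> UB K k -> unitary h ->
  rho (g *m k *m h) = rho g *m rho k *m rho h.
Proof.
move=> ug uk uh; have {}uk := UB_unitary uk.
by rewrite !(repM hrho)//; exact: unitaryM.
Qed.

Let D_mul g h : unitary g -> unitary h ->
  D g *m D h = mint (mu K) (fun k => D (g *m k *m h)).
Proof.
move=> ug uh.
have -> : D g *m D h = (P *m rho g) *m P *m (rho h *m P).
  by rewrite /sandwich !mulmxA -(mulmxA _ P P) P_idem.
rewrite (avg_sandwich hrho hT (hmu K)); apply: (eq_mint (hmu K)) => k uk.
by rewrite /sandwich rep3// !mulmxA.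
Qed.

Let D_comm_sym g h : unitary g -> unitary h ->
  (forall k, UB K k -> (g *m k *m h) i0 i0 = (h *m k *m g) i0 i0) ->
  D g *m D h = D h *m D g.
Proof.
move=> ug uh e; rewrite (D_mul ug uh) (D_mul uh ug).
apply: (eq_mint (hmu K)) => k uk; have uk' := UB_unitary uk.
by apply: D_corner (e k uk); apply: unitaryM => //; exact: unitaryM.
Qed.

Let corner_G g : unitary g -> exists z s, [/\ s^* = s, z * z^* + s * s = 1 &
  D g = D (Gmx z s)].
Proof.
move=> ug; set z := g i0 i0.
have z1 : `|z| <= 1 by exact: unitary_entry_le.
have w0 : 0 <= 1 - z * z^* by rewrite -normCK subr_ge0 exprn_ile1.
have hs : (sqrtC (1 - z * z^*))^* = sqrtC (1 - z * z^*).
  by apply: CrealP; apply: ger0_real; rewrite sqrtC_ge0.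
have e : z * z^* + sqrtC (1 - z * z^*) * sqrtC (1 - z * z^*) = 1.
  by rewrite -expr2 sqrtCK addrC subrK.
exists z, (sqrtC (1 - z * z^*)); split; [exact: hs|exact: e|].
by apply: (D_corner ug (Gmx_unitary hs e)); rewrite Gmx_corner.
Qed.

(** Gelfand's argument: the corner of [Gmx z s *m k *m Gmx z' s'] is symmetric under exchange of the
    outer factors, and both products are means over [k] of operators that depend on that corner
    alone. *)
Let D_comm g h : unitary g -> unitary h -> D g *m D h = D h *m D g.
Proof.
move=> /corner_G[z [s [hs es ->]]] /corner_G[z' [s' [hs' es' ->]]].
apply: D_comm_sym; [exact: Gmx_unitary|exact: Gmx_unitary|].
move=> k uk; apply: (etrans (Gmx_mid z s z' s' uk)).
apply: (etrans _ (esym (Gmx_mid z' s' z s uk))).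
by rewrite (mulrC z) (mulrC s).
Qed.

Hypothesis P0 : P != 0.

(** By commutation, an eigenvector y of D(g) in the row space of P satisfies y D(h) D(g) = c y D(h)
    for all h. Hence y rho(h) (D(g) - c P) = 0 for all h, and [irr_mx0] cancels y. *)
Let D_scalar g : unitary g -> exists c, D g = c *: P.
Proof.
move=> ug; have DP : D g *m P = D g by rewrite /sandwich -!mulmxA P_idem.
have [c [y [y0 yP yD]]] := idem_eigenvector P_idem P0 DP.
exists c; have [|/eqP|e] := @irr_mx0 _ _ _ _ hrho irr _ _ y (D g - c *: P).
- move=> h uh; rewrite mulmxBr -scalemxAr.
  have e1 : y *m rho h *m P = y *m D h.
    by rewrite /sandwich 2!mulmxA yP.
  have -> : y *m rho h *m D g = y *m D h *m D g.
    by rewrite -e1 -[in RHS]mulmxA (PD g).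
  by rewrite -(mulmxA y) (D_comm uh ug) mulmxA yD e1 -scalemxAl subrr.
- by rewrite (negbTE y0).
- by apply/eqP; rewrite -subr_eq0; apply/eqP.
Qed.

Lemma spherical_rank1 : exists (x : 'cV[C]_d) (y : 'rV[C]_d),
  P = x *m y /\ y *m x = 1%:M.
Proof.
have /existsNP[i /eqP hi] : ~ forall i, row i P = 0.
  by move=> r0; case/eqP: P0; apply/row_matrixP => i; rewrite r0 row0.
pose y := row i P; have yP : y *m P = y by rewrite -row_mul P_idem.
(* All v rho(g) P lie on the line of [y]: this holds for v = y by [D_scalar] and is inherited by the
   span of the orbit of [y]. *)
have all v : forall g, unitary g -> exists c, v *m rho g *m P = c *: y.
  move: v; apply: (irr_ind irr (P := fun v => forall g, unitary g ->
      exists c, v *m rho g *m P = c *: y)).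
  - by move=> g _; exists 0; rewrite !mul0mx scale0r.
  - move=> u v hu hv g ug; have [a ea] := hu g ug; have [b eb] := hv g ug.
    by exists (a + b); rewrite !mulmxDl ea eb scalerDl.
  - move=> a v hv g ug; have [b eb] := hv g ug.
    by exists (a * b); rewrite -!scalemxAl eb scalerA.
  - move=> A v uA hv g ug; rewrite -(mulmxA v) -(repM hrho)//; apply: hv.
    exact: unitaryM.
  exists y => // g ug; have [c ec] := D_scalar ug; exists c.
  by rewrite -{1}yP -2!mulmxA (mulmxA P) -/(sandwich P (rho g)) ec -scalemxAr yP.
have /choice[c hc] : forall j : 'I_d, exists c, row j P = c *: y.
  move=> j; have [c ec] := all (delta_mx 0 j) 1%:M unitary1.
  by exists c; rewrite -ec (rep1 hrho) mulmx1 -rowE.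
exists (\col_j c j), y.
have e : P = (\col_j c j) *m y.
  by apply/row_matrixP => j; rewrite hc; apply/rowP => l; rewrite !mxE big_ord1 !mxE.
split=> //; have : y *m ((\col_j c j) *m y) = y by rewrite -e yP.
rewrite mulmxA [y *m _]mx11_scalar mul_scalar_mx => /eqP.
rewrite -subr_eq0 -[X in _ - X]scale1r -scalerBl scaler_eq0 (negbTE hi) orbF subr_eq0.
by move=> /eqP ->.
Qed.

Variables (x0 : 'cV[C]_d) (y0 : 'rV[C]_d).
Hypotheses (hP : P = x0 *m y0) (hyx : y0 *m x0 = 1%:M).

Definition sph (g : M) : C := (y0 *m rho g *m x0) 0 0.

Lemma sphE g : y0 *m rho g *m x0 = (sph g)%:M.
Proof. exact: mx11_scalar. Qed.

Lemma y0P : y0 *m P = y0. Proof. by rewrite hP mulmxA hyx mul1mx. Qed.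
Lemma y0_fix g : UB K g -> y0 *m rho g = y0.
Proof. by move=> ug; rewrite -y0P -mulmxA P_rmul. Qed.

Lemma sph1 : sph 1%:M = 1.
Proof. by rewrite /sph (rep1 hrho) mulmx1 hyx mxE eqxx. Qed.

Lemma sph_D g : D g = sph g *: P.
Proof.
by rewrite /sandwich hP -!mulmxA (mulmxA y0) (mulmxA _ x0) sphE mul_scalar_mx -scalemxAr.
Qed.

Lemma sph_corner g h : unitary g -> unitary h -> g i0 i0 = h i0 i0 -> sph g = sph h.
Proof.
move=> ug uh e; have := D_corner ug uh e; rewrite !sph_D => /eqP.
by rewrite -subr_eq0 -scalerBl scaler_eq0 (negbTE P0) orbF subr_eq0 => /eqP.
Qed.

(** The factor x0 y0 in the middle of the product is the projection, that is a mean over K. *)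
Lemma sph_mul g h : unitary g -> unitary h ->
  sph g * sph h = cint (mu K) (fun k => sph (g *m k *m h)).
Proof.
move=> ug uh.
have -> : sph g * sph h = ((y0 *m rho g) *m P *m (rho h *m x0)) 0 0.
  by rewrite hP !mulmxA sphE mul_scalar_mx -!scalemxAl sphE !mxE eqxx mulr1n.
rewrite (avg_sandwich hrho hT (hmu K)) mint_entry; apply: (eq_cint (hmu K)) => k uk.
by rewrite /sph rep3// !mulmxA.
Qed.

Lemma y0_dg t : t * t^* = 1 -> y0 *m rho (dg i0 t) = sph (dg i0 t) *: y0.
Proof.
move=> ht; have ut := dg_unitary i0 ht.
have comm : rho (dg i0 t) *m P = P *m rho (dg i0 t).
  rewrite haar_avgE -(mintMl (hmu K) _ (rep_bmx hrho hT K)).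
  rewrite -(mintMr (hmu K) _ (rep_bmx hrho hT K)).
  apply: (eq_mint (hmu K)) => k uk; have uk' := UB_unitary uk.
  by rewrite -(repM hrho ut uk') -(repM hrho uk' ut) (dg_comm t uk).
by rewrite -{1}y0P -mulmxA -comm mulmxA hP mulmxA sphE mul_scalar_mx.
Qed.

Lemma sph_dg t g : t * t^* = 1 -> unitary g ->
  sph (dg i0 t *m g) = sph (dg i0 t) * sph g.
Proof.
move=> ht ug; rewrite -[LHS]/((y0 *m rho (dg i0 t *m g) *m x0) 0 0).
rewrite (repM hrho (dg_unitary i0 ht) ug) mulmxA (y0_dg ht) -!scalemxAl.
by rewrite (sphE g) !mxE eqxx mulr1n.
Qed.

Definition sph_value := sph (Gmx 0 1).

Lemma Gmx01_unitary : unitary (Gmx 0 1).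
Proof. by apply: Gmx_unitary; rewrite ?rmorph1 ?mul0r ?add0r ?mulr1. Qed.

(** Multiplication by diag(t, 1, .., 1) does not move a corner equal to 0, so f(t) c = c. *)
Lemma sph_value_phase t : sph_value != 0 -> t * t^* = 1 -> sph (dg i0 t) = 1.
Proof.
move=> c0 ht; have := sph_dg ht Gmx01_unitary.
rewrite (sph_corner (h := Gmx 0 1)).
- by move=> /eqP; rewrite -{1}[sph _]mul1r -subr_eq0 -mulrBl mulf_eq0 (negbTE c0) orbF subr_eq0 => /eqP.
- by apply: unitaryM; [exact: dg_unitary|exact: Gmx01_unitary].
- exact: Gmx01_unitary.
- by rewrite mul_dg Gmx_corner mulr0.
Qed.

End Spherical.

(** * The spherical function as a polynomial in the squared modulus of the corner *)

Section SphericalPoly.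
Context {R : realType} {n : nat}.
Local Notation C := R[i].
Local Notation M := 'M[C]_n.
Local Notation T := (mxT R n).
Local Notation full := (finset.setT : {set 'I_n}).

(** Modulo s^2 = 1 - z^2, polynomials in z and s are spanned over the polynomials in z^2 by 1, z, s
    and zs; the four parts behave differently under sign changes of z and s. *)
Lemma curve_poly (p : 'M[C]_2 -> 'M[C]_2 -> C) : polyf p ->
  exists A B E F : {poly C}, forall z s, z ^+ 2 + s ^+ 2 = 1 ->
    p (mx2 z s s (- z)) (mx2 z s s (- z)) =
    A.[z ^+ 2] + z * B.[z ^+ 2] + s * E.[z ^+ 2] + z * s * F.[z ^+ 2].
Proof.
have entry i j : exists A B E F : {poly C}, forall z s, z ^+ 2 + s ^+ 2 = 1 ->
    mx2 z s s (- z) i j =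
    A.[z ^+ 2] + z * B.[z ^+ 2] + s * E.[z ^+ 2] + z * s * F.[z ^+ 2].
  exists 0, (if i == 0 then (if j == 0 then 1 else 0) else (if j == 0 then 0 else -1)),
    (if i == 0 then (if j == 0 then 0 else 1) else (if j == 0 then 1 else 0)), 0.
  move=> z s _; rewrite mxE; case: ifP => _; case: ifP => _;
  by rewrite ?hornerN !(hornerC, horner0) /=; ring.
elim=> {p} [c|i j|i j|p q _ [A [B [E [F h]]]] _ [A' [B' [E' [F' h']]]]|
             p q _ [A [B [E [F h]]]] _ [A' [B' [E' [F' h']]]]].
- by exists c%:P, 0, 0, 0 => z s _; rewrite !(hornerC, horner0); ring.
- exact: entry.
- exact: entry.
- exists (A + A'), (B + B'), (E + E'), (F + F') => z s e.
  by rewrite h// h'// !hornerD; ring.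
exists (A * A' + 'X * B * B' + (1 - 'X) * E * E' + 'X * (1 - 'X) * F * F'),
  (A * B' + B * A' + (1 - 'X) * (E * F' + F * E')),
  (A * E' + E * A' + 'X * (B * F' + F * B')),
  (A * F' + F * A' + B * E' + E * B') => z s e.
rewrite h// h'// !(hornerD, hornerM, hornerN, hornerX, hornerC).
have -> : 1 - z ^+ 2 = s ^+ 2 by rewrite -e addrC addKr.
by ring.
Qed.

Variable mu : {set 'I_n} -> probability T R.
Hypothesis hmu : forall B, is_haar B (mu B).
Variables (i0 i1 : 'I_n).
Hypothesis i01 : i0 != i1.
Local Notation K := (~: [set i0])%SET.
Variables (d : nat) (rho : M -> 'M[C]_d).
Hypotheses (hrho : is_rep rho) (irr : irreducible rho).
Local Notation P := (haar_avg (mu K) rho).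
Hypothesis P0 : P != 0.
Variables (x0 : 'cV[C]_d) (y0 : 'rV[C]_d).
Hypotheses (hP : P = x0 *m y0) (hyx : y0 *m x0 = 1%:M).
Local Notation sph := (sph rho x0 y0).
Local Notation G := (Gmx i0 i1).
Local Notation c := (sph_value i0 i1 rho x0 y0).
Hypothesis phase : forall t, t * t^* = 1 -> sph (dg i0 t) = 1.

Lemma sph_phase t g : t * t^* = 1 -> unitary g -> sph (dg i0 t *m g) = sph g.
Proof.
by move=> ht ug; rewrite (sph_dg hmu hrho hP hyx)// phase// mul1r.
Qed.

Lemma sph_eq g h : unitary g -> unitary h -> g i0 i0 = h i0 i0 -> sph g = sph h.
Proof. exact: (sph_corner hmu hrho P0 hP). Qed.

(** On the real [Gmx z s] the function f is even in s, since it depends on the corner alone, and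
    even in z, by the phase -1; of the four parts of [curve_poly] only A survives. A general corner
    is made nonnegative by a phase. *)
Lemma sph_poly : exists A : {poly C}, forall g, unitary g ->
  sph g = A.[g i0 i0 * (g i0 i0)^*].
Proof.
have [Phi hPhi ePhi] := rep_polynomial (hmu full) hrho irr.
pose p X Y := (y0 *m Phi (emb2 i0 i1 X) (emb2 i0 i1 Y) *m x0) 0 0.
have hp : polyf p.
  have : polymx (fun X Y : 'M[C]_2 => y0 *m Phi (emb2 i0 i1 X) (emb2 i0 i1 Y) *m x0).
    apply: polymxM; last exact: polymx_cst.
    apply: polymxM; first exact: polymx_cst.
    apply: polymx_comp => //; apply: polymx_emb; first exact: polymx_X.
    exact: polymx_Y.
  exact.
have [A [B [E [F h]]]] := curve_poly hp; exists A.
have GE z s : z^* = z -> s^* = s -> z ^+ 2 + s ^+ 2 = 1 ->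
    sph (G z s) = A.[z ^+ 2] + z * B.[z ^+ 2] + s * E.[z ^+ 2] + z * s * F.[z ^+ 2].
  move=> hz hs e; have uG : unitary (G z s).
    by apply: Gmx_unitary => //; rewrite hz -!expr2.
  have eG : emb2 i0 i1 (mx2 z s s (- z)) = G z s by rewrite /Gmx hz.
  have sG : star (G z s) = G z s.
    by rewrite -eG /emb2 emb_star star_mx2 rmorphN /= !hs hz.
  by rewrite -(h z s e) /p eG -{3}sG -(ePhi _ uG).
have GA z s : z^* = z -> s^* = s -> z ^+ 2 + s ^+ 2 = 1 -> sph (G z s) = A.[z ^+ 2].
  move=> hz hs e.
  have hNz : (- z)^* = - z by rewrite rmorphN /= hz.
  have hNs : (- s)^* = - s by rewrite rmorphN /= hs.
  have uG (z' s' : C) : z'^* = z' -> s'^* = s' -> z' ^+ 2 + s' ^+ 2 = 1 -> unitary (G z' s').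
    by move=> h1 h2 h3; apply: Gmx_unitary => //; rewrite h1 -!expr2.
  have e1 : z ^+ 2 + (- s) ^+ 2 = 1 by rewrite sqrrN.
  have e2 : (- z) ^+ 2 + s ^+ 2 = 1 by rewrite sqrrN.
  have e3 : (- z) ^+ 2 + (- s) ^+ 2 = 1 by rewrite !sqrrN.
  have s1 : sph (G z (- s)) = sph (G z s).
    by apply: sph_eq; rewrite ?(Gmx_corner i01)//; exact: uG.
  have N1 : (-1) * (-1)^* = 1 :> C by rewrite rmorphN1 mulrNN mulr1.
  have s2 s' : s'^* = s' -> z ^+ 2 + s' ^+ 2 = 1 -> sph (G (- z) s') = sph (G z s').
    move=> h1 h2; rewrite -(sph_phase N1 (uG _ _ hz h1 h2)).
    apply: sph_eq; first by apply: uG; rewrite ?sqrrN.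
      by apply: unitaryM; [exact: dg_unitary|exact: uG].
    apply: (etrans (Gmx_corner i01 (- z) s')).
    apply: (etrans _ (esym (mul_dg i0 (-1) (G z s') i0 i0))).
    by rewrite (Gmx_corner i01 z s') eqxx mulN1r.
  have h1 := etrans (esym (GE z (- s) hz hNs e1)) (etrans s1 (GE z s hz hs e)).
  have h2 := etrans (esym (GE (- z) s hNz hs e2)) (etrans (s2 _ hs e) (GE z s hz hs e)).
  have h3 := etrans (esym (GE (- z) (- s) hNz hNs e3))
    (etrans (s2 _ hNs e1) (GE z (- s) hz hNs e1)).
  apply: (etrans (GE z s hz hs e)); move: h1 h2 h3; rewrite !sqrrN.
  move: (A.[_]) (B.[_]) (E.[_]) (F.[_]) => a b f g h1 h2 h3.
  (* The four values at the points (z, s) up to signs agree, and their average is a. *)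
  have h4 : 4%:R * (a + z * b + s * f + z * s * g - a) = 0.
    transitivity ((a + z * b + s * f + z * s * g - (a + z * b + - s * f + z * - s * g)) +
      (a + z * b + s * f + z * s * g - (a + - z * b + s * f + - z * s * g)) +
      (a + z * b + s * f + z * s * g - (a + z * b + - s * f + z * - s * g)) +
      (a + z * b + - s * f + z * - s * g - (a + - z * b + - s * f + - z * - s * g))).
      by ring.
    by rewrite h3 h2 h1 !subrr !addr0.
  by apply/eqP; rewrite -subr_eq0; move/eqP: h4; rewrite mulf_eq0 pnatr_eq0.
move=> g ug; set z := g i0 i0.
have z1 : `|z| <= 1 by exact: unitary_entry_le.
pose s := sqrtC (1 - `|z| ^+ 2).
have hs : s^* = s.
  by apply: CrealP; apply: ger0_real; rewrite sqrtC_ge0 subr_ge0 exprn_ile1.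
have hz : `|z|^* = `|z| by apply: CrealP; exact: normr_real.
have e : `|z| ^+ 2 + s ^+ 2 = 1 by rewrite /s sqrtCK addrC subrK.
have [t ht tz] : exists2 t : C, t * t^* = 1 & t * z = `|z|.
  have [->|z0] := eqVneq z 0; first by exists 1; rewrite ?rmorph1 ?mulr1 ?mul1r ?normr0.
  have nz0 : `|z| != 0 by rewrite normr_eq0.
  exists (z^* / `|z|).
    rewrite rmorphM fmorphV /= hz conjCK mulrACA -invfM -expr2 normCK [z^* * z]mulrC.
    by rewrite divff// -normCK expf_neq0.
  by rewrite mulrAC [z^* * z]mulrC -normCK expr2 mulfK.
rewrite -(sph_phase ht ug) -normCK -(GA _ _ hz hs e); apply: sph_eq.
- by apply: unitaryM => //; exact: dg_unitary.
- by apply: Gmx_unitary => //; rewrite hz -!expr2.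
- apply: (etrans (mul_dg i0 t g i0 i0)).
  apply: (etrans _ (esym (Gmx_corner i01 `|z| s))).
  by rewrite eqxx tz.
Qed.

Variable A : {poly C}.
Hypothesis hA : forall g, unitary g -> sph g = A.[g i0 i0 * (g i0 i0)^*].

Lemma sph_poly1 : A.[1] = 1.
Proof.
have e1 : (1%:M : M) i0 i0 = 1 by rewrite mxE eqxx.
by have := hA unitary1; rewrite (sph1 hrho hyx) e1 rmorph1 mulr1 => <-.
Qed.

Lemma sph_value_eqn (z : C) : 0 <= z <= 1 ->
  c * A.[z ^+ 2] =
  \sum_(j < size A) A`_j * moment mu i0 i1 j * (1 - z ^+ 2) ^+ j.
Proof.
move=> /andP[z0 z1]; pose s := sqrtC (1 - z ^+ 2).
have hs : s^* = s.
  by apply: CrealP; apply: ger0_real; rewrite sqrtC_ge0 subr_ge0 exprn_ile1.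
have hz : z^* = z by apply: CrealP; exact: ger0_real.
have e : z ^+ 2 + s ^+ 2 = 1 by rewrite /s sqrtCK addrC subrK.
have uG : unitary (G z s) by apply: Gmx_unitary => //; rewrite hz -!expr2.
have u1 := @Gmx01_unitary R n i0 i1 i01.
have -> : A.[z ^+ 2] = sph (G z s).
  by rewrite (hA uG) (Gmx_corner i01 z s) hz expr2.
rewrite /sph_value (sph_mul hmu hrho hP)//.
have term j : bmf K (fun k : M => A`_j * (1 - z ^+ 2) ^+ j * (k i1 i1 * (k i1 i1)^*) ^+ j).
  by apply: bmfM; [exact: bmf_cst|exact: moment_bmf].
transitivity (cint (mu K) (fun k => \sum_(j < size A)
    A`_j * (1 - z ^+ 2) ^+ j * (k i1 i1 * (k i1 i1)^*) ^+ j)).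
  apply: (eq_cint (hmu K)) => k uk; have uk' := UB_unitary uk.
  rewrite hA; last by apply: unitaryM => //; exact: unitaryM.
  rewrite (Gmx_mid i01 0 1 z s uk) mul0r add0r mul1r rmorphM /= hs horner_coef.
  apply: eq_bigr => j _; rewrite mulrACA -expr2 /s sqrtCK exprMn mulrA //.
rewrite (cint_sum (hmu K)); last by move=> j; exact: term.
apply: eq_bigr => j _.
apply: (etrans (cintZ (hmu K) _ (@moment_bmf R n i0 i1 j))).
by rewrite -/(moment mu i0 i1 j) mulrAC.
Qed.

Lemma sph_value_lead : A != 0 ->
  c = (-1) ^+ (size A).-1 * moment mu i0 i1 (size A).-1.
Proof.
move=> A0; set m := (size A).-1.
have sA : size A = m.+1 by rewrite prednK// size_poly_gt0.
pose Q := c *: A - \sum_(j < size A) (A`_j * moment mu i0 i1 j) *: (1 - 'X) ^+ j.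
have Q0 : Q = 0.
  (* The relation is known for z in [0, 1]; the points z = 1/(k+1) are enough to make it an identity
     of polynomials in z^2. *)
  apply: (@poly_inj_root _ Q (fun k => (k.+1%:R^-1) ^+ 2 : C)).
    move=> j k /eqP; rewrite eqrXn2// ?invr_ge0 ?ler0n// => /eqP/invr_inj/eqP.
    by rewrite eqr_nat eqSS => /eqP.
  move=> k; rewrite !hornerE horner_sum sph_value_eqn; last first.
    by rewrite invr_ge0 ler0n invf_le1 ?ltr0n// ler1n.
  apply/eqP; rewrite subr_eq0; apply/eqP/eq_bigr => j _.
  by rewrite !hornerE.
have := congr1 (fun p : {poly C} => p`_m) Q0; rewrite coef0 coefB coefZ coef_sum sA.
rewrite big_ord_recr/= big1 ?add0r => [|j _]; last first.
  rewrite coefZ [X in _ * X]nth_default ?mulr0//.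
  apply: leq_trans (size_poly_exp_leq _ _) _.
  have -> : (size (1 - 'X : {poly C})).-1 = 1%N.
    by rewrite -opprB size_polyN -[1]/(1%:P) size_XsubC.
  by rewrite mul1n.
rewrite coefZ.
have -> : ((1 - 'X) ^+ m : {poly C})`_m = (-1) ^+ m.
  have -> : (1 - 'X : {poly C}) = (-1)%:P * ('X - 1%:P).
    by rewrite polyCN mulNr polyC1 mul1r opprB.
  rewrite exprMn -rmorphXn coefCM /=.
  have /monicP := monic_exp m (monicXsubC (1 : C)).
  by rewrite lead_coefE size_exp_XsubC /= => ->; rewrite mulr1.
have Am : A`_m != 0 by rewrite -lead_coefE lead_coef_eq0.
move=> /eqP; rewrite subr_eq0 -mulrA mulrC => /eqP/(mulfI Am) ->.
by rewrite mulrC.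
Qed.

(** A constant f is 1, so y0 rho(g) - y0 annihilates every rho(h) x0. Then y0 is a fixed vector and
    the representation is trivial. *)
Lemma sph_poly_deg : nontrivial rho -> (0 < (size A).-1)%N.
Proof.
move=> [g0 [ug0 hg0]]; rewrite lt0n; apply/eqP => m0.
have sA : (size A <= 1)%N by move: m0; case: (size A) => [|[]].
have A1 g : unitary g -> sph g = 1.
  by move=> ug; rewrite hA// (size1_polyC sA) hornerC -sph_poly1 (size1_polyC sA) hornerC coefC.
have yfix g : unitary g -> y0 *m rho g = y0.
  move=> ug; have [|e|x00] := @irr_mx0 _ _ _ _ hrho irr _ _ (y0 *m rho g - y0) x0.
  - move=> h uh; rewrite !mulmxBl -(mulmxA y0) -(repM hrho)// !(sphE rho x0 y0).
    by rewrite !A1 ?subrr//; exact: unitaryM.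
  - by apply/eqP; rewrite -subr_eq0 e.
  - move: hyx; rewrite x00 mulmx0 => /matrixP/(_ 0 0); rewrite !mxE eqxx => /eqP.
    by rewrite eq_sym oner_eq0.
apply: hg0.
have fixall : forall v : 'rV[C]_d, forall g, unitary g -> v *m rho g = v.
  apply: (irr_ind irr (P := fun v => forall g, unitary g -> v *m rho g = v)).
  - by move=> g _; rewrite mul0mx.
  - by move=> u v hu hv g ug; rewrite mulmxDl hu// hv.
  - by move=> a v hv g ug; rewrite -scalemxAl hv.
  - by move=> g v ug hv h uh; rewrite (hv g ug) hv.
  exists y0 => //; apply/eqP => y00; move: hyx; rewrite y00 mul0mx.
  by move=> /matrixP/(_ 0 0); rewrite !mxE eqxx => /eqP; rewrite eq_sym oner_eq0.
by apply/row_matrixP => i; rewrite rowE fixall// row1.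
Qed.

End SphericalPoly.

Lemma sub_inv_inj (F : fieldType) (u v : F) : u != 0 -> v != 0 -> 1 + u * v != 0 ->
  u - u^-1 = v - v^-1 -> u = v.
Proof.
move=> u0 v0 uv e; have : (u - v) * (1 + u * v) = 0.
  transitivity (((u - u^-1) - (v - v^-1)) * (u * v)); last by rewrite e subrr mul0r.
  by field; rewrite u0 v0.
by move=> /eqP; rewrite mulf_eq0 subr_eq0 (negbTE uv) orbF => /eqP.
Qed.

(** * Complexification and highest weight vectors *)

Section ZariskiClosure.
Context {R : realType} {n : nat}.
Local Notation C := R[i].
Local Notation M := 'M[C]_n.

(** The Cayley transforms (1 + k i)/(1 - k i). They allow identities between polynomials to be
    tested on the unit circle. *)
Lemma infinite_units : exists2 f : nat -> C, injective f & forall k, f k * (f k)^* = 1.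
Proof.
pose a (k : nat) : C := 1 + k%:R * 'i; pose b (k : nat) : C := 1 - k%:R * 'i.
have ab k : a k * b k = 1 + k%:R ^+ 2.
  transitivity (1 - k%:R ^+ 2 * ('i : C) ^+ 2); first by rewrite /a /b; ring.
  by rewrite sqrCi mulrN1 opprK.
have ab0 k : a k * b k != 0.
  by rewrite ab lt0r_neq0// ltr_pwDl// exprn_ge0.
have b0 k : b k != 0 by move: (ab0 k); rewrite mulf_eq0 negb_or => /andP[].
have a0 k : a k != 0 by move: (ab0 k); rewrite mulf_eq0 negb_or => /andP[].
have ca k : (a k)^* = b k.
  by rewrite /a /b rmorphD rmorph1 rmorphM /= conjCi rmorph_nat mulrN.
have cb k : (b k)^* = a k by rewrite -ca conjCK.
exists (fun k => a k / b k).
  move=> j k /eqP; rewrite eqr_div// => /eqP h.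
  have : (j%:R - k%:R) * (2%:R * 'i) = 0 :> C.
    transitivity (a j * b k - a k * b j); last by rewrite h subrr.
    by rewrite /a /b; ring.
  move=> /eqP; rewrite mulf_eq0 subr_eq0 eqr_nat mulf_eq0 pnatr_eq0 /=.
  by rewrite (negbTE (neq0Ci _)) orbF => /eqP.
move=> k; rewrite rmorphM fmorphV /= ca cb mulrACA -invfM [b k * a k]mulrC.
by rewrite mulfV.
Qed.

(* The Zariski closure of the pairs (g, g^* ) with g unitary; its members are the
   pairs (X, X^-1) with X invertible. *)
Definition zcl (X Y : M) := forall p : M -> M -> C, polyf p ->
  (forall g, unitary g -> p g (star g) = 0) -> p X Y = 0.

Lemma zcl_unitary g : unitary g -> zcl g (star g).
Proof. by move=> ug p _; exact. Qed.

Lemma polymx_lmulX (A : M) : polymx (fun X Y : M => A *m X).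
Proof. by apply: polymxM; [exact: polymx_cst|exact: polymx_X]. Qed.
Lemma polymx_rmulX (A : M) : polymx (fun X Y : M => X *m A).
Proof. by apply: polymxM; [exact: polymx_X|exact: polymx_cst]. Qed.
Lemma polymx_lmulY (A : M) : polymx (fun X Y : M => A *m Y).
Proof. by apply: polymxM; [exact: polymx_cst|exact: polymx_Y]. Qed.
Lemma polymx_rmulY (A : M) : polymx (fun X Y : M => Y *m A).
Proof. by apply: polymxM; [exact: polymx_Y|exact: polymx_cst]. Qed.

(** As for the closure of any group, the factors leave the unitary group one after the other. Second
    coordinates multiply in reverse order, like adjoints. *)
Lemma zclM X Y X' Y' : zcl X Y -> zcl X' Y' -> zcl (X *m X') (Y' *m Y).
Proof.
move=> h h' p hp p0.
have hr : polyf (fun A D => p (A *m X') (Y' *m D)).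
  by apply: polyf_comp hp _ _; [exact: polymx_rmulX|exact: polymx_lmulY].
apply: (h _ hr) => g ug.
have hq : polyf (fun A D => p (g *m A) (D *m star g)).
  by apply: polyf_comp hp _ _; [exact: polymx_lmulX|exact: polymx_rmulY].
by apply: (h' _ hq) => g' ug'; rewrite -starM; apply: p0; exact: unitaryM.
Qed.

Lemma zcl_inv X Y : zcl X Y -> X *m Y = 1%:M.
Proof.
move=> h; apply/matrixP => i j; apply/eqP; rewrite -subr_eq0; apply/eqP.
have hp : polyf (fun A D : M => (A *m D) i j - (1%:M : M) i j).
  by apply: polyfB (polyf_cst _); apply: polymxM; [exact: polymx_X|exact: polymx_Y].
by apply: (h _ hp) => g /unitaryE ->; rewrite subrr.
Qed.

Lemma laurent_dg (p : M -> M -> C) i : polyf p ->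
  exists N (q : {poly C}), forall z, z != 0 ->
    z ^+ N * p (dg i z) (dg i z^-1) = q.[z].
Proof.
elim=> {p} [c|a b|a b|p q _ [N1 [q1 h1]] _ [N2 [q2 h2]]|p q _ [N1 [q1 h1]] _ [N2 [q2 h2]]].
- by exists 0%N, c%:P => z _; rewrite mul1r hornerC.
- exists 0%N, ((if a == i then 'X else 1) *+ (a == b)) => z _.
  by rewrite mul1r dgE hornerMn; case: ifP => _; rewrite ?hornerX ?hornerC.
- exists 1%N, ((if a == i then 1 else 'X) *+ (a == b)) => z z0.
  rewrite expr1 dgE hornerMn mulrnAr; case: ifP => _; rewrite ?hornerX ?hornerC ?mulr1//.
  by rewrite mulfV.
- exists (N1 + N2)%N, ('X^N2 * q1 + 'X^N1 * q2) => z z0.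
  rewrite hornerD !hornerM !hornerXn -(h1 z z0) -(h2 z z0) exprD mulrDr; congr (_ + _).
    by rewrite mulrA [z ^+ N2 * _]mulrC.
  by rewrite mulrA.
- exists (N1 + N2)%N, (q1 * q2) => z z0.
  by rewrite hornerM -(h1 z z0) -(h2 z z0) exprD mulrACA.
Qed.

(** Along [dg i z] the function is a Laurent polynomial in z, which is zero if it vanishes on the
    unit circle. *)
Lemma zcl_dg_poly (p : M -> M -> C) i z : polyf p ->
  (forall t, t * t^* = 1 -> p (dg i t) (dg i t^-1) = 0) -> z != 0 ->
  p (dg i z) (dg i z^-1) = 0.
Proof.
move=> hp h z0; have [N [q hq]] := laurent_dg i hp.
have [f injf hf] := infinite_units.
have q0 : q = 0.
  apply: (poly_inj_root injf) => k; have fk0 : f k != 0.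
    by apply/eqP => e; move: (hf k); rewrite e mul0r => /eqP; rewrite eq_sym oner_eq0.
  by rewrite -hq// h// mulr0.
have := hq z z0; rewrite q0 horner0 => /eqP.
by rewrite mulf_eq0 expf_eq0 (negbTE z0) andbF => /eqP.
Qed.

Lemma star_dg i t : t * t^* = 1 -> star (dg i t) = dg i t^-1 :> M.
Proof.
move=> ht; have t0 : t != 0.
  by apply/eqP => e; move: ht; rewrite e mul0r => /eqP; rewrite eq_sym oner_eq0.
have -> : t^-1 = t^* by apply: (mulfI t0); rewrite mulfV// ht.
apply/matrixP => a b; rewrite starE !dgE [b == a]eq_sym rmorphMn /=.
have [->|_] := eqVneq a b; last by rewrite !mulr0n.
by case: ifP; rewrite ?rmorph1.
Qed.

Lemma zcl_dg i z : z != 0 -> zcl (dg i z) (dg i z^-1).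
Proof.
move=> z0 p hp p0; apply: zcl_dg_poly => // t ht.
by rewrite -star_dg//; apply: p0; exact: dg_unitary.
Qed.

Definition El (i j : 'I_n) (x : C) : M := 1%:M + x *: delta_mx i j.

Lemma El_emb2 i j x : i != j -> El i j x = emb2 i j (mx2 1 x 0 1).
Proof.
move=> ij; rewrite /El /emb2 /emb; congr (_ + _).
have -> : mx2 1 x 0 1 - 1%:M = x *: delta_mx 0 1.
  by apply: mx2P; rewrite !mxE /=; ring.
rewrite -scalemxAr -scalemxAl; congr (_ *: _).
apply/matrixP => a b; rewrite !mxE (bigD1 1)//= big1 ?addr0.
  rewrite !mxE (bigD1 0)//= big1 ?addr0; first by rewrite !mxE /pair_incl /= mulr1 -natrM mulnb eq_sym [j == b]eq_sym.
  by move=> k k0; rewrite !mxE (negbTE k0) mulr0.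
move=> k k1; rewrite !mxE big1 ?mul0r// => l _.
by rewrite !mxE (negbTE k1) andbF mulr0.
Qed.

Lemma El_poly (p : M -> M -> C) i j : polyf p ->
  exists q : {poly C}, forall x, p (El i j x) (El i j (- x)) = q.[x].
Proof.
elim=> {p} [c|a b|a b|p q _ [q1 h1] _ [q2 h2]|p q _ [q1 h1] _ [q2 h2]].
- by exists c%:P => x; rewrite hornerC.
- exists (((1%:M : M) a b)%:P + ((delta_mx i j : M) a b)%:P * 'X) => x.
  by rewrite !hornerE [LHS]mxE [X in _ + X]mxE mulrC.
- exists (((1%:M : M) a b)%:P - ((delta_mx i j : M) a b)%:P * 'X) => x.
  by rewrite !hornerE [LHS]mxE [X in _ + X]mxE mulNr mulrC.
- by exists (q1 + q2) => x; rewrite h1 h2 hornerD.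
- by exists (q1 * q2) => x; rewrite h1 h2 hornerM.
Qed.

Lemma dg_emb2l (i j : 'I_n) (z : C) : i != j -> dg i z = emb2 i j (mx2 z 0 0 1).
Proof.
move=> ij; apply/matrixP => a b; rewrite dgE.
have inj := pair_incl_inj ij; have ji : j != i by rewrite eq_sym.
have eii : emb2 i j (mx2 z 0 0 1) i i = z.
  by apply: (etrans (embE inj 0 0 _)); rewrite mxE.
have eij : emb2 i j (mx2 z 0 0 1) i j = 0.
  by apply: (etrans (embE inj 0 1 _)); rewrite mxE.
have eji : emb2 i j (mx2 z 0 0 1) j i = 0.
  by apply: (etrans (embE inj 1 0 _)); rewrite mxE.
have ejj : emb2 i j (mx2 z 0 0 1) j j = 1.
  by apply: (etrans (embE inj 1 1 _)); rewrite mxE.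
have out k : k != i -> k != j -> forall l, pair_incl i j l != k.
  by move=> ki kj l; rewrite /pair_incl; case: ifP => _; rewrite eq_sym.
case: (boolP (a == i)) => [/eqP ea|ai].
  rewrite ea ?eqxx; case: (boolP (b == i)) => [/eqP ->|bi]; first by rewrite eii eqxx.
  case: (boolP (b == j)) => [/eqP ->|bj]; first by rewrite eij (negbTE ij).
  by rewrite /emb2 emb_out; [rewrite eq_sym (negbTE bi)|right; exact: out].
case: (boolP (a == j)) => [/eqP ea|aj].
  rewrite ea ?eqxx; case: (boolP (b == i)) => [/eqP ->|bi]; first by rewrite eji (negbTE ji).
  case: (boolP (b == j)) => [/eqP ->|bj]; first by rewrite ejj eqxx.
  by rewrite /emb2 emb_out; [rewrite eq_sym (negbTE bj)|right; exact: out].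
by rewrite /emb2 emb_out//; left; exact: out.
Qed.

Lemma emb2_swap (i j : 'I_n) (A : 'M[C]_2) : i != j ->
  emb2 i j A = emb2 j i (mx2 (A 1 1) (A 1 0) (A 0 1) (A 0 0)).
Proof.
move=> ij; have ji : j != i by rewrite eq_sym.
have inj := pair_incl_inj ij; have inj' := pair_incl_inj ji.
pose A' := mx2 (A 1 1) (A 1 0) (A 0 1) (A 0 0).
apply/matrixP => a b.
have out k : k != i -> k != j ->
    (forall l, pair_incl i j l != k) /\ (forall l, pair_incl j i l != k).
  by move=> ki kj; split=> l; rewrite /pair_incl; case: ifP => _; rewrite eq_sym.
have [->|ai] := eqVneq a i; [|have [->|aj] := eqVneq a j];
  (have [->|bi] := eqVneq b i; [|have [->|bj] := eqVneq b j]).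
- apply: (etrans (embE inj 0 0 A)); apply: esym.
  by apply: (etrans (embE inj' 1 1 A')); rewrite mxE.
- apply: (etrans (embE inj 0 1 A)); apply: esym.
  by apply: (etrans (embE inj' 1 0 A')); rewrite mxE.
- by have [h1 h2] := out b bi bj; rewrite /emb2 !emb_out//; right.
- apply: (etrans (embE inj 1 0 A)); apply: esym.
  by apply: (etrans (embE inj' 0 1 A')); rewrite mxE.
- apply: (etrans (embE inj 1 1 A)); apply: esym.
  by apply: (etrans (embE inj' 0 0 A')); rewrite mxE.
- by have [h1 h2] := out b bi bj; rewrite /emb2 !emb_out//; right.
all: by have [h1 h2] := out a ai aj; rewrite /emb2 !emb_out//; left.
Qed.

Lemma dg_emb2r (i j : 'I_n) (z : C) : i != j -> dg j z = emb2 i j (mx2 1 0 0 z).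
Proof.
by move=> ij; rewrite (@dg_emb2l j i) 1?eq_sym// (emb2_swap _ ij) !mxE.
Qed.

Lemma zcl_emb2M (i j : 'I_n) (A A' D D' : 'M[C]_2) : i != j ->
  zcl (emb2 i j A) (emb2 i j A') -> zcl (emb2 i j D) (emb2 i j D') ->
  zcl (emb2 i j (A *m D)) (emb2 i j (D' *m A')).
Proof.
move=> ij h h'; have inj := pair_incl_inj ij.
have e1 := embM inj A D; have e2 := embM inj D' A'.
by rewrite /emb2 -e1 -e2; exact: zclM h h'.
Qed.

Lemma zcl_emb2_unitary (i j : 'I_n) (A : 'M[C]_2) : i != j -> unitary A ->
  zcl (emb2 i j A) (emb2 i j (star A)).
Proof.
move=> ij uA; rewrite /emb2 -emb_star; apply: zcl_unitary.
by apply: emb_unitary => //; exact: pair_incl_inj.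
Qed.

Lemma zcl_emb2_conj (i j : 'I_n) (A A' Q S : 'M[C]_2) : i != j -> unitary Q -> unitary S ->
  zcl (emb2 i j A) (emb2 i j A') ->
  zcl (emb2 i j (Q *m A *m star Q *m S)) (emb2 i j (star S *m (star (star Q) *m (A' *m star Q)))).
Proof.
move=> ij uQ uS hA; have hQ := zcl_emb2_unitary ij uQ.
have hQ' := zcl_emb2_unitary ij (unitary_star uQ); have hS := zcl_emb2_unitary ij uS.
exact: (zcl_emb2M ij (zcl_emb2M ij (zcl_emb2M ij hQ hA) hQ') hS).
Qed.

(* [[1, x], [0, 1]] is the product of the swap and of the real symmetric matrix
   [[x, 1], [1, 0]], whose eigenvalues are m and -1/m if x = m - 1/m. *)
Lemma zcl_El i j x : i != j -> zcl (El i j x) (El i j (- x)).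
Proof.
move=> ij p hp p0; have [q hq] := El_poly i j hp; rewrite hq.
suff -> : q = 0 by rewrite horner0.
(* The dependence on x is polynomial, so the values x = m - 1/m with m a positive integer
   suffice. *)
pose f (k : nat) : C := k.+1%:R - k.+1%:R^-1.
apply: (@poly_inj_root _ q f).
  move=> a b /sub_inv_inj h.
  have : a.+1%:R = b.+1%:R :> C.
    by apply: h; rewrite ?pnatr_eq0// -natrM natr1 pnatr_eq0.
  by move=> /eqP; rewrite eqr_nat eqSS => /eqP.
move=> k; rewrite -hq; set m : C := k.+1%:R.
have m0 : m != 0 by rewrite pnatr_eq0.
have mr : m^* = m by rewrite rmorph_nat.
pose w := 1 + m ^+ 2; pose b := (sqrtC w)^-1.
have w0 : 0 < w by rewrite ltr_pwDl// exprn_ge0.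
have bb : b ^+ 2 = w^-1 by rewrite exprVn sqrtCK.
have br : b^* = b.
  by apply: CrealP; apply: ger0_real; rewrite invr_ge0 sqrtC_ge0 ltW.
(* Its columns are unit eigenvectors of [[x, 1], [1, 0]] for m and -1/m. *)
pose Rot := mx2 (m * b) (- b) b (m * b).
have uR : unitary Rot.
  apply/unitaryE; rewrite star_mx2 mul_mx2 -mx2_1 !(rmorphM, rmorphN) /= br mr.
  have e : (m * b) * (m * b) + b * b = 1.
    by transitivity (w * b ^+ 2); [rewrite /w; ring|rewrite bb mulfV// lt0r_neq0].
  by congr mx2; rewrite -?e; ring.
have uS : unitary (mx2 0 1 1 0 : 'M[C]_2).
  by apply/unitaryE; rewrite star_mx2 mul_mx2 -mx2_1 !(rmorph0, rmorph1); congr mx2; ring.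
have zD : zcl (emb2 i j (mx2 m 0 0 (- m^-1))) (emb2 i j (mx2 m^-1 0 0 (- m))).
  have -> : mx2 m 0 0 (- m^-1) = mx2 m 0 0 1 *m mx2 1 0 0 (- m^-1).
    by rewrite mul_mx2; congr mx2; ring.
  have -> : mx2 m^-1 0 0 (- m) = mx2 1 0 0 ((- m^-1)^-1) *m mx2 m^-1 0 0 1.
    by rewrite mul_mx2 invrN invrK; congr mx2; ring.
  apply: zcl_emb2M => //.
    by rewrite -!dg_emb2l//; exact: zcl_dg.
  by rewrite -!dg_emb2r//; apply: zcl_dg; rewrite oppr_eq0 invr_eq0.
have b2 : b * b * (1 + m ^+ 2) = 1 by rewrite -expr2 bb mulVf// lt0r_neq0.
have sRot : star Rot = mx2 (m * b) b (- b) (m * b).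
  by rewrite star_mx2 !(rmorphM, rmorphN) /= br mr.
have sS : star (mx2 0 1 1 0) = mx2 0 1 1 0 :> 'M[C]_2.
  by rewrite star_mx2 !(rmorph0, rmorph1).
have e1 : Rot *m mx2 m 0 0 (- m^-1) *m star Rot *m mx2 0 1 1 0 =
    mx2 1 (m - m^-1) 0 1.
  rewrite sRot !mul_mx2; congr mx2.
  - by rewrite -[RHS]b2; field.
  - by transitivity (b * b * (1 + m ^+ 2) * (m - m^-1)); [field|rewrite b2 mul1r].
  - by field.
  - by rewrite -[RHS]b2; field.
have e2 : star (mx2 0 1 1 0) *m (star (star Rot) *m (mx2 m^-1 0 0 (- m) *m star Rot)) =
    mx2 1 (- (m - m^-1)) 0 1.
  rewrite starK sRot sS !mul_mx2; congr mx2.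
  - by rewrite -[RHS]b2; field.
  - by transitivity (- (b * b * (1 + m ^+ 2) * (m - m^-1))); [field|rewrite b2 mul1r].
  - by field.
  - by rewrite -[RHS]b2; field.
rewrite (El_emb2 (m - m^-1) ij) (El_emb2 (- (m - m^-1)) ij) -e1 -e2.
exact: (zcl_emb2_conj ij uR uS zD).
Qed.

End ZariskiClosure.

(** * Gaussian elimination *)

Section Gauss.
Context {R : realType} {n : nat}.
Local Notation C := R[i].
Local Notation M := 'M[C]_n.

Definition id_off (B : {set 'I_n}) (X : M) :=
  forall i j, (i \notin B) || (j \notin B) -> X i j = (i == j)%:R.

Variables (S : {set 'I_n}) (Q : M -> Prop).
Hypotheses (Q1 : Q 1%:M) (QM : forall X Y, Q X -> Q Y -> Q (X *m Y)).
Hypothesis QEl : forall i j (x : C), i \in S -> j \in S -> i != j -> Q (El i j x).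
Hypothesis Qdg : forall i (z : C), i \in S -> z != 0 -> Q (dg i z).

Lemma El_mulr i j x (A : M) a b : (El i j x *m A) a b = A a b + x * (a == i)%:R * A j b.
Proof.
rewrite /El mulmxDl mul1mx mxE; congr (_ + _).
rewrite -scalemxAl mxE -mulrA; congr (_ * _).
rewrite mxE (bigD1 j)//= big1 ?addr0 => [|k kj].
  by rewrite mxE eqxx andbT.
by rewrite mxE (negbTE kj) andbF mul0r.
Qed.

Lemma El_mull i j x (A : M) a b : (A *m El i j x) a b = A a b + x * (b == j)%:R * A a i.
Proof.
rewrite /El mulmxDr mulmx1 mxE; congr (_ + _).
rewrite -scalemxAr mxE -mulrA; congr (_ * _).
rewrite mxE (bigD1 i)//= big1 ?addr0 => [|k ki].
  by rewrite mxE eqxx /= mulrC.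
by rewrite mxE (negbTE ki) mulr0.
Qed.

Lemma El_inv (i j : 'I_n) (x : C) : i != j -> El i j x *m El i j (- x) = 1%:M.
Proof.
move=> ij; apply/matrixP => a b; rewrite El_mulr /El !mxE.
by rewrite [j == i]eq_sym (negbTE ij) /= mulr0 addr0 -mulnb natrM eq_sym [j == b]eq_sym; ring.
Qed.

Lemma El_unitmx (i j : 'I_n) (x : C) : i != j -> El i j x \in unitmx.
Proof. by move=> ij; have /mulmx1_unit[] := El_inv x ij. Qed.

(** Induction on the size of [B]: with a nonzero pivot at [i], clear row and column [i] by
    elementary matrices, split off the pivot as a diagonal matrix, and recurse on B without i. [Q]
    will be a stabilizer, known to contain these generators. *)
Lemma gauss (B : {set 'I_n}) (X : M) :
  B \subset S -> X \in unitmx -> id_off B X -> Q X.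
Proof.
move: {2}#|B| (erefl #|B|) => N eN; elim: N B eN X => [|N IH] B eN X BS uX hX.
  suff -> : X = 1%:M by [].
  apply/matrixP => a b; rewrite hX ?mxE//.
  by move/eqP: eN; rewrite cards_eq0 => /eqP ->; rewrite inE.
have /card_gt0P[i iB] : (0 < #|B|)%N by rewrite eN.
have iS : i \in S by exact: (fintype.subsetP BS).
have BiN : #|B :\ i|%SET = N by move: eN; rewrite (cardsD1 i) iB => -[].
have BiS : (B :\ i \subset S)%SET by rewrite (fintype.subset_trans _ BS)// subD1set.
have Bout a : a \notin B -> a != i by apply: contraNneq => ->.
have pivot (Z : M) : Z \in unitmx -> id_off B Z -> Z i i != 0 -> Q Z.
  move=> uZ hZ z0; set z := Z i i in z0.
  (* [s] lists the indices at which row or column [i] may still be nonzero. *)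
  have clear (s : seq 'I_n) (Y : M) : Y \in unitmx -> id_off B Y -> Y i i = z ->
      (forall j, j != i -> j \notin s -> Y i j = 0 /\ Y j i = 0) -> Q Y.
    elim: s Y => [|j s IHs] Y uY hY Yz Yij.
      have -> : Y = dg i z *m (dg i z^-1 *m Y).
        by apply/matrixP => a b; rewrite !mul_dg; case: ifP => _; rewrite ?mul1r// mulrA mulfV// mul1r.
      apply: QM; first exact: Qdg.
      apply: (IH (B :\ i)%SET) => //.
        rewrite unitmx_mul uY andbT; suff: dg i z^-1 *m dg i z = 1%:M by move=> /mulmx1_unit[].
        apply/matrixP => a b; rewrite mul_dg dgE mxE.
        by case: ifP => _; rewrite ?mul1r// mulrnAr mulVf.
      move=> a b; rewrite mul_dg !inE !negb_and !negbK.
      have [->|ai] /= := eqVneq a i.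
        have [->|bi] := eqVneq b i; first by rewrite Yz mulVf.
        by move=> _; rewrite (Yij b bi _).1 ?mulr0// eq_sym (negbTE bi).
      have [->|bi] /= := eqVneq b i; first by rewrite (Yij a ai _).2 ?mulr0// (negbTE ai).
      by rewrite mul1r; exact: hY.
    have [ji|ji] := eqVneq j i.
      apply: (IHs Y) => // k ki ks; apply: Yij => //.
      by rewrite inE negb_or ks andbT ji.
    have [jB|jB] := boolP (j \in B); last first.
      apply: (IHs Y) => // k ki ks; have [->|kj] := eqVneq k j.
        by rewrite !hY ?jB ?orbT// eq_sym (negbTE ji).
      by apply: Yij => //; rewrite inE negb_or kj.
    have jS : j \in S by exact: (fintype.subsetP BS).
    have ij : i != j by rewrite eq_sym.
    pose c := Y j i / z; pose e := Y i j / z.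
    pose Y' := El j i (- c) *m Y *m El i j (- e).
    have Y'E a b : Y' a b = Y a b - c * (a == j)%:R * Y i b +
       - e * (b == j)%:R * (Y a i - c * (a == j)%:R * Y i i).
      by rewrite /Y' El_mull !El_mulr !mulNr.
    have -> : Y = El j i c *m Y' *m El i j e.
      rewrite /Y' !mulmxA El_inv// mul1mx -mulmxA.
      by have := El_inv (- e) ij; rewrite opprK => ->; rewrite mulmx1.
    apply: QM; last exact: QEl.
    apply: QM; first exact: QEl.
    apply: IHs.
    - by rewrite !unitmx_mul !El_unitmx// uY.
    - move=> a b hab; rewrite Y'E hY//.
      have [aB|aB] := boolP (a \in B).
        have bB : b \notin B by move: hab; rewrite aB.
        have -> : (b == j) = false by apply/negbTE; apply: contraNneq bB => ->.
        have -> : Y i b = 0 by rewrite hY ?bB ?orbT// eq_sym (negbTE (Bout _ bB)).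
        by rewrite /=; ring.
      have -> : (a == j) = false by apply/negbTE; apply: contraNneq aB => ->.
      have -> : Y a i = 0 by rewrite hY ?aB// (negbTE (Bout _ aB)).
      by rewrite /=; ring.
    - by rewrite Y'E (negbTE ij) Yz /=; ring.
    - move=> k ki ks; rewrite !Y'E Yz (negbTE ij) !mulr0 !mul0r ?addr0 !subr0.
      have [->|kj] := eqVneq k j.
        by split; rewrite /c /e /= mulr1 ?mulNr divfK// subrr.
      have [|h1 h2] := Yij k ki; first by rewrite inE negb_or kj.
      by rewrite h1 h2 /=; split; ring.
  apply: (clear (enum 'I_n) Z) => // j ji; by rewrite mem_enum.
(* A zero pivot is repaired by adding to column [i] a column [j] that is nonzero in row [i]; one
   exists since [X] is invertible. *)
have [z0|] := eqVneq (X i i) 0; last exact: pivot.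
have /existsNP[j hj] : ~ forall j, X i j = 0.
  move=> r0; have : row i X *m invmx X = 0.
    have -> : row i X = 0 by apply/rowP => k; rewrite !mxE.
    by rewrite mul0mx.
  by rewrite rowE -mulmxA mulmxV// mulmx1 => /rowP/(_ i); rewrite !mxE !eqxx => /eqP; rewrite oner_eq0.
have ji : j != i by apply: contra_notN hj => /eqP ->.
have jB : j \in B.
  by apply: contra_notT hj => jB; rewrite hX ?jB ?orbT// eq_sym (negbTE ji).
have jS : j \in S by exact: (fintype.subsetP BS).
have -> : X = X *m El j i 1 *m El j i (- 1) by rewrite -mulmxA El_inv// mulmx1.
apply: QM; last exact: QEl.
apply: pivot.
- by rewrite unitmx_mul uX El_unitmx.
- move=> a b hab; rewrite El_mull hX// mul1r.
  have [aB|aB] := boolP (a \in B).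
    have bB : b \notin B by move: hab; rewrite aB.
    by rewrite (negbTE (Bout _ bB)) mul0r addr0.
  have -> : X a j = 0.
    by rewrite hX ?aB//; case: eqVneq aB => // ->; rewrite jB.
  by rewrite mulr0 addr0.
- by rewrite El_mull z0 eqxx add0r !mul1r; exact/eqP.
Qed.

End Gauss.

Lemma divf_cancel (F : fieldType) (x a b : F) : a != 0 -> b != 0 ->
  x * (a / b) * (a^-1 / b^-1) = x.
Proof. by move=> a0 b0; rewrite invrK -mulrA mulrACA mulfV// mulVf// !mulr1. Qed.

(** * Extension of a representation to the closure, and root subgroups *)

Section Extension.
Context {R : realType} {n d : nat}.
Local Notation C := R[i].
Local Notation M := 'M[C]_n.
Variables (rho : M -> 'M[C]_d) (Phi : M -> M -> 'M[C]_d).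
Hypotheses (hrho : is_rep rho) (hPhi : polymx Phi).
Hypothesis ePhi : forall g, unitary g -> rho g = Phi g (star g).

Lemma Phi1 : Phi 1%:M 1%:M = 1%:M.
Proof. by rewrite -(rep1 hrho) (ePhi unitary1) star1. Qed.

(** Multiplicativity is a polynomial identity on unitary pairs, and it passes to the closure in one
    factor at a time. *)
Lemma PhiM X Y X' Y' : zcl X Y -> zcl X' Y' ->
  Phi (X *m X') (Y' *m Y) = Phi X Y *m Phi X' Y'.
Proof.
move=> h h'; apply/matrixP => k l; apply/eqP; rewrite -subr_eq0; apply/eqP.
have hp : polyf (fun A D => Phi (A *m X') (Y' *m D) k l - (Phi A D *m Phi X' Y') k l).
  apply: polyfB; first exact: (polyf_comp (hPhi k l) (polymx_rmulX X') (polymx_lmulY Y')).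
  exact: (polymxM hPhi (polymx_cst _) k l).
apply: (h _ hp) => g ug.
have hq : polyf (fun A D => Phi (g *m A) (D *m star g) k l - (Phi g (star g) *m Phi A D) k l).
  apply: polyfB; first exact: (polyf_comp (hPhi k l) (polymx_lmulX g) (polymx_rmulY (star g))).
  exact: (polymxM (polymx_cst _) hPhi k l).
apply: (h' _ hq) => g' ug'.
by rewrite -starM -!ePhi ?(repM hrho ug ug') ?subrr//; exact: unitaryM.
Qed.

Definition dgs (t : 'I_n -> C) : M := diag_mx (\row_i t i).

Lemma dgsE t a b : dgs t a b = t a *+ (a == b).
Proof. by rewrite !mxE. Qed.

Lemma star_dgs t : star (dgs t) = dgs (fun i => (t i)^*).
Proof.
apply/matrixP => a b; rewrite starE !dgsE rmorphMn /= eq_sym.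
by case: eqVneq => // ->.
Qed.

Lemma normC1 (z : C) : `|z| = 1 -> z * z^* = 1.
Proof. by move=> h; rewrite -normCK h expr1n. Qed.

Lemma norm1_neq0 (z : C) : `|z| = 1 -> z != 0.
Proof. by move=> h; rewrite -normr_eq0 h oner_eq0. Qed.

Lemma dgs_unitary t : (forall i, `|t i| = 1) -> unitary (dgs t).
Proof.
move=> ht; apply/unitaryE; rewrite star_dgs; apply/matrixP => a b.
rewrite mul_diag_mx !mxE; case: eqVneq => [->|_]; last by rewrite mulr0.
by rewrite mulr1n normC1.
Qed.

Lemma El_dgs i j x t : (forall i, t i != 0) ->
  El i j x *m dgs t = dgs t *m El i j (x * (t j / t i)).
Proof.
move=> t0; apply/matrixP => a b; rewrite El_mulr El_mull !dgsE; congr (_ + _).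
rewrite [b == j]eq_sym; case: (eqVneq a i) => [->|_]; last by rewrite /= !(mulr0n, mulr0, mul0r).
case: eqVneq => _; last by rewrite /= !(mulr0n, mulr0, mul0r).
by rewrite /= ?mulr1n !mulr1 -mulrA divfK.
Qed.

Lemma prod_shift (lam : 'I_n -> int) (t : 'I_n -> C) i j (m : nat) :
  (forall i, t i != 0) ->
  \prod_k t k ^ (lam k + m%:Z *+ (k == j) - m%:Z *+ (k == i)) =
  \prod_k t k ^ lam k * (t j / t i) ^+ m.
Proof.
move=> t0; have one l (s : bool) : \prod_k t k ^ (if s then m%:Z *+ (k == l) else - (m%:Z *+ (k == l))) =
    if s then t l ^+ m else t l ^- m.
  rewrite (bigD1 l)//= big1 ?mulr1 => [|k kl].
    by rewrite eqxx mulr1n; case: s => //; rewrite -exprnN.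
  by rewrite (negbTE kl) mulr0n oppr0; case: s; rewrite expr0z.
under eq_bigr do rewrite expfzDr ?t0// expfzDr ?t0//.
by rewrite !big_split /= (one j true) (one i false) -mulrA expr_div_n.
Qed.

Variables (lam : 'I_n -> int) (v : 'rV[C]_d).
Hypothesis hv : forall t : 'I_n -> C, (forall i, `|t i| = 1) ->
  v *m rho (dgs t) = (\prod_i (t i ^ lam i)) *: v.

(** Moving a torus element across E_ij(x) rescales x by t_j / t_i. The coefficient of x^m in v
    E_ij(x) therefore has weight lam + m (e_j - e_i) unless it is 0, so only the constant
    coefficient v remains. *)
Lemma weight_El i j x : i != j ->
  (forall m : nat, (0 < m)%N ->
     ~ is_weight rho (fun k => lam k + m%:Z *+ (k == j) - m%:Z *+ (k == i))) ->
  v *m Phi (El i j x) (El i j (- x)) = v.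
Proof.
move=> ij noweight.
have /choice[q hq] : forall l, exists q : {poly C}, forall x,
    (v *m Phi (El i j x) (El i j (- x))) 0 l = q.[x].
  move=> l; exact: (El_poly i j (polymxM (polymx_cst v) hPhi 0 l)).
have act t y l : (forall i, `|t i| = 1) ->
    \sum_k (q k).[y] * rho (dgs t) k l = \prod_k t k ^ lam k * (q l).[y * (t j / t i)].
  move=> ht; have t0 k : t k != 0 by exact: norm1_neq0.
  have ut := dgs_unitary ht; have zt := zcl_unitary ut.
  set y' := y * _.
  have e1 : El i j y *m dgs t = dgs t *m El i j y' by exact: El_dgs.
  have e2 : star (dgs t) *m El i j (- y) = El i j (- y') *m star (dgs t).
    rewrite star_dgs El_dgs => [|k]; last by rewrite conjC_eq0.
    congr (_ *m El _ _ _); rewrite /y' mulNr; congr (- _).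
    have a1 : t i * (t i)^* = 1 by exact: normC1.
    have b1 : t j * (t j)^* = 1 by exact: normC1.
    have -> : (t i)^* = (t i)^-1 by apply: (mulfI (t0 i)); rewrite a1 mulfV.
    have -> : (t j)^* = (t j)^-1 by apply: (mulfI (t0 j)); rewrite b1 mulfV.
    by rewrite divf_cancel.
  have E : v *m Phi (El i j y) (El i j (- y)) *m rho (dgs t) =
      (\prod_k t k ^ lam k) *: (v *m Phi (El i j y') (El i j (- y'))).
    rewrite (ePhi ut) -(mulmxA v) -(PhiM (zcl_El y ij) zt) e1 e2.
    by rewrite (PhiM zt (zcl_El y' ij)) -(ePhi ut) mulmxA (hv ht) -scalemxAl.
  have /rowP/(_ l) := E; rewrite !mxE -(hq l y') mxE => <-.
  by apply: eq_bigr => k _; rewrite -hq.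
have coefE t m l : (forall i, `|t i| = 1) ->
    \sum_k (q k)`_m * rho (dgs t) k l =
    \prod_k t k ^ lam k * (t j / t i) ^+ m * (q l)`_m.
  move=> ht; set c := t j / t i; set chi := \prod_k _.
  pose q' := \poly_(m < size (q l)) ((q l)`_m * c ^+ m).
  have : \sum_k (rho (dgs t) k l) *: q k - chi *: q' = 0.
    apply: (@poly_inj_root _ _ (fun k => k%:R)) => [a b /eqP|k].
      by rewrite eqr_nat => /eqP.
    rewrite hornerD hornerN hornerZ horner_poly horner_sum.
    apply/eqP; rewrite subr_eq0; apply/eqP.
    transitivity (\sum_k0 (q k0).[k%:R] * rho (dgs t) k0 l).
      by apply: eq_bigr => k0 _; rewrite hornerZ mulrC.
    rewrite (act _ _ _ ht); congr (_ * _); rewrite horner_coef.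
    by apply: eq_bigr => k0 _; rewrite exprMn mulrA mulrAC.
  move=> /polyP/(_ m); rewrite coef0 coefB coefZ coef_poly coef_sum => /eqP.
  rewrite subr_eq0 => /eqP e; transitivity (chi * ((q l)`_m * c ^+ m)); last by ring.
  transitivity (\sum_k ((rho (dgs t) k l) *: q k)`_m).
    by apply: eq_bigr => k _; rewrite coefZ mulrC.
  rewrite e; case: ifP => // /negbT; rewrite -leqNgt => /(nth_default 0) ->.
  by rewrite mul0r.
have q0 m l : (0 < m)%N -> (q l)`_m = 0.
  move=> m0; pose u : 'rV[C]_d := \row_l (q l)`_m.
  suff /rowP/(_ l) : u = 0 by rewrite !mxE.
  apply/eqP; apply: contra_notT (noweight m m0) => u0; exists u; split=> // t ht.
  rewrite prod_shift => [|k]; last exact: norm1_neq0.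
  apply/rowP => l'; rewrite !mxE -(coefE _ _ _ ht).
  by apply: eq_bigr => k _; rewrite !mxE.
apply/rowP => l; rewrite hq.
have -> : q l = ((q l)`_0)%:P.
  by apply/polyP => -[|m]; rewrite coefC//= q0.
rewrite hornerC -horner_coef0 -hq /El scale0r addr0 oppr0 scale0r addr0.
by rewrite Phi1 mulmx1.
Qed.

End Extension.

(** * Stabilizer of the highest weight vector *)

Section HighestWeight.
Context {R : realType} {n d : nat}.
Local Notation C := R[i].
Local Notation M := 'M[C]_n.
Variables (rho : M -> 'M[C]_d) (Phi : M -> M -> 'M[C]_d).
Hypotheses (hrho : is_rep rho) (hPhi : polymx Phi).
Hypothesis ePhi : forall g, unitary g -> rho g = Phi g (star g).
Variables (i0 il : 'I_n) (a : nat).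
Hypotheses (i0l : i0 != il) (vi0 : i0 = 0%N :> nat) (vil : il = n.-1 :> nat).
Local Notation lam := (wt_c0c n a%:Z).
Hypothesis dom : forall mu, is_weight rho mu -> dom_le mu lam.
Variable v : 'rV[C]_d.
Hypothesis hv : forall t : 'I_n -> C, (forall i, `|t i| = 1) ->
  v *m rho (dgs t) = (\prod_i (t i ^ lam i)) *: v.
Local Notation mid := (~: [set i0; il])%SET.

Lemma lam_i0 : lam i0 = a. Proof. by rewrite /wt_c0c vi0 eqxx. Qed.

Lemma lam_il : lam il = - a%:Z.
Proof.
rewrite /wt_c0c; case: eqP => h; last by rewrite vil eqxx.
by case/eqP: i0l; apply: val_inj; rewrite /= h vi0.
Qed.

Lemma lam_mid i : i \in mid -> lam i = 0.
Proof.
rewrite !inE negb_or => /andP[h0 hl]; rewrite /wt_c0c.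
have -> : (i == 0%N :> nat) = false by apply/negbTE; apply: contraNneq h0 => e; apply/eqP/val_inj; rewrite /= e vi0.
by have -> : (i == n.-1 :> nat) = false by apply/negbTE; apply: contraNneq hl => e; apply/eqP/val_inj; rewrite /= e vil.
Qed.

Lemma raise_not_weight (i j : 'I_n) (m : nat) : (j < i)%N -> (0 < m)%N ->
  ~ is_weight rho (fun k => lam k + m%:Z *+ (k == j) - m%:Z *+ (k == i)).
Proof.
(* The partial sum up to and including [j] gains m and does not reach [i], so dominance fails
   there. *)
move=> ji m0 /dom[/(_ j.+1)]; rewrite (bigD1 j)//= big1 => [|k /andP[kj kj']].
  have -> : (j == i) = false by apply/negbTE; rewrite neq_ltn ji.
  by rewrite eqxx mulr1n mulr0n; lia.
have -> : (k == i) = false.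
  by apply/negbTE; rewrite neq_ltn (leq_trans _ ji).
by rewrite (negbTE kj') !mulr0n; lia.
Qed.

Lemma weight_perm (mu : 'I_n -> int) s : is_weight rho mu -> is_weight rho (fun k => mu (tperm s.1 s.2 k)).
Proof.
case: s => i j /= [u [u0 hu]]; pose S : M := perm_mx (tperm i j).
have SS : S *m S = 1%:M by rewrite -perm_mxM tperm2 perm_mx1.
have sS : star S = S.
  apply/matrixP => k l; rewrite starE !mxE rmorph_nat; congr (_%:R); congr nat_of_bool.
  by apply/eqP/eqP => <-; rewrite tpermK.
have uS : unitary S by apply/unitaryE; rewrite sS.
exists (u *m rho S); split.
  apply: contraNneq u0 => e; rewrite -[u]mulmx1 -(rep1 hrho) -SS (repM hrho)//.
  by rewrite mulmxA e mul0mx.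
move=> t ht; have ht' k : `|t (tperm i j k)| = 1 by [].
have e : S *m dgs t = dgs (fun k => t (tperm i j k)) *m S.
  apply/matrixP => k l; rewrite mul_diag_mx mul_mx_diag !mxE mulrC.
  by case: eqVneq => [->|_]; rewrite ?mulr0.
have ut := dgs_unitary ht; have ut' := dgs_unitary ht'.
rewrite -mulmxA -(repM hrho uS ut) e (repM hrho ut' uS) mulmxA (hu _ ht') -scalemxAl.
apply: (congr1 (fun c => c *: (u *m rho S))); rewrite (reindex_inj (@perm_inj _ (tperm i j))) /=.
by apply: eq_bigr => k _; rewrite tpermK.
Qed.

Local Notation act X Y := (v *m Phi X Y).

Lemma El_fix_low (i j : 'I_n) x : (j < i)%N -> act (El i j x) (El i j (- x)) = v.
Proof.
move=> ji; have ij : i != j by rewrite neq_ltn ji orbT.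
apply: (weight_El hrho hPhi ePhi hv x ij) => m m0; exact: raise_not_weight.
Qed.

(** For i < j dominance does not exclude lam + m (e_j - e_i) directly. But weights are stable under
    transpositions, and exchanging i and j gives lam + m (e_i - e_j), because lam vanishes at both
    places. *)
Lemma El_fix_mid i j x : i \in mid -> j \in mid -> i != j ->
  act (El i j x) (El i j (- x)) = v.
Proof.
move=> im jm ij; have [ji|] := ltnP j i; first exact: El_fix_low.
rewrite leq_eqVlt => /orP[/eqP e|lij].
  by case/eqP: ij; exact: val_inj.
apply: (weight_El hrho hPhi ePhi hv x ij) => m m0 w.
apply: (raise_not_weight lij m0).
apply: (eq_ind _ (is_weight rho) (weight_perm (i, j) w)); apply/funext => k /=.
have [->|ki] := eqVneq k i.
  by rewrite tpermL eqxx !lam_mid// eq_sym (negbTE ij) mulr0n; lia.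
have [->|kj] := eqVneq k j.
  by rewrite tpermR eqxx !lam_mid// (negbTE ij) mulr0n; lia.
have ik : i != k by rewrite eq_sym.
have jk : j != k by rewrite eq_sym.
by rewrite (tpermD ik jk) (negbTE ki) (negbTE kj).
Qed.

(** The exponent is split as e1 - e2 so that the eigenvalue is a polynomial in the entries of the
    pair (dg i z, dg i z^-1); the identity then extends from |z| = 1. *)
Lemma dg_act i (e1 e2 : nat) z : lam i = e1%:Z - e2%:Z -> z != 0 ->
  act (dg i z) (dg i z^-1) = (z ^+ e1 * z^-1 ^+ e2) *: v.
Proof.
move=> hi z0; apply/rowP => l; rewrite [RHS]mxE; apply/eqP; rewrite -subr_eq0; apply/eqP.
have hp : polyf (fun X Y : M => act X Y 0 l - X i i ^+ e1 * Y i i ^+ e2 * v 0 l).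
  apply: polyfB; first exact: (polymxM (polymx_cst v) hPhi 0 l).
  apply: polyfM (polyf_cst _); apply: polyfM; apply: polyfX.
    exact: polymx_X.
  exact: polymx_Y.
have := @zcl_dg_poly _ _ _ i z hp; rewrite !dgE !eqxx !mulr1n; apply=> // t ht.
have t1 : `|t| = 1.
  by apply/eqP; rewrite -(@eqrXn2 _ 2)// normCK ht expr1n.
have t0 : t != 0 by exact: norm1_neq0.
rewrite !dgE !eqxx !mulr1n -(star_dg i ht) -(ePhi (dg_unitary i ht)).
have -> : dg i t = dgs (fun k => if k == i then t else 1).
  by [].
rewrite hv => [|k]; last by case: ifP; rewrite // normr1.
rewrite (bigD1 i)//= big1 ?mulr1 => [|k /negbTE ->]; last by rewrite exp1rz.
by rewrite eqxx mxE hi expfzDr// -exprnN exprVn subrr.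
Qed.

(** Elementary and diagonal matrices with indices in [mid] fix v, the latter because lam vanishes
    there, and [gauss] writes k in terms of them. The second coordinate obtained on the way is the
    inverse of k, that is its adjoint. *)
Lemma UBmid_fix k : UB mid k -> v *m rho k = v.
Proof.
move=> hk; have uk := UB_unitary hk.
have [Y [kY hY]] : exists Y, zcl k Y /\ act k Y = v.
  apply: (@gauss _ _ mid (fun X => exists Y, zcl X Y /\ act X Y = v) _ _ _ _ mid k) => //.
  - exists 1%:M; split; last by rewrite (Phi1 hrho ePhi) mulmx1.
    by have := zcl_unitary (@unitary1 R n); rewrite star1.
  - move=> X X' [Y [h e]] [Y' [h' e']]; exists (Y' *m Y); split; first exact: zclM.
    by rewrite (PhiM hrho hPhi ePhi h h') mulmxA e e'.
  - move=> i j x im jm ij; exists (El i j (- x)); split; first exact: zcl_El.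
    exact: El_fix_mid.
  - move=> i z im z0; exists (dg i z^-1); split; first exact: zcl_dg.
    by rewrite (dg_act (e1 := 0) (e2 := 0))// ?mulr1 ?scale1r// lam_mid.
  - by have /mulmx1_unit[] := (unitaryE k).1 uk.
  - by move: hk => [].
rewrite (ePhi uk) -[RHS]hY; congr (v *m Phi _ _).
have := zcl_inv kY; have := (unitary_star_mul uk) => e1 e2.
by rewrite -[star k]mulmx1 -e2 mulmxA e1 mul1mx.
Qed.

End HighestWeight.

Lemma sqr_sum_le (F : numDomainType) (d : nat) (x : 'I_d -> F) :
  (forall l, x l \is Num.real) -> (\sum_l x l) ^+ 2 <= d%:R * \sum_l x l ^+ 2.
Proof.
move=> xr; rewrite -(@ler_pMn2r _ 2)//.
have -> : (\sum_l x l) ^+ 2 *+ 2 = \sum_l \sum_m (x l * x m) *+ 2.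
  rewrite expr2 mulr_suml -sumrMnl; apply: eq_bigr => l _.
  by rewrite mulr_sumr -sumrMnl.
have -> : d%:R * (\sum_l x l ^+ 2) *+ 2 = \sum_l \sum_m (x l ^+ 2 + x m ^+ 2).
  rewrite [RHS](eq_bigr (fun l => x l ^+ 2 *+ d + \sum_m x m ^+ 2)) => [|l _].
    by rewrite big_split /= sumr_const card_ord sumrMnl mulr_natl mulr2n.
  by rewrite big_split /= sumr_const card_ord.
apply: ler_sum => l _; apply: ler_sum => m _.
rewrite -subr_ge0.
have -> : x l ^+ 2 + x m ^+ 2 - (x l * x m) *+ 2 = (x l - x m) ^+ 2 by rewrite mulr2n; ring.
by apply: real_exprn_even_ge0 => //; apply: rpredB.
Qed.

(** * The dual of the highest weight vector *)

Section Intertwiner.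
Context {R : realType} {n d : nat}.
Local Notation C := R[i].
Local Notation M := 'M[C]_n.
Local Notation T := (mxT R n).
Local Notation full := (finset.setT : {set 'I_n}).
Variables (muT : probability T R) (rho : M -> 'M[C]_d) (Phi : M -> M -> 'M[C]_d).
Hypotheses (hT : is_haar full muT) (hrho : is_rep rho) (hPhi : polymx Phi).
Hypothesis ePhi : forall g, unitary g -> rho g = Phi g (star g).

(** [rho] need not be unitary. This averaged Gram matrix intertwines rho(h) with the conjugate
    transpose of rho(h^-1), and so carries the row [v] to a column whose stabilizer consists of the
    adjoints of that of [v]. *)
Definition gram := mint muT (fun g => rho g *m star (rho g)).

Lemma gram_bmx : bmx full (fun g => rho g *m star (rho g)).
Proof.
apply: bmxM; first exact: (rep_bmx hrho hT).
move=> k l; under [fun A => _]eq_fun do rewrite starE.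
exact: (bmfJ (rep_bmx hrho hT full l k)).
Qed.

Lemma gram_conj h : unitary h -> rho h *m gram *m star (rho h) = gram.
Proof.
move=> uh; rewrite -(mintMl hT _ gram_bmx).
have b1 : bmx full (fun g => rho h *m (rho g *m star (rho g))).
  by apply: bmxM gram_bmx; exact: bmx_cst.
rewrite -(mintMr hT _ b1) -[RHS](mint_lmul hT (UB_setT uh) gram_bmx).
apply: (eq_mint hT) => g ug; rewrite (repM hrho uh (UB_unitary ug)) starM.
by rewrite !mulmxA.
Qed.

Lemma gram_inter h : unitary h -> rho h *m gram = gram *m star (rho (star h)).
Proof.
move=> uh; rewrite -{2}(gram_conj uh) -mulmxA -starM.
by rewrite (rep_star_mul hrho uh) star1 mulmx1.
Qed.

Lemma gram_Phi X Y : zcl X Y -> Phi X Y *m gram = gram *m star (Phi (star X) (star Y)).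
Proof.
move=> h; apply/matrixP => k l; apply/eqP; rewrite -subr_eq0; apply/eqP.
have hs : polymx (fun X Y => star (Phi (star X) (star Y))).
  move=> p q; apply: (eq_polyf _ (polyf_conj (hPhi q p))) => A D.
  by rewrite starE.
have hp : polyf (fun X Y => (Phi X Y *m gram) k l - (gram *m star (Phi (star X) (star Y))) k l).
  apply: polyfB; first exact: (polymxM hPhi (polymx_cst _) k l).
  exact: (polymxM (polymx_cst _) hs k l).
apply: (h _ hp) => g ug; rewrite -(ePhi ug) -(ePhi (unitary_star ug)).
by rewrite (gram_inter ug) subrr.
Qed.

Variable v : 'rV[C]_d.

Definition gram_col := gram *m star v.

Lemma gram_col_act X Y : zcl X Y ->
  Phi X Y *m gram_col = gram *m star (v *m Phi (star X) (star Y)).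
Proof. by move=> h; rewrite /gram_col mulmxA (gram_Phi h) starM mulmxA. Qed.

(** The value is the mean of |v rho(g)|^2. Since v = v rho(g) rho(g^-1) with entries of [rho]
    bounded by r, each |v_k|^2 is at most d r^2 |v rho(g)|^2, so the mean is bounded away from 0. *)
Lemma gram_neq0 : v != 0 -> (v *m gram_col) 0 0 != 0.
Proof.
move=> v0; have [k vk] : exists k, v 0 k != 0.
  apply: contrapT => h; case/eqP: v0; apply/rowP => k; rewrite mxE.
  by apply/eqP/negPn/negP => vk; apply: h; exists k.
have [r r0 hr] := rep_bounded hrho hT.
pose u g := v *m rho g; pose f (g : M) := \sum_l u g 0 l * (u g 0 l)^*.
have bu l : bmf full (fun g => u g 0 l).
  exact: (bmxM (bmx_cst full v) (rep_bmx hrho hT full) 0 l).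
have bf : bmf full f by apply: bmf_sum => l; apply: bmfM; [exact: bu|exact: bmfJ (bu l)].
have -> : (v *m gram_col) 0 0 = cint muT f.
  have b1 : bmx full (fun g => v *m (rho g *m star (rho g))).
    by apply: bmxM gram_bmx; exact: bmx_cst.
  rewrite /gram_col mulmxA -(mintMl hT _ gram_bmx) -(mintMr hT _ b1) mint_entry.
  apply: (eq_cint hT) => g _; rewrite mulmxA -mulmxA -starM mxE.
  by apply: eq_bigr => l _; rewrite starE.
pose c : C := (r%:C)%C ^+ 2 * d%:R.
have pos : 0 <= cint muT (fun g => c * f g + - (`|v 0 k| ^+ 2)).
  apply: (cint_ge0 hT) => g /UB_unitary ug; rewrite subr_ge0.
  have -> : v 0 k = \sum_l u g 0 l * rho (star g) l k.
    by rewrite -[v in LHS]mulmx1 -(rep_mul_star hrho ug) mulmxA mxE.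
  apply: (@le_trans _ _ ((\sum_l `|u g 0 l| * (r%:C)%C) ^+ 2)).
    rewrite lerXn2r ?nnegrE ?normr_ge0 ?sumr_ge0// => [l _|].
      by rewrite mulr_ge0// lecR.
    apply: (le_trans (ler_norm_sum _ _ _)); apply: ler_sum => l _.
    by rewrite normrM ler_wpM2l// hr//; exact: unitary_star.
  rewrite -mulr_suml exprMn mulrC /c -mulrA ler_wpM2l ?exprn_ge0 ?lecR//.
  apply: (le_trans (sqr_sum_le _)) => [l|]; first exact: normr_real.
  by rewrite /f; under eq_bigr do rewrite normCK.
apply/eqP => e; move: pos.
rewrite (cintD hT) ?(cintZ hT)//; last 2 first.
- by apply: bmfM; [exact: bmf_cst|exact: bf].
- exact: bmf_cst.
rewrite e mulr0 add0r (cint_cst hT) oppr_ge0 => h.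
have : 0 < `|v 0 k| ^+ 2 by rewrite exprn_gt0// normr_gt0.
by move=> /lt_le_trans/(_ h); rewrite ltxx.
Qed.

End Intertwiner.

(** * LDU factorization of a double coset representative between two elementary matrices *)

Definition mx3 {F : nzRingType} (a b c e f g h k l : F) : 'M[F]_3 :=
  \matrix_(i, j) nth 0 (nth [::] [:: [:: a; b; c]; [:: e; f; g]; [:: h; k; l]] i) j.

Lemma mx3P {F : nzRingType} (A D : 'M[F]_3) :
  A 0 0 = D 0 0 -> A 0 1 = D 0 1 -> A 0 2%:R = D 0 2%:R ->
  A 1 0 = D 1 0 -> A 1 1 = D 1 1 -> A 1 2%:R = D 1 2%:R ->
  A 2%:R 0 = D 2%:R 0 -> A 2%:R 1 = D 2%:R 1 -> A 2%:R 2%:R = D 2%:R 2%:R -> A = D.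
Proof.
move=> *; apply/matrixP => i j.
have o3 (k : 'I_3) : k = 0 \/ k = 1 \/ k = 2%:R.
  by case: k => -[|[|[|//]]] ?; [left|right; left|right; right]; exact: val_inj.
by case: (o3 i) => [->|[]->]; case: (o3 j) => [->|[]->].
Qed.

Lemma mul_mx3 {F : nzRingType} (a b c e f g h k l a' b' c' e' f' g' h' k' l' : F) :
  mx3 a b c e f g h k l *m mx3 a' b' c' e' f' g' h' k' l' =
  mx3 (a * a' + b * e' + c * h') (a * b' + b * f' + c * k') (a * c' + b * g' + c * l')
      (e * a' + f * e' + g * h') (e * b' + f * f' + g * k') (e * c' + f * g' + g * l')
      (h * a' + k * e' + l * h') (h * b' + k * f' + l * k') (h * c' + k * g' + l * l').
Proof. by apply: mx3P; rewrite !mxE !big_ord_recl big_ord0 !mxE /= addr0 !addrA. Qed.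

Lemma ltu3_aux {F : fieldType} (x z z' s : F) : s * s = 1 - z * z' ->
  1 + x ^+ 2 * z != 0 -> z' + x ^+ 2 != 0 ->
  let D := 1 + x ^+ 2 * z in let E := z' + x ^+ 2 in
  [/\ x * s / D * D * (x * s / D) + - E / D = - z',
      x * s / D * D * (x * z / D) + - E / D * (- s / E) = s &
      x * z / D * D * (x * z / D) + - s / E * (- E / D) * (- s / E) + E^-1 = z].
Proof.
move=> sE D0 E0 D E; split.
- transitivity ((x ^+ 2 * (s * s) - E) / D); first by rewrite /D /E; field.
  by rewrite sE /D /E; field.
- by rewrite /D /E; field; apply/andP; split.
transitivity (x ^+ 2 * z ^+ 2 / D - s * s / (D * E) + E^-1).
  by rewrite /D /E; field; apply/andP; split.
by rewrite sE /D /E; field; apply/andP; split.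
Qed.

(** The left side is [[1 + x^2 z, xs, xz], [xs, -z', s], [xz, s, z]], whose leading principal minors
    are D, -E and -1; the diagonal part and the multipliers a, b, c follow from them. *)
Lemma ltu3 {F : fieldType} (x z z' s D E a b c : F) :
  D = 1 + x ^+ 2 * z -> E = z' + x ^+ 2 -> D != 0 -> E != 0 ->
  a = x * s / D -> b = x * z / D -> c = - s / E -> s * s = 1 - z * z' ->
  mx3 1 0 x 0 1 0 0 0 1 *m (mx3 1 0 0 0 (- z') s 0 s z *m mx3 1 0 0 0 1 0 x 0 1) =
  (mx3 1 0 0 a 1 0 0 0 1 *m (mx3 1 0 0 0 1 0 b 0 1 *m mx3 1 0 0 0 1 0 0 c 1)) *m
  (mx3 D 0 0 0 1 0 0 0 1 *m (mx3 1 0 0 0 (- E / D) 0 0 0 1 *m mx3 1 0 0 0 1 0 0 0 (E^-1))) *m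
  (mx3 1 0 0 0 1 c 0 0 1 *m (mx3 1 0 b 0 1 0 0 0 1 *m mx3 1 a 0 0 1 0 0 0 1)).
Proof.
move=> hD hE D0 E0 ha hb hc sE.
have [h5 h6 h9] : [/\ a * D * a + - E / D = - z', a * D * b + - E / D * c = s &
    b * D * b + c * (- E / D) * c + E^-1 = z].
  by rewrite ha hb hc hD hE; apply: ltu3_aux; rewrite // -?hD -?hE.
have aD : a * D = x * s by rewrite ha divfK.
have bD : b * D = x * z by rewrite hb divfK.
rewrite !mul_mx3; congr mx3.
- by transitivity D; [rewrite hD; ring|ring].
- by transitivity (x * s); [ring|rewrite -[LHS]aD; ring].
- by transitivity (x * z); [ring|rewrite -[LHS]bD; ring].
- by transitivity (x * s); [ring|rewrite -[LHS]aD; ring].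
- by transitivity (- z'); [ring|rewrite -[LHS]h5; ring].
- by transitivity s; [ring|rewrite -[LHS]h6; ring].
- by transitivity (x * z); [ring|rewrite -[LHS]bD; ring].
- by transitivity s; [ring|rewrite -[LHS]h6; ring].
- by transitivity z; [ring|rewrite -[LHS]h9; ring].
Qed.

Section Ltu.
Context {R : realType} {n : nat}.
Local Notation C := R[i].

Lemma emb_El m (f : 'I_m -> 'I_n) i j (x : C) : injective f ->
  emb f (El i j x) = El (f i) (f j) x.
Proof.
move=> injf; rewrite /emb /El.
have -> : 1%:M + x *: delta_mx i j - 1%:M = x *: delta_mx i j :> 'M[C]_m by rewrite addrC addKr.
rewrite -scalemxAr -scalemxAl; congr (_ + _ *: _).
apply/matrixP => a b; rewrite mxE (bigD1 j)//= big1 => [|k kj].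
  rewrite !mxE (bigD1 i)//= big1 => [|k ki]; last by rewrite !mxE (negbTE ki) mulr0.
  by rewrite !mxE !eqxx mulr1 !addr0 -natrM mulnb [f i == a]eq_sym [f j == b]eq_sym.
rewrite mxE big1 ?mul0r// => l _.
by rewrite !mxE (negbTE kj) andbF mulr0.
Qed.

Lemma dg_El (i : 'I_n) (z : C) : dg i z = El i i (z - 1).
Proof.
apply/matrixP => a b; rewrite dgE !mxE.
have [->|ab] := eqVneq a b.
  by case: eqVneq => _ /=; rewrite mulr1n ?mulr1 ?mulr0 ?addr0// addrC subrK.
by case: eqVneq => [<-|_] /=; rewrite mulr0n add0r ?[b == a]eq_sym ?(negbTE ab) mulr0.
Qed.

Lemma emb_dg m (f : 'I_m -> 'I_n) i (z : C) : injective f -> emb f (dg i z) = dg (f i) z.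
Proof.
move=> injf; rewrite dg_El -(emb_El _ _ _ injf); congr emb.
apply/matrixP => a b; rewrite dgE !mxE.
have [->|ab] := eqVneq a b.
  by case: eqVneq => _ /=; rewrite mulr1n ?mulr1 ?mulr0 ?addr0// addrC subrK.
by case: eqVneq => [<-|_] /=; rewrite mulr0n add0r ?[b == a]eq_sym ?(negbTE ab) mulr0.
Qed.

Lemma emb_emb m p (f : 'I_m -> 'I_n) (g : 'I_p -> 'I_m) (A : 'M[C]_p) :
  emb f (emb g A) = emb (f \o g) A.
Proof.
have e : incl_mx (f \o g) = incl_mx g *m incl_mx f :> 'M[C]_(p, n).
  apply/matrixP => a b; rewrite !mxE (bigD1 (g a))//= big1 => [|k kg].
    by rewrite !mxE eqxx mul1r addr0.
  by rewrite !mxE eq_sym (negbTE kg) mul0r.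
rewrite /emb; set B := _ *m _ *m incl_mx g.
have -> : 1%:M + B - 1%:M = B by rewrite addrC addKr.
by rewrite /B e trmx_mul !mulmxA.
Qed.

(** The counterpart of [ltu_n3] for n = 2, where there is no third index. *)
Lemma ltu_n2 (i j : 'I_n) (x z D b : C) : i != j ->
  D = 1 + x ^+ 2 * z -> D != 0 -> b = x * z / D ->
  El i j x *m (dg j z *m El j i x) =
  El j i b *m (dg i D *m dg j (z / D)) *m El i j b.
Proof.
move=> ij hD D0 hb; have ji : j != i by rewrite eq_sym.
have bD : b * D = x * z by rewrite hb divfK.
have inj := pair_incl_inj ij.
have low (y : C) : El j i y = emb2 i j (mx2 1 0 y 1).
  by rewrite (El_emb2 _ ji) (emb2_swap _ ji) !mxE.
have h : b * D * b + z / D = z.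
  by rewrite bD hb hD; rewrite hD in D0; field.
have key : mx2 1 x 0 1 *m (mx2 1 0 0 z *m mx2 1 0 x 1) =
    mx2 1 0 b 1 *m (mx2 D 0 0 1 *m mx2 1 0 0 (z / D)) *m mx2 1 b 0 1.
  rewrite !mul_mx2; congr mx2.
  - by transitivity D; [rewrite hD; ring|ring].
  - by transitivity (x * z); [ring|rewrite -[LHS]bD; ring].
  - by transitivity (x * z); [ring|rewrite -[LHS]bD; ring].
  - by transitivity z; [ring|rewrite -[LHS]h; ring].
have e2 (A B : 'M[C]_2) : emb2 i j (A *m B) = emb2 i j A *m emb2 i j B.
  by rewrite /emb2 (embM inj A B).
have := congr1 (emb2 i j) key; rewrite !e2.
by rewrite -!low -!(El_emb2 _ ij) -!(dg_emb2l _ ij) -!(dg_emb2r _ ij).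
Qed.

Lemma ltu_n3 (i j l : 'I_n) (x z z' s D E a b c : C) : i != j -> i != l -> j != l ->
  D = 1 + x ^+ 2 * z -> E = z' + x ^+ 2 -> D != 0 -> E != 0 ->
  a = x * s / D -> b = x * z / D -> c = - s / E -> s * s = 1 - z * z' ->
  El i l x *m (emb2 l j (mx2 z s s (- z')) *m El l i x) =
  (El j i a *m (El l i b *m El l j c)) *m
  (dg i D *m (dg j (- E / D) *m dg l E^-1)) *m
  (El j l c *m (El i l b *m El i j a)).
Proof.
move=> ij il jl hD hE D0 E0 ha hb hc hs.
pose f (k : 'I_3) : 'I_n := nth i [:: i; j; l] k.
have injf : injective f.
  by move=> [[|[|[|//]]] ?] [[|[|[|//]]] ?] /eqP; rewrite /f /= ?(negbTE ij) ?(negbTE il)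
    ?(negbTE jl) 1?eq_sym ?(negbTE ij) ?(negbTE il) ?(negbTE jl)// => _; apply: val_inj.
have fEl p q (y : C) : El (f p) (f q) y = emb f (El p q y) by rewrite emb_El.
have fdg p (y : C) : dg (f p) y = emb f (dg p y) by rewrite emb_dg.
have fG : emb2 l j (mx2 z s s (- z')) =
    emb f (emb2 2%:R 1 (mx2 z s s (- z'))).
  by rewrite /emb2 emb_emb; congr emb; apply/funext => k; rewrite /pair_incl /=; case: ifP.
have e12 : (2%:R : 'I_3) != 1 by [].
have G3 : emb2 2%:R 1 (mx2 z s s (- z')) = mx3 1 0 0 0 (- z') s 0 s z :> 'M[C]_3.
  have inj3 := pair_incl_inj e12.
  have ee p q := embE inj3 p q (mx2 z s s (- z')).
  have eo p q := @emb_out _ _ _ (pair_incl (2%:R : 'I_3) 1) (mx2 z s s (- z')) p q.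
  apply: mx3P.
  - by rewrite [LHS]eo ?mxE//; left=> k; rewrite /pair_incl; case: ifP.
  - by rewrite [LHS]eo ?mxE//; left=> k; rewrite /pair_incl; case: ifP.
  - by rewrite [LHS]eo ?mxE//; left=> k; rewrite /pair_incl; case: ifP.
  - by rewrite [LHS]eo ?mxE//; right=> k; rewrite /pair_incl; case: ifP.
  - by apply: (etrans (ee 1 1)); rewrite !mxE.
  - by apply: (etrans (ee 1 0)); rewrite !mxE.
  - by rewrite [LHS]eo ?mxE//; right=> k; rewrite /pair_incl; case: ifP.
  - by apply: (etrans (ee 0 1)); rewrite !mxE.
  - by apply: (etrans (ee 0 0)); rewrite !mxE.
have El10 y : El 1 0 y = mx3 1 0 0 y 1 0 0 0 1 :> 'M[C]_3.
  by apply: mx3P; rewrite !mxE /= ?(mulr1, mulr0) ?(addr0, add0r).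
have El20 y : El 2%:R 0 y = mx3 1 0 0 0 1 0 y 0 1 :> 'M[C]_3.
  by apply: mx3P; rewrite !mxE /= ?(mulr1, mulr0) ?(addr0, add0r).
have El21 y : El 2%:R 1 y = mx3 1 0 0 0 1 0 0 y 1 :> 'M[C]_3.
  by apply: mx3P; rewrite !mxE /= ?(mulr1, mulr0) ?(addr0, add0r).
have El01 y : El 0 1 y = mx3 1 y 0 0 1 0 0 0 1 :> 'M[C]_3.
  by apply: mx3P; rewrite !mxE /= ?(mulr1, mulr0) ?(addr0, add0r).
have El02 y : El 0 2%:R y = mx3 1 0 y 0 1 0 0 0 1 :> 'M[C]_3.
  by apply: mx3P; rewrite !mxE /= ?(mulr1, mulr0) ?(addr0, add0r).
have El12 y : El 1 2%:R y = mx3 1 0 0 0 1 y 0 0 1 :> 'M[C]_3.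
  by apply: mx3P; rewrite !mxE /= ?(mulr1, mulr0) ?(addr0, add0r).
have dg0 y : dg 0 y = mx3 y 0 0 0 1 0 0 0 1 :> 'M[C]_3 by apply: mx3P; rewrite !mxE.
have dg1 y : dg 1 y = mx3 1 0 0 0 y 0 0 0 1 :> 'M[C]_3 by apply: mx3P; rewrite !mxE.
have dg2 y : dg 2%:R y = mx3 1 0 0 0 1 0 0 0 y :> 'M[C]_3 by apply: mx3P; rewrite !mxE.
have gen (e : 'M[C]_3 -> 'M[C]_n) (A1 A2 A3 L1 L2 L3 T1 T2 T3 U1 U2 U3 : 'M[C]_3)
    (a1 a2 a3 l1 l2 l3 t1 t2 t3 u1 u2 u3 : 'M[C]_n) :
    (forall A B, e A *m e B = e (A *m B)) ->
    e A1 = a1 -> e A2 = a2 -> e A3 = a3 -> e L1 = l1 -> e L2 = l2 -> e L3 = l3 ->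
    e T1 = t1 -> e T2 = t2 -> e T3 = t3 -> e U1 = u1 -> e U2 = u2 -> e U3 = u3 ->
    A1 *m (A2 *m A3) = (L1 *m (L2 *m L3)) *m (T1 *m (T2 *m T3)) *m (U1 *m (U2 *m U3)) ->
    a1 *m (a2 *m a3) = (l1 *m (l2 *m l3)) *m (t1 *m (t2 *m t3)) *m (u1 *m (u2 *m u3)).
  by move=> eM <- <- <- <- <- <- <- <- <- <- <- <- h; rewrite !eM h.
have h10 (y : C) : emb f (mx3 1 0 0 y 1 0 0 0 1) = El j i y by rewrite -El10 -(fEl 1 0).
have h20 (y : C) : emb f (mx3 1 0 0 0 1 0 y 0 1) = El l i y by rewrite -El20 -(fEl 2%:R 0).
have h21 (y : C) : emb f (mx3 1 0 0 0 1 0 0 y 1) = El l j y by rewrite -El21 -(fEl 2%:R 1).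
have h01 (y : C) : emb f (mx3 1 y 0 0 1 0 0 0 1) = El i j y by rewrite -El01 -(fEl 0 1).
have h02 (y : C) : emb f (mx3 1 0 y 0 1 0 0 0 1) = El i l y by rewrite -El02 -(fEl 0 2%:R).
have h12 (y : C) : emb f (mx3 1 0 0 0 1 y 0 0 1) = El j l y by rewrite -El12 -(fEl 1 2%:R).
have k0 (y : C) : emb f (mx3 y 0 0 0 1 0 0 0 1) = dg i y by rewrite -dg0 -(fdg 0).
have k1 (y : C) : emb f (mx3 1 0 0 0 y 0 0 0 1) = dg j y by rewrite -dg1 -(fdg 1).
have k2 (y : C) : emb f (mx3 1 0 0 0 1 0 0 0 y) = dg l y by rewrite -dg2 -(fdg 2%:R).
have hG := esym fG; rewrite G3 in hG.
exact: (gen _ _ _ _ _ _ _ _ _ _ _ _ _ _ _ _ _ _ _ _ _ _ _ _ _ (embM injf) (h02 x) hG (h20 x)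
  (h10 a) (h20 b) (h21 c) (k0 D) (k1 (- E / D)) (k2 E^-1) (h12 c) (h02 b) (h01 a)
  (ltu3 hD hE D0 E0 ha hb hc hs)).
Qed.

End Ltu.

Lemma ord_le_pred n (j : 'I_n) : (j <= n.-1)%N.
Proof. by case: n j => [[]//|n] j; rewrite -ltnS. Qed.

(** * Nonvanishing of the invariant projection *)

Section HighestWeightSpherical.
Context {R : realType} {n d : nat}.
Local Notation C := R[i].
Local Notation M := 'M[C]_n.
Local Notation T := (mxT R n).
Local Notation full := (finset.setT : {set 'I_n}).
Variable mu : {set 'I_n} -> probability T R.
Hypothesis hmu : forall B, is_haar B (mu B).
Variables (rho : M -> 'M[C]_d) (Phi : M -> M -> 'M[C]_d).
Hypotheses (hrho : is_rep rho) (hPhi : polymx Phi).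
Hypothesis ePhi : forall g, unitary g -> rho g = Phi g (star g).
Variables (i0 il : 'I_n) (a : nat).
Hypotheses (i0l : i0 != il) (vi0 : i0 = 0%N :> nat) (vil : il = n.-1 :> nat).
Local Notation lam := (wt_c0c n a%:Z).
Hypothesis dom : forall mu, is_weight rho mu -> dom_le mu lam.
Variable v : 'rV[C]_d.
Hypothesis v0 : v != 0.
Hypothesis hv : forall t : 'I_n -> C, (forall i, `|t i| = 1) ->
  v *m rho (dgs t) = (\prod_i (t i ^ lam i)) *: v.
Local Notation mid := (~: [set i0; il])%SET.
Local Notation K := (~: [set i0])%SET.
Let hT := hmu full.
Let y := gram_col (mu full) rho v.
Let vy := (v *m y) 0 0.

Let vy0 : vy != 0. Proof. exact: (gram_neq0 hT hrho). Qed.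

Lemma star_El (i j : 'I_n) (x : C) : star (El i j x) = El j i x^*.
Proof.
apply/matrixP => p q; rewrite starE !mxE rmorphD rmorphM !rmorph_nat.
by rewrite [q == p]eq_sym andbC.
Qed.

(** The adjoint of an upper elementary matrix is lower, and those fix v. *)
Let Phi_El_y (i j : 'I_n) (x : C) : (i < j)%N -> Phi (El i j x) (El i j (- x)) *m y = y.
Proof.
move=> ij; have nij : i != j by rewrite neq_ltn ij.
rewrite /y (gram_col_act hT hrho hPhi ePhi v (zcl_El x nij)) !star_El rmorphN.
by rewrite (El_fix_low hrho hPhi ePhi i0l vi0 vil dom hv).
Qed.

Let rho_y k : UB mid k -> rho k *m y = y.
Proof.
move=> hk; have uk := UB_unitary hk.
rewrite (ePhi uk) /y (gram_col_act hT hrho hPhi ePhi v (zcl_unitary uk)).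
rewrite -(ePhi (unitary_star uk)).
by rewrite (UBmid_fix hrho hPhi ePhi i0l vi0 vil dom hv (UB_star hk)).
Qed.

(** [FT] and [FY] record how a member of the closure acts on v from the right and on y from the
    left; the second coordinate is hidden, being determined as the inverse. *)
Let FT (A : M) (c : C) := exists B, zcl A B /\ v *m Phi A B = c *: v.
Let FY (A : M) := exists B, zcl A B /\ Phi A B *m y = y.

Let FTM A A' c c' : FT A c -> FT A' c' -> FT (A *m A') (c * c').
Proof.
move=> [B [h e]] [B' [h' e']]; exists (B' *m B); split; first exact: zclM.
by rewrite (PhiM hrho hPhi ePhi h h') mulmxA e -scalemxAl e' scalerA.
Qed.

Let FYM A A' : FY A -> FY A' -> FY (A *m A').
Proof.
move=> [B [h e]] [B' [h' e']]; exists (B' *m B); split; first exact: zclM.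
by rewrite (PhiM hrho hPhi ePhi h h') -mulmxA e' e.
Qed.

Let FTY A A' D c : FT A c -> FY A' -> zcl (A *m A') D ->
  (v *m Phi (A *m A') D *m y) 0 0 = c * vy.
Proof.
move=> [B [h e]] [B' [h' e']] hD.
have -> : D = B' *m B.
  have e1 := zcl_inv hD; have e2 := zcl_inv (zclM h h').
  by rewrite -[LHS]mul1mx -(mulmx1C e2) -mulmxA e1 mulmx1.
rewrite (PhiM hrho hPhi ePhi h h') mulmxA e -scalemxAl -scalemxAl.
by rewrite -mulmxA e' mxE.
Qed.

Let FT_low (i j : 'I_n) (x : C) : (j < i)%N -> FT (El i j x) 1.
Proof.
move=> ji; exists (El i j (- x)); split; first by apply: zcl_El; rewrite neq_ltn ji orbT.
by rewrite scale1r (El_fix_low hrho hPhi ePhi i0l vi0 vil dom hv).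
Qed.

Let FY_up (i j : 'I_n) (x : C) : (i < j)%N -> FY (El i j x).
Proof.
move=> ij; exists (El i j (- x)); split; last exact: Phi_El_y.
by apply: zcl_El; rewrite neq_ltn ij.
Qed.

Let FT_dg0 z : z != 0 -> FT (dg i0 z) (z ^+ a).
Proof.
move=> z0; exists (dg i0 z^-1); split; first exact: zcl_dg.
rewrite (dg_act hPhi ePhi hv (e1 := a) (e2 := 0))// ?expr0 ?mulr1//.
by rewrite (lam_i0 a vi0) subr0.
Qed.

Let FT_dgl z : z != 0 -> FT (dg il z) (z^-1 ^+ a).
Proof.
move=> z0; exists (dg il z^-1); split; first exact: zcl_dg.
rewrite (dg_act hPhi ePhi hv (e1 := 0) (e2 := a))// ?expr0 ?mul1r//.
by rewrite (lam_il a i0l vi0 vil) sub0r.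
Qed.

Let FT_dgm j z : j \in mid -> z != 0 -> FT (dg j z) 1.
Proof.
move=> jm z0; exists (dg j z^-1); split; first exact: zcl_dg.
rewrite (dg_act hPhi ePhi hv (e1 := 0) (e2 := 0))// ?expr0 ?mul1r//.
by rewrite (lam_mid a vi0 vil jm) subr0.
Qed.

(** The coefficient v N rho(k) N' y, with a variable x as the entry of N and N' because the LDU
    decomposition exists only for generic x. *)
Let Fx (x : C) (k : M) := (v *m Phi (El i0 il x) (El i0 il (- x)) *m rho k *m
  (Phi (El il i0 x) (El il i0 (- x)) *m y)) 0 0.

Let il0 : il != i0. Proof. by rewrite eq_sym. Qed.

Let lt0l : (i0 < il)%N.
Proof. by rewrite vi0 lt0n; apply: contraNneq i0l => e; apply/eqP/val_inj; rewrite /= e vi0. Qed.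

Let Fx_word x k A A' c : unitary k -> FT A c -> FY A' ->
  El i0 il x *m (k *m El il i0 x) = A *m A' -> Fx x k = c * vy.
Proof.
move=> uk hA hA' e.
have hk := zcl_unitary uk; have h1 := zcl_El x i0l; have h2 := zcl_El x il0.
have hz := zclM h1 (zclM hk h2).
have := @FTY A A' (El il i0 (- x) *m star k *m El i0 il (- x)) c hA hA'.
rewrite -e => /(_ hz) <-.
rewrite (PhiM hrho hPhi ePhi h1 (zclM hk h2)) (PhiM hrho hPhi ePhi hk h2).
by rewrite -(ePhi uk) /Fx !mulmxA.
Qed.

Let El_comm (i j : 'I_n) (x : C) (k : M) : i \notin mid -> j \notin mid -> UB mid k ->
  El i j x *m k = k *m El i j x.
Proof.
move=> im jm [_ hk]; apply/matrixP => p q; rewrite El_mulr El_mull; congr (_ + _).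
rewrite (hk j q) ?jm// (hk p i) ?im ?orbT// [j == q]eq_sym.
by rewrite -!mulrA [(p == i)%:R * _]mulrC.
Qed.

Let i0m : i0 \notin mid. Proof. by rewrite !inE eqxx. Qed.
Let ilm : il \notin mid. Proof. by rewrite !inE eqxx orbT. Qed.

Let Phi_El_comm (i j : 'I_n) (x : C) (k : M) : i \notin mid -> j \notin mid -> i != j -> UB mid k ->
  Phi (El i j x) (El i j (- x)) *m rho k = rho k *m Phi (El i j x) (El i j (- x)).
Proof.
move=> im jm ij hk; have uk := UB_unitary hk; have zk := zcl_unitary uk.
rewrite (ePhi uk) -(PhiM hrho hPhi ePhi (zcl_El x ij) zk).
rewrite -(PhiM hrho hPhi ePhi zk (zcl_El x ij)).
by rewrite (El_comm x im jm hk) (El_comm (- x) im jm (UB_star hk)).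
Qed.

(** N and N' commute with the unitary group of [mid], which fixes both v and y. *)
Let Fx_bi x k g k' : unitary g -> UB mid k -> UB mid k' -> Fx x (k *m g *m k') = Fx x g.
Proof.
move=> ug hk hk'; have uk := UB_unitary hk; have uk' := UB_unitary hk'.
rewrite /Fx (repM hrho (unitaryM uk ug) uk') (repM hrho uk ug).
congr (fun_of_matrix _ _ _).
have e1 : v *m Phi (El i0 il x) (El i0 il (- x)) *m rho k = v *m Phi (El i0 il x) (El i0 il (- x)).
  rewrite -mulmxA (Phi_El_comm x i0m ilm i0l hk) mulmxA.
  by rewrite (UBmid_fix hrho hPhi ePhi i0l vi0 vil dom hv hk).
have e2 : rho k' *m (Phi (El il i0 x) (El il i0 (- x)) *m y) = Phi (El il i0 x) (El il i0 (- x)) *m y.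
  by rewrite mulmxA -(Phi_El_comm x ilm i0m il0 hk') -mulmxA (rho_y hk').
by rewrite -{2}e1 -{2}e2 !mulmxA.
Qed.

(** Lower factors fix v, upper ones fix y, and the diagonal part diag(D, -E/D, 1/E) multiplies v by
    D^a E^a, since lam is a, 0, -a at these places. *)
Let Fx_val x k : UB K k -> 1 + x ^+ 2 * k il il != 0 -> (k il il)^* + x ^+ 2 != 0 ->
  Fx x k = ((1 + x ^+ 2 * k il il) * ((k il il)^* + x ^+ 2)) ^+ a * vy.
Proof.
move=> hk; set z := k il il; set D := 1 + _; set E := _ + _ => D0 E0.
have uk := UB_unitary hk.
have ilK : il \in K by rewrite !inE eq_sym.
(* Without a middle index, n = 2 and k is a single phase z. *)
have [m0|/set0Pn[j jm]] := eqVneq mid finset.set0.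
  have only i : i = i0 \/ i = il.
    have := finset.in_set0 i; rewrite -m0 !inE => /negbT; rewrite negbK.
    by case/orP => /eqP; [left|right].
  have ek : k = dg il z.
    have hk' := hk.2.
    apply/matrixP => p q; rewrite dgE.
    case: (only p) => ->; first by rewrite hk' ?inE ?eqxx// (negbTE i0l).
    case: (only q) => ->; first by rewrite hk' ?inE ?eqxx ?orbT// (negbTE il0).
    by rewrite !eqxx.
  have zz : z * z^* = 1.
    have /matrixP/(_ il il) := (unitaryE k).1 uk; rewrite {1}ek mul_dg starE eqxx mxE eqxx.
    by rewrite -/z.
  have z0 : z != 0 by apply/eqP => e; move: zz; rewrite e mul0r => /eqP; rewrite eq_sym oner_eq0.
  have DE : D = z * E by rewrite /D /E mulrDr zz mulrC [z * _]mulrC.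
  have hE : (z / D)^-1 = E.
    by rewrite invf_div DE mulrC mulKf.
  apply: (Fx_word uk _ _ (etrans _ (ltu_n2 (x := x) (z := z) (D := D) i0l erefl D0 erefl))).
  - have -> : (D * E) ^+ a = 1 * (D ^+ a * (z / D)^-1 ^+ a) by rewrite hE mul1r exprMn.
    apply: FTM; first exact: FT_low.
    by apply: FTM; [exact: FT_dg0|apply: FT_dgl; rewrite mulf_neq0// invr_eq0].
  - exact: FY_up.
  - by rewrite {1}ek.
have [j0 jl] : j != i0 /\ j != il.
  by move: jm; rewrite !inE negb_or => /andP[].
have lt0j : (i0 < j)%N.
  by rewrite vi0 lt0n; apply: contraNneq j0 => e; apply/eqP/val_inj; rewrite /= e vi0.
have ltjl : (j < il)%N.
  rewrite ltn_neqAle; apply/andP; split; last by rewrite vil ord_le_pred.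
  by apply: contraNneq jl => e; apply/eqP/val_inj; rewrite /= e.
have z1 : `|z| <= 1 by exact: unitary_entry_le.
pose s := sqrtC (1 - z * z^*).
have w0 : 0 <= 1 - z * z^* by rewrite -normCK subr_ge0 exprn_ile1.
have sr : s^* = s by apply: CrealP; apply: ger0_real; rewrite sqrtC_ge0.
have ss : s * s = 1 - z * z^* by rewrite -expr2 sqrtCK.
have inj : injective (pair_incl il j) by apply: pair_incl_inj; rewrite eq_sym.
have uG2 : unitary (mx2 z s s (- z^*)).
  by apply: mx2_refl_unitary => //; rewrite ss addrC subrK.
have hG : UB K (Gmx il j z s).
  apply: (emb_UB inj uG2) => p; rewrite /pair_incl.
  by case: ifP => _; rewrite !inE ?il0 ?j0.
have uG := UB_unitary hG.
have lj : il != j by rewrite eq_sym.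
have eG : k il il = Gmx il j z s il il by rewrite Gmx_corner.
(* Inside K the entry z determines the double coset of k; the representative involves only [il] and
   [j], so that 3 by 3 matrices are enough. *)
have [k1 [k2 [h1 h2 ->]]] := double_coset ilK hk hG eG.
have eK : (K :\ il)%SET = mid.
  by apply/finset.setP => p; rewrite !inE negb_or andbC.
rewrite eK in h1 h2; rewrite (Fx_bi x uG h1 h2).
have i0j : i0 != j by rewrite eq_sym.
have L3 := ltu_n3 i0j i0l jl (erefl D) (erefl E) D0 E0 (erefl _) (erefl _) (erefl _) ss.
apply: (Fx_word uG _ _ L3).
- have -> : (D * E) ^+ a = 1 * (1 * 1) * (D ^+ a * (1 * E^-1^-1 ^+ a)).
    by rewrite invrK !mul1r exprMn.
  apply: FTM.
    by apply: FTM; [exact: FT_low|apply: FTM; exact: FT_low].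
  apply: FTM; first exact: FT_dg0.
  apply: FTM; last by apply: FT_dgl; rewrite invr_eq0.
  by apply: FT_dgm => //; rewrite mulf_neq0 ?oppr_eq0 ?invr_eq0.
- by apply: FYM; [exact: FY_up|apply: FYM; exact: FY_up].
Qed.

Let Fx_poly k : exists q : {poly C}, forall x, Fx x k = q.[x].
Proof.
have /choice[p hp] : forall l, exists p : {poly C}, forall x,
    (v *m Phi (El i0 il x) (El i0 il (- x))) 0 l = p.[x].
  by move=> l; exact: (El_poly i0 il (polymxM (polymx_cst v) hPhi 0 l)).
have /choice[q hq] : forall l, exists p : {poly C}, forall x,
    (Phi (El il i0 x) (El il i0 (- x)) *m y) l 0 = p.[x].
  by move=> l; exact: (El_poly il i0 (polymxM hPhi (polymx_cst y) l 0)).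
exists (\sum_l (\sum_m (rho k m l) *: p m) * q l) => x.
rewrite /Fx mxE horner_sum; apply: eq_bigr => l _.
rewrite hornerM hq horner_sum; congr (_ * _); rewrite mxE.
by apply: eq_bigr => m _; rewrite hornerZ hp mulrC.
Qed.

(** At x = 1 the entry -1 is excluded by [Fx_val]. Both sides are values of polynomials in x that
    agree for generic x, hence they agree at x = 1. *)
Let Fx1 k : UB K k -> Fx 1 k = ((1 + k il il) * ((k il il)^* + 1)) ^+ a * vy.
Proof.
move=> hk; have [q hq] := Fx_poly k; set z := k il il.
pose pD : {poly C} := 1 + z *: 'X^2; pose pE : {poly C} := (z^*)%:P + 'X^2.
(* The factor [pD * pE] makes the product vanish at the excluded values of x too; it is cancelled
   afterwards because neither polynomial is zero. *)
pose p := (q - vy *: (pD * pE) ^+ a) * (pD * pE).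
have hD x : pD.[x] = 1 + x ^+ 2 * z by rewrite /pD hornerD hornerZ hornerXn hornerC mulrC.
have hE x : pE.[x] = z^* + x ^+ 2 by rewrite /pE hornerD hornerXn hornerC.
have : p = 0.
  apply: (@poly_inj_root _ _ (fun k => k%:R)) => [b c /eqP|j].
    by rewrite eqr_nat => /eqP.
  set x : C := j%:R; rewrite /p hornerM hornerD hornerN hornerZ horner_exp hornerM hD hE.
  have [->|D0] := eqVneq (1 + x ^+ 2 * z) 0; first by rewrite mul0r mulr0.
  have [->|E0] := eqVneq (z^* + x ^+ 2) 0; first by rewrite !mulr0.
  by rewrite -hq (Fx_val hk D0 E0) mulrC [vy * _]mulrC subrr mulr0.
move=> /eqP; rewrite mulf_eq0 mulf_eq0 => /orP[|/orP[]] /eqP h.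
- rewrite hq; have := congr1 (horner^~ 1) h.
  rewrite hornerD hornerN hornerZ horner_exp hornerM hD hE expr1n mul1r horner0 => /eqP.
  by rewrite subr_eq0 => /eqP ->; rewrite mulrC.
- have := congr1 (horner^~ 0) h; rewrite hD expr0n mul0r addr0 horner0 => /eqP.
  by rewrite oner_eq0.
- have := congr1 (horner^~ 0) h; rewrite hE expr0n addr0 horner0 => z0.
  have := congr1 (horner^~ 1) h; rewrite hE z0 add0r expr1n horner0 => /eqP.
  by rewrite oner_eq0.
Qed.

(** The mean of (1 + t k_nn)^a is a polynomial in t that is constant on the unit circle, by
    invariance under the phases of K; so it is constant, with value 1 at t = 0. *)
Let mean1 : cint (mu K) (fun k : M => (1 + k il il) ^+ a) = 1.
Proof.
pose g (t : C) := cint (mu K) (fun k : M => (1 + t * k il il) ^+ a).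
have bk j : bmf K (fun k : M => k il il ^+ j) by apply: bmfX; exact: bmf_entry.
have [q hq] : exists q : {poly C}, forall t, g t = q.[t].
  exists (\poly_(j < a.+1) (cint (mu K) (fun k : M => k il il ^+ j) * 'C(a, j)%:R)) => t.
  rewrite horner_poly /g.
  rewrite (eq_cint (hmu K) (h := fun k : M => \sum_(j < a.+1) ('C(a, j)%:R * t ^+ j) * k il il ^+ j)).
    rewrite (cint_sum (hmu K)) => [|j]; last by apply: bmfM; [exact: bmf_cst|exact: bk].
    by apply: eq_bigr => j _; rewrite (cintZ (hmu K))//; ring.
  move=> k _; rewrite exprDn; apply: eq_bigr => j _.
  by rewrite expr1n mul1r exprMn -mulr_natl mulrA.
have [f injf hf] := @infinite_units R.
have ilK : il \in K by rewrite !inE eq_sym.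
have gu t : t * t^* = 1 -> g t = g 1.
  move=> ht; have hdg : UB K (dg il t).
    split; first exact: dg_unitary.
    move=> p r hpr; rewrite dgE; have [epr|] := eqVneq p r; last by rewrite mulr0n.
    rewrite mulr1n; case: eqVneq => // ep.
    by move: hpr; rewrite -epr ep ilK.
  have b1 : bmf K (fun k : M => (1 + 1 * k il il) ^+ a).
    by apply: bmfX; apply: bmfD (bmf_cst _ _) _; apply: bmfM (bmf_cst _ _) (bmf_entry _ _ _).
  rewrite /g -(cint_lmul (hmu K) hdg b1); apply: (eq_cint (hmu K)) => k _.
  by rewrite mul_dg eqxx mul1r.
have q0 : q - (q.[1])%:P = 0.
  apply: (poly_inj_root injf) => k; rewrite hornerD hornerN hornerC -!hq.
  by rewrite gu ?subrr.
have e1 : g 1 = cint (mu K) (fun k : M => (1 + k il il) ^+ a).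
  by apply: (eq_cint (hmu K)) => k _; rewrite mul1r.
rewrite -e1 hq; have := congr1 (horner^~ 0) q0.
rewrite hornerD hornerN hornerC horner0 -hq => /eqP; rewrite subr_eq0 => /eqP <-.
rewrite -[RHS](cint_cst (hmu K)); apply: (eq_cint (hmu K)) => k _.
by rewrite mul0r addr0 expr1n.
Qed.

(* If the mean vanished, so would the mean of |w|^2 for w = (1 + k_nn)^a; but w has
   mean 1. *)
Lemma hw_avg_neq0 : haar_avg (mu K) rho != 0.
Proof.
apply/eqP => P0; pose w (k : M) := (1 + k il il) ^+ a.
have bw : bmf K w by apply: bmfX; apply: bmfD (bmf_cst _ _) (bmf_entry _ _ _).
have bw' := bmfJ bw.
have e0 : cint (mu K) (fun k => w k * (w k)^*) = 0.
  have : ((v *m Phi (El i0 il 1) (El i0 il (- 1))) *m haar_avg (mu K) rho *m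
     (Phi (El il i0 1) (El il i0 (- 1)) *m y)) 0 0 = 0.
    by rewrite P0 mulmx0 mul0mx mxE.
  rewrite (avg_sandwich hrho hT (hmu K)) mint_entry.
  rewrite (eq_cint (hmu K) (h := fun k => (w k * (w k)^*) * vy)).
    rewrite (cintZr (hmu K)); last exact: bmfM.
    by move=> /eqP; rewrite mulf_eq0 (negbTE vy0) orbF => /eqP.
  move=> k hk; rewrite -[LHS]/(Fx 1 k) (Fx1 hk) exprMn /w rmorphXn rmorphD rmorph1.
  by rewrite [_^* + 1]addrC.
(* Expanded, this mean is 0 - 1 - 1 + 1, which is negative. *)
have : 0 <= cint (mu K) (fun k => (w k - 1) * (w k - 1)^*).
  by apply: (cint_ge0 (hmu K)) => k _; rewrite -normCK exprn_ge0.
rewrite (eq_cint (hmu K) (h := fun k => w k * (w k)^* + (-1 * w k + (-1 * (w k)^* + 1)))); last first.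
  by move=> k _; rewrite rmorphB rmorph1; ring.
have b1 c f : bmf K f -> bmf K (fun k : M => c * f k) by apply: bmfM (bmf_cst _ _).
have b2 : bmf K (fun k => -1 * (w k)^* + 1) by apply: bmfD (bmf_cst _ _); exact: b1.
have b3 : bmf K (fun k => -1 * w k + (-1 * (w k)^* + 1)) by apply: bmfD b2; exact: b1.
rewrite (cintD (hmu K)) ?(cintD (hmu K)) ?(cintZ (hmu K)) ?(cintJ (hmu K))//; do ?[exact: bmfM|exact: b1|exact: bmf_cst].
rewrite e0 mean1 rmorph1 (cint_cst (hmu K)).
by rewrite !mulr1 add0r addrA addrNK oppr_ge0 ler10.
Qed.

End HighestWeightSpherical.

Lemma coef_top_mul (F : nzRingType) (p q : {poly F}) a b :
  (size p <= a.+1)%N -> (size q <= b.+1)%N -> (p * q)`_(a + b) = p`_a * q`_b.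
Proof.
move=> sp sq; have ha : (a < (a + b).+1)%N by rewrite ltnS leq_addr.
rewrite coefM (bigD1 (Ordinal ha))//= addKn big1 ?addr0// => i ia.
have [ai|] := ltnP a i; first by rewrite nth_default ?mul0r// (leq_trans sp).
rewrite leq_eqVlt => /orP[/eqP e|lia]; first by case/eqP: ia; exact: val_inj.
by rewrite [q`__]nth_default ?mulr0// (leq_trans sq)// ltn_subRL ltn_add2r.
Qed.

(** * Degree of the spherical function *)

Section Degree.
Context {R : realType} {n d : nat}.
Local Notation C := R[i].
Local Notation M := 'M[C]_n.

Lemma poly_eq_units (p q : {poly C}) :
  (forall t, t * t^* = 1 -> p.[t] = q.[t]) -> p = q.
Proof.
move=> h; have [f injf hf] := @infinite_units R.
apply/eqP; rewrite -subr_eq0; apply/eqP; apply: (poly_inj_root injf) => k.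
by rewrite hornerD hornerN h ?subrr.
Qed.

Lemma dg_mid_entry i (h g : M) t :
  (h *m dg i t *m g) i i = h i i * g i i * t + ((h *m g) i i - h i i * g i i).
Proof.
have -> : (h *m g) i i - h i i * g i i = \sum_(k < n | k != i) h i k * g k i.
  by rewrite mxE [X in X - _](bigD1 i)//= [LHS]addrC addKr.
rewrite mxE (bigD1 i)//= dg_mul eqxx mulrAC; congr (_ + _).
by apply: eq_bigr => k ki; rewrite dg_mul (negbTE ki) mulr1.
Qed.

Lemma normsq_twist (t u w : C) : t * t^* = 1 ->
  t * ((u * t + w) * (u * t + w)^*) = (u * t + w) * (u^* + w^* * t).
Proof.
move=> ht; rewrite rmorphD rmorphM /=.
transitivity ((u * t + w) * (u^* * (t * t^*) + w^* * t)); first by ring.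
by rewrite ht mulr1.
Qed.

(* On the circle t |-> h diag(t, 1, .., 1) g a function of |corner|^2 given by a
   polynomial of degree m is a Laurent polynomial with exponents in [-m, m]. *)
Lemma poly_twist (A : {poly C}) (u w : C) : exists q : {poly C},
  [/\ (size q <= ((size A).-1).*2.+1)%N,
      q`_((size A).-1).*2 = A`_(size A).-1 * (u * w^*) ^+ (size A).-1 &
      forall t, t * t^* = 1 ->
        t ^+ (size A).-1 * A.[(u * t + w) * (u * t + w)^*] = q.[t]].
Proof.
set m := (size A).-1.
(* On the unit circle [B] is t times |u t + w|^2; its coefficient of degree 2 is u w^*. *)
pose B : {poly C} := (u *: 'X + w%:P) * ((u^*)%:P + w^* *: 'X).
have s1 (a b : C) : (size (a *: 'X + b%:P)%R <= 2)%N.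
  rewrite (leq_trans (size_polyD _ _))// geq_max (leq_trans (size_scale_leq _ _)) ?size_polyX//.
  by rewrite (leq_trans (size_polyC_leq1 _)).
have s1' : (size ((u^*)%:P + w^* *: 'X)%R <= 2)%N by rewrite addrC s1.
have sB : (size B <= 3)%N.
  rewrite (leq_trans (size_polyMleq _ _))//.
  by have := leq_add (s1 u w) s1'; case: (_ + _)%N => // k; rewrite ltnS.
have B2 : B`_2 = u * w^*.
  rewrite (@coef_top_mul _ _ _ 1 1)// !coefD !coefZ !coefX !coefC /=.
  by rewrite !mulr1 addr0 add0r.
have sBj j : (size (B ^+ j) <= j.*2.+1)%N.
  rewrite (leq_trans (size_poly_exp_leq _ _))// ltnS -mul2n leq_mul2r.
  by case: (size B) sB => [|[|[|[|]]]]//=; rewrite orbT.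
have Bj j : (B ^+ j)`_(j.*2) = (u * w^*) ^+ j.
  elim: j => [|j IH]; first by rewrite !expr0 coefC.
  by rewrite exprS doubleS -add2n (@coef_top_mul _ _ _ 2 j.*2)// IH B2 exprS.
have hB t : B.[t] = (u * t + w) * (u^* + w^* * t).
  by rewrite /B hornerM !hornerD !hornerZ !hornerC hornerX.
have sq j : (j <= m)%N -> (size (B ^+ j * 'X^(m - j))%R <= (m + j).+1)%N.
  move=> jm; rewrite (leq_trans (size_polyMleq _ _))// size_polyXn addnS /=.
  by rewrite (leq_trans (leq_add (sBj j) (leqnn _)))// addSn ltnS -addnn -addnA subnKC// addnC.
exists (\sum_(j < m.+1) A`_j *: (B ^+ j * 'X^(m - j))); split.
- apply: (leq_trans (size_sum _ _ _)); apply/bigmax_leqP => j _.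
  have jm : (j <= m)%N by rewrite -ltnS.
  rewrite (leq_trans (size_scale_leq _ _))// (leq_trans (sq _ jm))// ltnS -addnn.
  by rewrite leq_add2l.
- rewrite coef_sum big_ord_recr /= big1 ?add0r => [|j _].
    by rewrite coefZ subnn expr0 mulr1 Bj.
  have jm : (j < m)%N by [].
  rewrite coefZ [X in _ * X]nth_default ?mulr0//; apply: (leq_trans (sq _ (ltnW jm))).
  by rewrite -addnn ltn_add2l.
- move=> t ht; rewrite horner_sum.
  have -> : A.[(u * t + w) * (u * t + w)^*] =
      \sum_(j < m.+1) A`_j * ((u * t + w) * (u * t + w)^*) ^+ j.
    apply: horner_coef_wide; rewrite /m; by case: (size A).
  rewrite mulr_sumr; apply: eq_bigr => j _.
  have jm : (j <= m)%N by rewrite -ltnS.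
  rewrite hornerZ hornerM horner_exp hornerXn hB -(normsq_twist _ _ ht) [(t * _) ^+ j]exprMn.
  have em : t ^+ m = t ^+ j * t ^+ (m - j) by rewrite -exprD subnKC.
  have shuffle (p r c z : C) : p * r * (c * z) = c * (p * z * r) by ring.
  by rewrite em shuffle.
Qed.

End Degree.

Lemma mulmx_reassoc (F : nzRingType) d (u : 'rV[F]_d) (A B D G : 'M[F]_d) (x : 'cV[F]_d) :
  u *m A *m (B *m D *m G *m x) = u *m (A *m B *m D *m G *m x).
Proof. by rewrite !mulmxA. Qed.

Section HighestWeightDegree.
Context {R : realType} {n d : nat}.
Local Notation C := R[i].
Local Notation M := 'M[C]_n.
Local Notation T := (mxT R n).
Local Notation full := (finset.setT : {set 'I_n}).

Lemma normC1_inv (z : C) : z * z^* = 1 -> `|z| = 1.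
Proof. by move=> h; apply/eqP; rewrite -(@eqrXn2 _ 2)// normCK h expr1n. Qed.

(** [X] acts on the family [q] by rescaling its variable, so that the coefficients of t^m, taken
    together, form an eigenvector of [X]. *)
Lemma eigen_coef (q : 'I_d -> {poly C}) (X : 'M[C]_d) (c k : C) :
  (forall t l, t * t^* = 1 -> \sum_j (q j).[t] * X j l = k * (q l).[t * c]) ->
  forall m l, \sum_j (q j)`_m * X j l = k * c ^+ m * (q l)`_m.
Proof.
move=> h m l; pose q' := \poly_(m < size (q l)) ((q l)`_m * c ^+ m).
have e : \sum_j X j l *: q j = k *: q'.
  apply: poly_eq_units => t ht; rewrite horner_sum hornerZ horner_poly.
  transitivity (\sum_j (q j).[t] * X j l).
    by apply: eq_bigr => j _; rewrite hornerZ mulrC.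
  rewrite h// horner_coef; congr (_ * _).
  by apply: eq_bigr => j _; rewrite exprMn mulrA mulrAC.
transitivity ((\sum_j X j l *: q j)`_m).
  by rewrite coef_sum; apply: eq_bigr => j _; rewrite coefZ mulrC.
rewrite e coefZ coef_poly -mulrA; congr (_ * _).
case: ifP => [_|/negbT]; first by rewrite mulrC.
by rewrite -leqNgt => /(nth_default 0) ->; rewrite mulr0.
Qed.

Variable mu : {set 'I_n} -> probability T R.
Hypothesis hmu : forall B, is_haar B (mu B).
Variables (rho : M -> 'M[C]_d) (Phi : M -> M -> 'M[C]_d).
Hypotheses (hrho : is_rep rho) (irr : irreducible rho) (hPhi : polymx Phi).
Hypothesis ePhi : forall g, unitary g -> rho g = Phi g (star g).
Variables (i0 il : 'I_n) (a : nat).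
Hypotheses (i0l : i0 != il) (vi0 : i0 = 0%N :> nat) (vil : il = n.-1 :> nat).
Local Notation lam := (wt_c0c n a%:Z).
Hypothesis dom : forall mu, is_weight rho mu -> dom_le mu lam.
Variable v : 'rV[C]_d.
Hypothesis v0 : v != 0.
Hypothesis hv : forall t : 'I_n -> C, (forall i, `|t i| = 1) ->
  v *m rho (dgs t) = (\prod_i (t i ^ lam i)) *: v.
Local Notation mid := (~: [set i0; il])%SET.
Local Notation K := (~: [set i0])%SET.
Variables (x0 : 'cV[C]_d) (y0 : 'rV[C]_d).
Hypotheses (hP : haar_avg (mu K) rho = x0 *m y0) (hyx : y0 *m x0 = 1%:M).
Local Notation sph := (sph rho x0 y0).
Let hT := hmu full.

Lemma prod_wt (m : nat) (t : 'I_n -> C) : (forall i, t i != 0) ->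
  \prod_i t i ^ wt_c0c n m%:Z i = (t i0 / t il) ^+ m.
Proof.
move=> t0; rewrite (bigD1 i0)//= (bigD1 il) 1?eq_sym//= big1 ?mulr1 => [|i /andP[h1 h2]].
  by rewrite (lam_i0 m vi0) (lam_il m i0l vi0 vil) -exprnN expr_div_n.
by rewrite (lam_mid m vi0 vil) ?expr0z// !inE negb_or h1.
Qed.

Lemma unit_scalar_unitary (t : C) : t * t^* = 1 -> unitary (t%:M : M).
Proof.
move=> ht; apply/unitaryE/matrixP => i j; rewrite mul_scalar_mx mxE starE !mxE.
rewrite rmorphMn /= eq_sym mulrnAr ht; by [].
Qed.

Let scalar_fix t (u : 'rV[C]_d) : t * t^* = 1 -> u *m rho t%:M = u.
Proof.
move=> ht; have ut := unit_scalar_unitary ht.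
move: u; apply: (irr_ind irr (P := fun u => u *m rho t%:M = u)).
- by rewrite mul0mx.
- by move=> u w hu hw; rewrite mulmxDl hu hw.
- by move=> c u hu; rewrite -scalemxAl hu.
- move=> g u ug hu; rewrite -mulmxA -(repM hrho ug ut) scalar_mxC.
  by rewrite (repM hrho ut ug) mulmxA hu.
exists v => //; have -> : t%:M = dgs (fun=> t) :> M by apply/matrixP => i j; rewrite !mxE.
have t1 := normC1_inv ht; have t0 := norm1_neq0 t1.
by rewrite hv// prod_wt// divff// expr1n scale1r.
Qed.

(** Scalars act trivially because the highest weight has sum 0, and diag(t, 1, .., 1) is a scalar
    times an element of K. At this point c is not known to be nonzero, so [sph_value_phase] does not
    apply. *)
Lemma hw_phase t : t * t^* = 1 -> sph (dg i0 t) = 1.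
Proof.
move=> ht; have ht' : t^* * t^*^* = 1 by rewrite conjCK mulrC.
pose k : M := dg i0 t *m (t^*)%:M.
have uk : unitary k.
  by apply: unitaryM; [exact: dg_unitary|exact: unit_scalar_unitary].
have hk : UB K k.
  split=> // i j hij; rewrite mul_dg !mxE.
  have [eij|ij] := eqVneq i j; last by rewrite mulr0n mulr0.
  have -> : i = i0 by move: hij; rewrite -eij orbb !inE negbK => /eqP.
  by rewrite eqxx mulr1n.
have -> : dg i0 t = k *m t%:M.
  by rewrite /k -mulmxA -scalar_mxM mulrC ht mulmx1.
have ut := unit_scalar_unitary ht.
rewrite -[LHS]/((y0 *m rho (k *m t%:M) *m x0) 0 0) (repM hrho uk ut) mulmxA.
by rewrite (y0_fix hmu hrho hP hyx hk) scalar_fix// hyx mxE eqxx.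
Qed.

Variable A : {poly C}.
Hypothesis hA : forall g, unitary g -> sph g = A.[g i0 i0 * (g i0 i0)^*].
Let m := (size A).-1.

Let A0 : A != 0.
Proof.
apply/eqP => e; have := sph_poly1 hrho hyx hA; rewrite e horner0 => /eqP.
by rewrite eq_sym oner_eq0.
Qed.

Let sph_twist h g : unitary h -> unitary g -> exists q : {poly C},
  [/\ (size q <= m.*2.+1)%N,
      q`_m.*2 = A`_m * (h i0 i0 * g i0 i0 * ((h *m g) i0 i0 - h i0 i0 * g i0 i0)^*) ^+ m &
      forall t, t * t^* = 1 -> t ^+ m * sph (h *m dg i0 t *m g) = q.[t]].
Proof.
move=> uh ug.
have [q [q1 q2 q3]] := poly_twist A (h i0 i0 * g i0 i0) ((h *m g) i0 i0 - h i0 i0 * g i0 i0).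
exists q; split=> // t ht; rewrite -q3// hA ?dg_mid_entry//.
by apply: unitaryM => //; apply: unitaryM => //; exact: dg_unitary.
Qed.

Let sph_word h k g : unitary h -> unitary k -> unitary g ->
  sph (h *m k *m g) = (y0 *m (rho h *m rho k *m rho g *m x0)) 0 0.
Proof.
move=> uh uk ug; rewrite -[LHS]/((y0 *m rho (h *m k *m g) *m x0) 0 0).
by rewrite (repM hrho (unitaryM uh uk) ug) (repM hrho uh uk) -(mulmxA y0).
Qed.

Let y0_neq0 : y0 != 0.
Proof.
apply/eqP => e; move: hyx; rewrite e mul0mx => /matrixP/(_ 0 0).
by rewrite !mxE eqxx => /eqP; rewrite eq_sym oner_eq0.
Qed.

(** For u = y0 the function u rho(h) rho(dg i0 t) rho(g) x0 has exponents in [-m, m] by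
    [poly_twist], and this passes to all u by irreducibility. The choice u = v gives a nonzero
    multiple of t^a. *)
Lemma hw_deg_ge : (a <= m)%N.
Proof.
have [g ug hg] : exists2 g, unitary g & v *m rho g *m x0 != 0.
  apply: contrapT => h; have [|/eqP|x00] := @irr_mx0 _ _ _ _ hrho irr _ _ v x0.
  - by move=> g ug; apply/eqP/negPn/negP => hg; apply: h; exists g.
  - by rewrite (negbTE v0).
  by move: hyx; rewrite x00 mulmx0 => /matrixP/(_ 0 0); rewrite !mxE eqxx => /eqP; rewrite eq_sym oner_eq0.
have key : forall u : 'rV[C]_d, forall h, unitary h -> exists q : {poly C},
    (size q <= m.*2.+1)%N /\
    forall t, t * t^* = 1 -> t ^+ m * (u *m (rho h *m rho (dg i0 t) *m rho g *m x0)) 0 0 = q.[t].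
  apply: (irr_ind irr (P := fun u => forall h, unitary h -> exists q : {poly C},
    (size q <= m.*2.+1)%N /\
    forall t, t * t^* = 1 -> t ^+ m * (u *m (rho h *m rho (dg i0 t) *m rho g *m x0)) 0 0 = q.[t])).
  - move=> h _; exists 0; rewrite size_poly0; split=> // t _.
    by rewrite mul0mx mxE mulr0 horner0.
  - move=> u w hu hw h uh; have [q1 [s1 e1]] := hu h uh; have [q2 [s2 e2]] := hw h uh.
    exists (q1 + q2); split; first by rewrite (leq_trans (size_polyD _ _))// geq_max s1.
    by move=> t ht; rewrite mulmxDl mxE mulrDr e1// e2// hornerD.
  - move=> c u hu h uh; have [q [s e]] := hu h uh; exists (c *: q); split.
      by rewrite (leq_trans (size_scale_leq _ _)).
    by move=> t ht; rewrite -scalemxAl mxE mulrCA e// hornerZ.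
  - move=> h u uh hu h' uh'; have [q [sq e]] := hu _ (unitaryM uh uh').
    exists q; split; [exact: sq|move=> t ht]; rewrite -(e t ht) (repM hrho uh uh').
    by rewrite (mulmx_reassoc u (rho h) (rho h') (rho (dg i0 t)) (rho g) x0).
  exists y0; first exact: y0_neq0.
  move=> h uh; have [q [s _ e]] := sph_twist uh ug; exists q; split; [exact: s|move=> t ht].
  by rewrite -(e t ht) (sph_word uh (dg_unitary i0 ht) ug).
have [q [sq eq]] := key v 1%:M unitary1.
pose c := (v *m rho g *m x0) 0 0.
have c0 : c != 0.
  by apply: contraNneq hg => e; rewrite [_ *m x0]mx11_scalar -/c e; apply/eqP/matrixP => i j; rewrite !mxE mul0rn.
have : 'X^(m + a) * c%:P = q.
  apply: poly_eq_units => t ht; rewrite -eq// (rep1 hrho) mul1mx -(mulmxA _ (rho g)) mulmxA.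
  have -> : dg i0 t = dgs (fun k => if k == i0 then t else 1) by [].
  have t1 := normC1_inv ht; have t0 := norm1_neq0 t1.
  rewrite hv => [|k]; last by case: ifP; rewrite // normr1.
  rewrite prod_wt => [|k]; last by case: ifP; rewrite // oner_eq0.
  rewrite eqxx eq_sym (negbTE i0l) divr1 -scalemxAl mulmxA mxE hornerM hornerXn hornerC.
  by rewrite exprD mulrA.
move=> e; move: sq; rewrite -e mulrC mul_polyC size_scale// size_polyXn -addnn !ltnS.
by rewrite leq_add2l.
Qed.

(** In the expansion of y0 rho(h) rho(dg i0 t) in powers of t, the coefficient of t^m is nonzero and
    has weight (m, 0, .., 0, -m), which the highest weight dominates. *)
Lemma hw_deg_le : (m <= a)%N.
Proof.
(* With s^2 = 1/2 the square of [h] has corner 1, so u and w in [poly_twist] are both 1/2 and the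
   top coefficient is not 0. *)
pose s : C := sqrtC 2^-1.
have ss : s * s = 2^-1 by rewrite -expr2 sqrtCK.
have sr : s^* = s.
  by apply: CrealP; apply: ger0_real; rewrite sqrtC_ge0 invr_ge0 ler0n.
have h2 : 2^-1 + 2^-1 = 1 :> C by field.
pose h := Gmx i0 il s s.
have uh : unitary h by apply: (Gmx_unitary i0l sr); rewrite sr ss h2.
have uw : UB K (1%:M : M) by exact: UB1.
have hh : (h *m h) i0 i0 = 1.
  by rewrite -[h in _ *m h]mul1mx mulmxA (Gmx_mid i0l s s s s uw) mxE eqxx mulr1 ss h2.
have h00 : h i0 i0 = s by rewrite /h Gmx_corner.
have [q [sq q2 eq]] := sph_twist uh uh.
have q20 : q`_m.*2 != 0.
  rewrite q2 h00 hh ss mulf_neq0// ?expf_neq0//; first by rewrite lead_coef_eq0.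
  rewrite -{2}h2 addrK mulf_neq0 ?conjC_eq0// invr_eq0 pnatr_eq0//.
have /choice[N' hN'] : forall l, exists N, exists q : {poly C}, forall z, z != 0 ->
    z ^+ N * (y0 *m rho h *m Phi (dg i0 z) (dg i0 z^-1)) 0 l = q.[z].
  by move=> l; exact: (laurent_dg i0 (polymxM (polymx_cst (y0 *m rho h)) hPhi 0 l)).
have /choice[p' hp'] := hN'.
(* [N] clears the denominators of all coordinates at once; the index N + m below therefore stands
   for t^m. *)
pose N := (\max_l N' l)%N; pose p l := 'X^(N - N' l) * p' l.
have hp l t : t * t^* = 1 -> (p l).[t] = t ^+ N * (y0 *m rho h *m rho (dg i0 t)) 0 l.
  move=> ht; have t0 := norm1_neq0 (normC1_inv ht).
  rewrite hornerM hornerXn -hp'// mulrA -exprD subnK ?(leq_bigmax l)//.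
  by rewrite -(star_dg i0 ht) -(ePhi (dg_unitary i0 ht)).
pose c l := (rho h *m x0) l 0.
have pairing : 'X^m * (\sum_l c l *: p l) = 'X^N * q.
  apply: poly_eq_units => t ht; have ut := dg_unitary i0 ht.
  rewrite !hornerM !hornerXn -eq// horner_sum mulrCA; congr (_ * _).
  rewrite (sph_word uh ut uh) -(mulmxA (rho h *m rho (dg i0 t))) (mulmxA y0) (mulmxA y0 (rho h)) mxE mulr_sumr.
  by apply: eq_bigr => l _; rewrite hornerZ hp// mulrCA [c l * _]mulrC.
pose w : 'rV[C]_d := \row_l (p l)`_(N + m).
have w0 : w != 0.
  apply: contraNneq q20 => w0; have /polyP/(_ (N + m.*2)%N) := pairing.
  rewrite !coefXnM ltnNge -addnn addnA leq_addl addnK /= ltnNge -addnA leq_addr /= addKn => <-.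
  rewrite coef_sum big1// => l _; rewrite coefZ.
  by have /rowP/(_ l) := w0; rewrite !mxE => ->; rewrite mulr0.
suff /dom[/(_ 1%N)] : is_weight rho (wt_c0c n m%:Z).
  rewrite (bigD1 i0) ?vi0//= big1 => [|k /andP[k1 k0]].
    by rewrite (lam_i0 a vi0) (lam_i0 m vi0) addr0 subr_ge0.
  by case/eqP: k0; apply: val_inj; rewrite /= vi0; case: (k : nat) k1.
exists w; split=> // t ht; have t0 k : t k != 0 by exact: norm1_neq0.
rewrite prod_wt//; pose tl := t il; pose e := t i0 / t il.
(* A torus element is the product of diag(e, 1, .., 1), the scalar [tl] and a part [f] supported on
   the middle indices; [f] commutes with [h] and lies in K, so y0 absorbs it. *)
pose f k := if k \in mid then t k / tl else 1.
have nf k : `|f k| = 1 by rewrite /f; case: ifP => _; rewrite ?normr1// normf_div /tl !ht divr1.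
have ne : `|e| = 1 by rewrite /e normf_div !ht divr1.
have htl : tl * tl^* = 1 by exact: normC1 (ht il).
have hK : UB K (dgs f).
  split=> [|i j hij]; first exact: dgs_unitary.
  rewrite dgsE; have [eij|] := eqVneq i j; last by rewrite mulr0n.
  have -> : i = i0 by move: hij; rewrite -eij orbb !inE negbK => /eqP.
  by rewrite mulr1n /f !inE eqxx.
have fpair k : f (pair_incl i0 il k) = 1.
  by rewrite /f /pair_incl; case: (k == 0); rewrite !inE eqxx ?orbT.
have com : dgs f *m h = h *m dgs f.
  apply: emb_comm; apply/matrixP => i j; rewrite ?mul_mx_diag ?mul_diag_mx !mxE.
    by case: eqVneq => [<-|_]; rewrite ?mul0r// fpair mulr1.
  by case: eqVneq => [<-|_]; rewrite ?mulr0// fpair mulr1.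
have split_t s' : h *m dg i0 s' *m dgs t = dgs f *m (h *m dg i0 (s' * e)) *m tl%:M.
  have -> : dgs f *m (h *m dg i0 (s' * e)) *m tl%:M =
      h *m (dgs f *m dg i0 (s' * e) *m tl%:M).
    by rewrite mulmxA com !mulmxA.
  rewrite -mulmxA; congr (_ *m _); apply/matrixP => i j.
  rewrite mul_dg [RHS]mxE (bigD1 j)//= big1 => [|k kj].
    rewrite dg_mul !dgsE !mxE eqxx mulr1n addr0.
    case: (eqVneq i j) => [<-|_]; last by rewrite !mulr0n !mulr0 !mul0r.
    rewrite !mulr1n /f !inE negb_or; case: eqVneq => [->|_] /=.
      by rewrite mul1r /e /tl -!mulrA mulVf// mulr1.
    case: eqVneq => [->|_] /=; first by rewrite !mul1r.
    by rewrite mul1r mulr1 (divfK (t0 il)).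
  by rewrite [tl%:M _ _]mxE (negbTE kj) mulr0n mulr0.
have act s' l : s' * s'^* = 1 ->
    \sum_k (p k).[s'] * rho (dgs t) k l = e ^- N * (p l).[s' * e].
  move=> hs'; have us := dg_unitary i0 hs'; have ut := dgs_unitary ht.
  have hse : (s' * e) * (s' * e)^* = 1 by rewrite rmorphM mulrACA hs' (normC1 ne) mulr1.
  have use := dg_unitary i0 hse; have uhe := unitaryM uh use.
  have uf := UB_unitary hK; have utl := unit_scalar_unitary htl.
  rewrite hp// [(s' * e) ^+ N]exprMn.
  have <- : y0 *m rho h *m rho (dg i0 s') *m rho (dgs t) = y0 *m rho h *m rho (dg i0 (s' * e)).
    rewrite -!(mulmxA y0) -(repM hrho uh us) -(repM hrho uh use).
    rewrite -(repM hrho (unitaryM uh us) ut) split_t.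
    rewrite (repM hrho (unitaryM uf uhe) utl) mulmxA scalar_fix// (repM hrho uf uhe).
    by rewrite mulmxA (y0_fix hmu hrho hP hyx hK).
  have e0 : e ^+ N != 0 by rewrite expf_neq0// norm1_neq0.
  have cancel (b x z : C) : x != 0 -> x^-1 * (b * x * z) = b * z.
    by move=> x0'; rewrite [b * x]mulrC -mulrA mulKf.
  rewrite (cancel _ _ _ e0) mxE mulr_sumr; apply: eq_bigr => k _.
  by rewrite hp// mulrA.
apply/rowP => l; rewrite !mxE.
transitivity (\sum_k (p k)`_(N + m) * rho (dgs t) k l).
  by apply: eq_bigr => k _; rewrite mxE.
rewrite (eigen_coef (fun s' l' => act s' l')) exprD [e ^- N * _]mulrA mulVf ?mul1r//.
by rewrite expf_neq0// norm1_neq0.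
Qed.

Lemma hw_sph_value_aux : sph_value i0 il rho x0 y0 = (-1) ^+ a * moment mu i0 il a.
Proof.
have -> : a = m by apply/eqP; rewrite eqn_leq hw_deg_ge hw_deg_le.
exact: (sph_value_lead hmu i0l hrho hP hA A0).
Qed.

End HighestWeightDegree.

(** * The Laplacian *)

Section Rayleigh.
Context {R : realType} {n : nat}.
Local Notation C := R[i].
Local Notation Re := (@complex.Re R).

(** In an orthonormal eigenbasis both forms are weighted sums of squares; l is the largest
    eigenvalue. *)
Lemma rayleigh (H : 'M[C]_n) : (0 < n)%N -> star H = H -> exists2 l : R,
  eigenvalue H (l%:C)%C &
  forall b : 'rV[C]_n, (b *m H *m star b) 0 0 <= (l%:C)%C * (b *m star b) 0 0.
Proof.
move=> n0 hH; have herm : H \is sesquilinear.hermitianmx n false (@Num.conj C).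
  apply/sesquilinear.is_hermitianmxP; rewrite expr0 scale1r -{1}hH.
  by rewrite /star map_trmx.
pose P : 'M[C]_n := spectral.spectralmx H; pose D : 'rV[C]_n := spectral.spectral_diag H.
have PP : P *m star P = 1%:M.
  have /spectral.unitarymxP := spectral.spectral_unitarymx H.
  by rewrite -map_trmx.
have eH : H = star P *m diag_mx D *m P.
  have /spectral.orthomx_spectralP := spectral.hermitian_normalmx herm.
  by rewrite (spectral.invmx_unitary (spectral.spectral_unitarymx H)) -map_trmx.
have Dreal i : ((Re (D 0 i))%:C)%C = D 0 i.
  have /mxOverP/(_ 0 i)/CrealP h := spectral.hermitian_spectral_diag_real herm.
  by move: h; case: (D 0 i) => x y /= [] /eqP; rewrite -subr_eq0 -opprD oppr_eq0 -mulr2n mulrn_eq0 /= => /eqP ->.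
have [k hk] : exists k, forall i, Re (D 0 i) <= Re (D 0 k).
  by case: (@Order.TotalTheory.arg_maxP _ _ _ (Ordinal n0) xpredT (fun i => Re (D 0 i)) isT) => k _ hk; exists k => i; exact: hk.
exists (Re (D 0 k)).
  apply/eigenvalueP; exists (row k P); last first.
    apply/eqP => P0; have /matrixP/(_ k k) := PP; rewrite [LHS]mxE mxE eqxx big1 => [/eqP|j _].
      by rewrite eq_sym oner_eq0.
    by have /rowP/(_ j) := P0; rewrite !mxE => ->; rewrite mul0r.
  rewrite Dreal -row_mul eH !mulmxA PP mul1mx.
  by apply/rowP => j; rewrite [LHS]mxE mul_diag_mx !mxE.
move=> b; pose u := b *m star P.
have su : star u = P *m star b by rewrite /u starM starK.
have PP' : star P *m P = 1%:M by exact: mulmx1C.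
have -> : (b *m H *m star b) 0 0 = \sum_i (u 0 i * (u 0 i)^*) * D 0 i.
  rewrite eH !mulmxA -/u -(mulmxA _ P) -su mxE; apply: eq_bigr => i _.
  by rewrite mul_mx_diag mxE starE mulrAC.
have -> : (b *m star b) 0 0 = \sum_i (u 0 i * (u 0 i)^*).
  rewrite -[b in b *m _]mulmx1 -PP' mulmxA -/u -mulmxA -su mxE.
  by apply: eq_bigr => i _; rewrite starE.
rewrite mulr_sumr; apply: ler_sum => i _; rewrite mulrC ler_wpM2r//.
  by rewrite -normCK exprn_ge0.
by rewrite -Dreal lecR.
Qed.

End Rayleigh.

(** * Eigenvalues of a weighted sum of rank-one projections *)

Section Frame.
Context {R : realType} {n : nat}.
Local Notation C := R[i].
Variable w : 'I_n -> C.
Hypothesis w0 : forall i, 0 <= w i.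

(** If X has the columns sqrt(w_i) x_i and Y the rows sqrt(w_i) y_i, the weighted sum of the x_i y_i
    is X Y and this matrix is Y X; hence the equality of nonzero spectra. *)
Definition gramS (c : C) : 'M[C]_n :=
  \matrix_(i, j) (sqrtC (w i) * (if i == j then 1 else c) * sqrtC (w j)).

Let s i := sqrtC (w i).
Let sr i : (s i)^* = s i.
Proof. by apply: CrealP; apply: ger0_real; rewrite sqrtC_ge0. Qed.
Let ss i : s i * s i = w i.
Proof. by rewrite -expr2 sqrtCK. Qed.

Lemma gramS_star c : c^* = c -> star (gramS c) = gramS c.
Proof.
move=> hc; apply/matrixP => i j; rewrite starE !mxE !rmorphM -/(s i) -/(s j) /= !sr [j == i]eq_sym.
have -> : (if i == j then 1 else c)^* = (if i == j then 1 else c).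
  by case: ifP; rewrite ?rmorph1.
by move: (s i) (s j) (if _ then _ else _) => p r z; ring.
Qed.

(** Convexity in c enters in this form: for fixed b the quadratic form is affine in c. *)
Lemma gramS_affine c (b : 'rV[C]_n) : (b *m gramS c *m star b) 0 0 =
  (b *m gramS 0 *m star b) 0 0 + c * (b *m (gramS 1 - gramS 0) *m star b) 0 0.
Proof.
have -> : gramS c = gramS 0 + c *: (gramS 1 - gramS 0).
  apply/matrixP => i j; rewrite !mxE; case: ifP => _; ring.
by rewrite mulmxDr mulmxDl -scalemxAr -scalemxAl mxE [X in _ + X]mxE.
Qed.

Lemma gramS_delta c i : ((delta_mx 0 i : 'rV[C]_n) *m gramS c *m star (delta_mx 0 i : 'rV[C]_n)) 0 0 = w i.
Proof.
rewrite -rowE mxE (bigD1 i)//= big1 => [|j ji].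
  by rewrite starE !mxE !eqxx rmorph1 mulr1 addr0 mulr1 -/(s i) ss.
by rewrite starE [X in X^*]mxE (negbTE ji) andbF rmorph0 mulr0.
Qed.

Variables (d : nat) (x : 'I_n -> 'cV[C]_d) (y : 'I_n -> 'rV[C]_d) (c : C).
Hypothesis hxy : forall i j, y i *m x j = (if i == j then 1 else c)%:M.
Let Q := \sum_i w i *: (x i *m y i).

Let yx i j : (y i *m x j) 0 0 = if i == j then 1 else c.
Proof. by rewrite hxy mxE eqxx mulr1n. Qed.

Let mulQ (v : 'rV[C]_d) : v *m Q = \sum_i (w i * (v *m x i) 0 0) *: y i.
Proof.
rewrite mulmx_sumr; apply: eq_bigr => i _.
by rewrite -scalemxAr mulmxA {1}[v *m x i]mx11_scalar mul_scalar_mx scalerA.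
Qed.

Lemma frame_eigen_gram (v : 'rV[C]_d) m : v != 0 -> m != 0 -> v *m Q = m *: v ->
  exists2 b : 'rV[C]_n, b != 0 & b *m gramS c = m *: b.
Proof.
move=> v0 m0; rewrite mulQ => e; pose a i := (v *m x i) 0 0.
have ea j : \sum_i w i * a i * (if i == j then 1 else c) = m * a j.
  transitivity ((m *: v *m x j) 0 0); last by rewrite -scalemxAl mxE.
  rewrite -e mulmx_suml summxE; apply: eq_bigr => i _.
  by rewrite -scalemxAl [RHS]mxE yx.
(* This is the row v X, with X as explained at [gramS]. *)
exists (\row_j (s j * a j)).
  apply: contra_neq v0 => b0.
  suff : m *: v = 0 by move=> /eqP; rewrite scaler_eq0 (negbTE m0) => /eqP.
  rewrite -e big1// => i _; have /rowP/(_ i) := b0; rewrite mxE [RHS]mxE => h.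
  by rewrite -ss -mulrA -/(a i) h mulr0 scale0r.
apply/rowP => j; rewrite [LHS]mxE [RHS]mxE [X in m * X]mxE mulrCA -ea mulr_sumr.
apply: eq_bigr => i _; rewrite [X in X * _ = _]mxE [X in _ * X]mxE -/(s i) -/(s j) -ss; move: (s i) (s j) (a i) => p r z.
by case: ifP => _; ring.
Qed.

Lemma frame_gram_eigen (b : 'rV[C]_n) m : b != 0 -> m != 0 -> b *m gramS c = m *: b ->
  eigenvalue Q m.
Proof.
move=> b0 m0 e; pose v : 'rV[C]_d := \sum_i (b 0 i * s i) *: y i.
have vx j : s j * (v *m x j) 0 0 = m * b 0 j.
  have /rowP/(_ j) := e; rewrite mxE [RHS]mxE => <-; rewrite /v mulmx_suml summxE mulr_sumr.
  apply: eq_bigr => i _; rewrite -scalemxAl [X in s j * X]mxE yx [X in _ = _ * X]mxE -/(s i) -/(s j).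
  by move: (s i) (s j) (b 0 i) (if _ then _ else _) => p r z t; ring.
apply/eigenvalueP; exists v.
  rewrite mulQ /v scaler_sumr; apply: eq_bigr => i _; rewrite scalerA; congr (_ *: _).
  by rewrite -ss -mulrA vx; ring.
apply: contra_neq b0 => v0; apply/rowP => j; rewrite mxE; apply: (mulfI m0).
by rewrite -vx v0 mul0mx mxE !mulr0.
Qed.

End Frame.

Section Spectrum.
Context {R : realType} {n d : nat}.
Local Notation C := R[i].

Lemma eigenvalue_shift (W m : C) (Q : 'M[C]_d) :
  eigenvalue Q m -> eigenvalue (W%:M - Q) (W - m).
Proof.
move=> /eigenvalueP[v hv v0]; apply/eigenvalueP; exists v => //.
by rewrite mulmxBr mul_mx_scalar hv scalerBl.
Qed.

Lemma herm_form_real (H : 'M[C]_n) (b : 'rV[C]_n) : star H = H ->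
  (b *m H *m star b) 0 0 \is Num.real.
Proof.
move=> hH; apply/CrealP; rewrite -starE !starM starK hH mulmxA; by [].
Qed.

Variable w : 'I_n -> C.
Hypothesis w0 : forall i, 0 <= w i.
Variables (x : 'I_n -> 'cV[C]_d) (y : 'I_n -> 'rV[C]_d) (c : C).
Hypothesis hxy : forall i j, y i *m x j = (if i == j then 1 else c)%:M.
Local Notation Q := (\sum_i w i *: (x i *m y i)).
Local Notation form H b := ((b *m H *m star b) 0 0).
Local Notation normsq b := ((b *m star b) 0 0).

Lemma frame_lower (c1 c2 l : C) : c1 <= c <= c2 -> 0 <= l ->
  (forall b : 'rV[C]_n, form (gramS w c1) b <= l * normsq b) ->
  (forall b : 'rV[C]_n, form (gramS w c2) b <= l * normsq b) ->
  forall W z, eigenvalue (W%:M - Q) z -> W - l <= z.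
Proof.
move=> /andP[c1c cc2] l0 h1 h2 W z /eigenvalueP[v hv v0].
have hQ : v *m Q = (W - z) *: v.
  by move: hv; rewrite mulmxBr mul_mx_scalar scalerBl => <-; rewrite opprB addrC subrK.
have [m0|m0] := eqVneq (W - z) 0.
  by move/eqP: m0; rewrite subr_eq0 => /eqP ->; rewrite gerBl.
have [b b0 hb] := frame_eigen_gram hxy v0 m0 hQ.
have N0 : 0 < normsq b.
  rewrite lt0r; apply/andP; split.
    apply: contra_neq b0 => e; apply: mul_star_eq0.
    by rewrite [_ *m _]mx11_scalar e; apply/matrixP => i j; rewrite !mxE mul0rn.
  by rewrite mxE sumr_ge0// => i _; rewrite starE -normCK exprn_ge0.
suff : (W - z) * normsq b <= l * normsq b by rewrite ler_pM2r// lerBlDr lerBlDl.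
have -> : (W - z) * normsq b = form (gramS w c) b.
  by rewrite hb -scalemxAl [RHS]mxE.
have qr : form (gramS w 1 - gramS w 0) b \is Num.real.
  apply: herm_form_real; rewrite starD starN !(gramS_star w0) ?rmorph0 ?rmorph1//.
have f1 := h1 b; have f2 := h2 b.
rewrite (gramS_affine w c1 b) in f1; rewrite (gramS_affine w c2 b) in f2.
rewrite (gramS_affine w c b).
(* The sign of the slope in c selects the end point that bounds the form. *)
have [q0|q0] := real_ge0P qr.
  by apply: le_trans f2; rewrite lerD2l ler_wpM2r.
by apply: le_trans f1; rewrite lerD2l ler_wnM2r// ltW.
Qed.

(** A nonzero top eigenvalue l transfers to [Q]. If l = 0, the diagonal of [gramS] forces all
    weights to vanish, so that Q = 0. *)
Lemma frame_attained (l W : C) : (0 < d)%N -> eigenvalue (gramS w c) l ->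
  (forall b : 'rV[C]_n, form (gramS w c) b <= l * normsq b) -> eigenvalue (W%:M - Q) (W - l).
Proof.
move=> d0 /eigenvalueP[b hb b0] hl; apply: eigenvalue_shift.
have [l0|l0] := eqVneq l 0; last exact: (frame_gram_eigen hxy b0 l0 hb).
have -> : Q = 0.
  apply: big1 => i _; have := hl (delta_mx 0 i); rewrite gramS_delta l0 mul0r => wi.
  have wi0 : w i = 0 by apply/eqP; rewrite eq_le wi w0.
  by rewrite wi0 scale0r.
apply/eigenvalueP; exists (delta_mx 0 (Ordinal d0)).
  by rewrite mulmx0 l0 scale0r.
apply/eqP => /rowP/(_ (Ordinal d0)); rewrite !mxE !eqxx => /eqP.
by rewrite oner_eq0.
Qed.

End Spectrum.

(** * The n projections of one representation *)

Section SphericalFrame.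
Context {R : realType} {n d : nat}.
Local Notation C := R[i].
Local Notation M := 'M[C]_n.
Local Notation T := (mxT R n).
Local Notation full := (finset.setT : {set 'I_n}).
Variable mu : {set 'I_n} -> probability T R.
Hypothesis hmu : forall B, is_haar B (mu B).
Variables (rho : M -> 'M[C]_d).
Hypotheses (hrho : is_rep rho).
Variables (i0 i1 : 'I_n).
Hypothesis i01 : i0 != i1.
Local Notation co i := (~: [set i])%SET.
Local Notation P i := (haar_avg (mu (co i)) rho).

Definition swap_mx (i : 'I_n) : M := perm_mx (tperm i0 i).

Lemma swap_mxK i : swap_mx i *m swap_mx i = 1%:M.
Proof. by rewrite -perm_mxM tperm2 perm_mx1. Qed.

Lemma swap_star i : star (swap_mx i) = swap_mx i.
Proof.
apply/matrixP => k l; rewrite starE !mxE rmorph_nat; congr (_%:R); congr nat_of_bool.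
by apply/eqP/eqP => <-; rewrite tpermK.
Qed.

Lemma swap_unitary i : unitary (swap_mx i).
Proof. by apply/unitaryE; rewrite swap_star swap_mxK. Qed.

Lemma swap_conjE i (g : M) k l :
  (swap_mx i *m g *m swap_mx i) k l = g (tperm i0 i k) (tperm i0 i l).
Proof.
have -> : swap_mx i *m g *m swap_mx i = col_perm (tperm i0 i) (row_perm (tperm i0 i) g).
  by rewrite col_permE row_permE tpermV.
by rewrite !mxE.
Qed.

Lemma swap_UB i j k (g : M) : tperm i0 i k = j ->  UB (co j) g ->
  UB (co k) (swap_mx i *m g *m swap_mx i).
Proof.
move=> e [ug hg]; have us := swap_unitary i.
split; first by apply: unitaryM => //; apply: unitaryM.
move=> p q hpq; rewrite swap_conjE hg ?(inj_eq perm_inj)//.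
by move: hpq; rewrite !inE !negbK -e !(inj_eq perm_inj).
Qed.

Lemma avg_swap i : P i = rho (swap_mx i) *m P i0 *m rho (swap_mx i).
Proof.
rewrite -{2}(swap_star i); apply: (avg_conj hrho (hmu full) (hmu _) (hmu _) (swap_unitary i)) => g.
  by rewrite swap_star; apply: swap_UB; rewrite tpermR.
by rewrite swap_star; apply: swap_UB; rewrite tpermL.
Qed.

(** All projections are conjugate to the first one by [swap_mx], and a product of two different
    swaps has corner 0, where the spherical function is c. *)
Lemma spherical_frame (x0 : 'cV[C]_d) (y0 : 'rV[C]_d) : P i0 != 0 ->
  P i0 = x0 *m y0 -> y0 *m x0 = 1%:M ->
  exists (x : 'I_n -> 'cV[C]_d) (y : 'I_n -> 'rV[C]_d), (forall i, P i = x i *m y i) /\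
    forall i j, y i *m x j = (if i == j then 1 else sph_value i0 i1 rho x0 y0)%:M.
Proof.
move=> P0 hP hyx; exists (fun i => rho (swap_mx i) *m x0), (fun i => y0 *m rho (swap_mx i)).
split=> [i|i j]; first by rewrite avg_swap hP !mulmxA.
have ui := swap_unitary i; have uj := swap_unitary j.
have -> : y0 *m rho (swap_mx i) *m (rho (swap_mx j) *m x0) =
    y0 *m rho (swap_mx i *m swap_mx j) *m x0.
  by rewrite (repM hrho ui uj) !mulmxA.
rewrite (sphE rho x0 y0); have [->|ij] := eqVneq i j.
  by rewrite swap_mxK (sph1 hrho hyx).
rewrite (sph_corner hmu hrho P0 hP (unitaryM ui uj) (Gmx01_unitary i01))//.
rewrite (Gmx_corner i01) /swap_mx -perm_mxM !mxE permM tpermL.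
case: eqP => // e; case/eqP: ij; apply: (@perm_inj _ (tperm i0 j)).
by rewrite e tpermR.
Qed.

Local Notation mom := (moment mu i0 i1).

Lemma irr_frame : irreducible rho -> nontrivial rho -> P i0 != 0 ->
  exists (x : 'I_n -> 'cV[C]_d) (y : 'I_n -> 'rV[C]_d) (c : C), [/\ forall i, P i = x i *m y i,
    forall i j, y i *m x j = (if i == j then 1 else c)%:M & - mom 1%N <= c <= mom 2].
Proof.
move=> irr nt P0; have [x0 [y0 [hP hyx]]] := spherical_rank1 hmu i01 hrho irr P0.
have [x [y [h1 h2]]] := spherical_frame P0 hP hyx.
exists x, y, (sph_value i0 i1 rho x0 y0); split=> //.
have m1 := moment_ge0 hmu i0 i1 1%N; have m2 := moment_ge0 hmu i0 i1 2.
have [->|c0] := eqVneq (sph_value i0 i1 rho x0 y0) 0; first by rewrite oppr_le0 m1 m2.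
have ph t (ht : t * t^* = 1) := sph_value_phase hmu i01 hrho P0 hP hyx c0 ht.
have [A hA] := sph_poly hmu i01 hrho irr P0 hP hyx ph.
have A0 : A != 0.
  apply/eqP => e; have := sph_poly1 hrho hyx hA; rewrite e horner0 => /eqP.
  by rewrite eq_sym oner_eq0.
have := sph_poly_deg hrho irr hyx hA nt; rewrite (sph_value_lead hmu i01 hrho hP hA A0).
move: (_.-1) => k k0; have mk := moment_ge0 hmu i0 i1 k.
(* Odd degrees give c in [-b_1, 0]; even ones, which are at least 2, give c in [0, b_2]. *)
rewrite -signr_odd; have [ok|ek] := boolP (odd k).
  rewrite expr1 mulN1r lerN2 (moment_homo hmu i0 i1 k0) /=.
  by rewrite (@le_trans _ _ 0)// oppr_le0.
have k2 : (2 <= k)%N by case: k k0 ek {mk} => [|[|]].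
rewrite expr0 mul1r (moment_homo hmu i0 i1 k2) andbT.
by rewrite (@le_trans _ _ 0)// oppr_le0.
Qed.

(** The sets of size at least n - 1 are the whole set, whose mean is 0, and the complements of
    points. *)
Lemma laplacianE (w : {set 'I_n} -> R) : irreducible rho -> nontrivial rho ->
  (forall B : {set 'I_n}, (#|B| < n - 1)%N -> w B = 0) ->
  laplacian w mu rho = ((w full + \sum_i w (co i))%:C)%C%:M -
    \sum_i ((w (co i))%:C)%C *: P i.
Proof.
move=> irr nt hw; rewrite /laplacian.
rewrite (bigD1 full)//= (avg_full0 hrho (hmu full) irr nt) subr0.
have inj : injective (fun i : 'I_n => co i).
  by move=> i j /finset.setC_inj/finset.set1_inj.
rewrite (bigID (fun B => B \in [set co i | i in 'I_n]%SET))/= [X in _ + (_ + X)]big1 ?addr0; last first.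
  move=> B /andP[BT Bi]; rewrite hw ?scale0r// ltn_neqAle; apply/andP; split.
    apply: contraNneq Bi => e; have : #|(~: B)%SET| = 1%N.
      by have := cardsC B; rewrite card_ord e; have := ltn_ord i0; lia.
    move=> /eqP/cards1P[i hi]; apply/imsetP; exists i => //.
    by rewrite -hi finset.setCK.
  have : (#|B| < #|full|)%N by apply: proper_card; rewrite properT.
  by rewrite cardsT card_ord => h; rewrite subn1 -ltnS (ltn_predK h).
rewrite (eq_bigl (fun B => B \in [set co i | i in 'I_n]%SET)) => [|B]; last first.
  have [/imsetP[i _ ->]|] := boolP (B \in _); last by rewrite andbF.
  rewrite andbT; apply/eqP => /finset.setP/(_ i).
  by rewrite !inE eqxx.
rewrite big_imset/= => [|i j _ _ e]; last exact: inj.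
under eq_bigr do rewrite scalerBr.
rewrite sumrB addrA; congr (_ - _).
rewrite -scaler_suml -scalerDl scalemx1; congr scalar_mx.
by rewrite [RHS]rmorphD /= rmorph_sum.
Qed.

End SphericalFrame.

Section DirectSum.
Context {R : realType}.
Local Notation C := R[i].

Lemma eigenvalue_block d1 d2 (A : 'M[C]_d1) (D : 'M[C]_d2) z :
  eigenvalue (block_mx A 0 0 D) z <-> eigenvalue A z \/ eigenvalue D z.
Proof.
split=> [/eigenvalueP[v]|[]/eigenvalueP[v hv v0]].
- rewrite -[v]hsubmxK mul_row_block !mulmx0 addr0 add0r scale_row_mx.
  set v1 := lsubmx v; set v2 := rsubmx v => /eq_row_mx[h1 h2] v0.
  have [e1|n1] := eqVneq v1 0; last by left; apply/eigenvalueP; exists v1.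
  right; apply/eigenvalueP; exists v2 => //.
  by apply: contra_neq v0 => e2; rewrite e1 e2 row_mx0.
- apply/eigenvalueP; exists (row_mx v 0).
    by rewrite mul_row_block !mulmx0 !mul0mx !addr0 scale_row_mx scaler0 hv.
  apply: contra_neq v0 => e; rewrite -(row_mx0 _ _ d1 d2) in e.
  by have [] := eq_row_mx e.
- apply/eigenvalueP; exists (row_mx 0 v).
    by rewrite mul_row_block !mulmx0 !mul0mx !add0r scale_row_mx scaler0 hv.
  apply: contra_neq v0 => e; rewrite -(row_mx0 _ _ d1 d2) in e.
  by have [] := eq_row_mx e.
Qed.

Context {n : nat}.
Local Notation T := (mxT R n).

Lemma haar_avg_dsum (B : {set 'I_n}) (mu : probability T R) d1 d2
    (r1 : 'M[C]_n -> 'M[C]_d1) (r2 : 'M[C]_n -> 'M[C]_d2) : is_haar B mu ->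
  haar_avg mu (dsum r1 r2) = block_mx (haar_avg mu r1) 0 0 (haar_avg mu r2).
Proof.
move=> hmu; rewrite !haar_avgE -[LHS]submxK; congr block_mx; apply/matrixP => k l.
- rewrite mint_entry !mxE; apply: (eq_cint hmu) => A _.
  by rewrite /dsum block_mxEul.
- rewrite !mxE -[RHS](cint_cst hmu); apply: (eq_cint hmu) => A _.
  by rewrite /dsum block_mxEur mxE.
- rewrite !mxE -[RHS](cint_cst hmu); apply: (eq_cint hmu) => A _.
  by rewrite /dsum block_mxEdl mxE.
- rewrite mint_entry !mxE; apply: (eq_cint hmu) => A _.
  by rewrite /dsum block_mxEdr.
Qed.

Lemma laplacian_dsum (w : {set 'I_n} -> R) (mu : {set 'I_n} -> probability T R) d1 d2
    (r1 : 'M[C]_n -> 'M[C]_d1) (r2 : 'M[C]_n -> 'M[C]_d2) :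
  (forall B, is_haar B (mu B)) ->
  laplacian w mu (dsum r1 r2) = block_mx (laplacian w mu r1) 0 0 (laplacian w mu r2).
Proof.
move=> hmu; rewrite /laplacian.
apply: (big_rec3 (fun S S1 S2 => S = block_mx S1 0 0 S2)) => [|B S S1 S2 _ ->].
  by rewrite block_mx0.
rewrite (haar_avg_dsum _ _ (hmu B)) scalar_mx_block opp_block_mx add_block_mx.
by rewrite scale_block_mx add_block_mx !(oppr0, addr0, scaler0).
Qed.

End DirectSum.

Section HighestWeightFrame.
Context {R : realType} {n d : nat}.
Local Notation C := R[i].
Local Notation M := 'M[C]_n.
Local Notation T := (mxT R n).
Variable mu : {set 'I_n} -> probability T R.
Hypothesis hmu : forall B, is_haar B (mu B).
Variables (i0 il : 'I_n).
Hypotheses (i0l : i0 != il) (vi0 : i0 = 0%N :> nat) (vil : il = n.-1 :> nat).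
Variables (rho : M -> 'M[C]_d) (a : nat).
Hypotheses (hrho : is_rep rho) (hw : has_highest_weight rho (wt_c0c n a%:Z)).

Lemma hw_nontrivial : (0 < a)%N -> nontrivial rho.
Proof.
move=> a0; have [irr [[v [v0 hv]] dom]] := hw.
have [t ht ta] : exists2 t : C, t * t^* = 1 & t ^+ a != 1.
  apply: contrapT => h; have [f injf hf] := @infinite_units R.
  have : 'X^a - 1%:P = 0 :> {poly C}.
    apply: (poly_inj_root injf) => k; rewrite hornerD hornerN hornerXn hornerC.
    apply/eqP; rewrite subr_eq0; apply/negPn/negP => hk.
    by apply: h; exists (f k).
  by move=> /(congr1 (fun p : {poly C} => size p)); rewrite size_XnsubC// size_poly0.
have t1 := normC1_inv ht; pose s k : C := if k == i0 then t else 1.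
have s1 k : `|s k| = 1 by rewrite /s; case: ifP => _; rewrite ?normr1.
exists (dgs s); split; first exact: dgs_unitary.
move=> e; have := hv s s1; rewrite -[diag_mx _]/(dgs s) e mulmx1.
rewrite (prod_wt i0l vi0 vil) => [|k]; last exact: norm1_neq0.
rewrite /s eqxx eq_sym (negbTE i0l) divr1 => /eqP.
rewrite -subr_eq0 -{1}[v]scale1r -scalerBl scaler_eq0 (negbTE v0) orbF subr_eq0.
by rewrite eq_sym (negbTE ta).
Qed.

Lemma hw_frame : exists (x : 'I_n -> 'cV[C]_d) (y : 'I_n -> 'rV[C]_d),
  (forall i, haar_avg (mu (~: [set i])%SET) rho = x i *m y i) /\
  forall i j, y i *m x j = (if i == j then 1 else (-1) ^+ a * moment mu i0 il a)%:M.
Proof.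
have [irr [[v [v0 hv]] dom]] := hw.
have [Phi hPhi ePhi] := rep_polynomial (hmu finset.setT) hrho irr.
have P0 := hw_avg_neq0 hmu hrho hPhi ePhi i0l vi0 vil dom v0 hv.
have [x0 [y0 [hP hyx]]] := spherical_rank1 hmu i0l hrho irr P0.
have ph t (ht : t * t^* = 1) := hw_phase hmu hrho irr i0l vi0 vil v0 hv hP hyx ht.
have [A hA] := sph_poly hmu i0l hrho irr P0 hP hyx ph.
rewrite -(hw_sph_value_aux hmu hrho irr hPhi ePhi i0l vi0 vil dom v0 hv hP hyx hA).
exact: (spherical_frame hmu hrho i0l P0 hP hyx).
Qed.

End HighestWeightFrame.

(** * The smallest eigenvalue *)

Section LowestEigenvalue.
Context {R : realType} {n : nat}.
Local Notation C := R[i].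
Local Notation M := 'M[C]_n.
Local Notation T := (mxT R n).
Local Notation full := (finset.setT : {set 'I_n}).
Local Notation co i := (~: [set i])%SET.
Variable mu : {set 'I_n} -> probability T R.
Hypothesis hmu : forall B, is_haar B (mu B).
Variables (i0 il : 'I_n).
Hypothesis i0l : i0 != il.
Variable w : {set 'I_n} -> R.
Hypotheses (hw0 : forall B, 0 <= w B)
  (hw : forall B : {set 'I_n}, (#|B| < n - 1)%N -> w B = 0).
Local Notation mom := (moment mu i0 il).

Definition wco (i : 'I_n) : C := (w (co i))%:C%C.

Lemma wco_ge0 i : 0 <= wco i. Proof. by rewrite /wco lecR. Qed.

Definition rbound (c l : C) := forall b : 'rV[C]_n,
  (b *m gramS wco c *m star b) 0 0 <= l * (b *m star b) 0 0.

Lemma normsq_ge0 (b : 'rV[C]_n) : 0 <= (b *m star b) 0 0.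
Proof. by rewrite mxE sumr_ge0// => i _; rewrite starE -normCK exprn_ge0. Qed.

Lemma rbound_le c l l' : l <= l' -> rbound c l -> rbound c l'.
Proof.
move=> ll h b; apply: (le_trans (h b)); apply: ler_wpM2r => //.
exact: normsq_ge0.
Qed.

Lemma rbound_ge0 c l : rbound c l -> 0 <= l.
Proof.
move=> /(_ (delta_mx 0 i0)); rewrite (gramS_delta wco).
rewrite -rowE mxE starE mxE !eqxx rmorph1 mulr1.
by apply: le_trans; exact: wco_ge0.
Qed.

Lemma laplacian_lower d (rho : M -> 'M[C]_d) (l : C) z :
  is_rep rho -> irreducible rho -> nontrivial rho ->
  rbound (- mom 1%N) l -> rbound (mom 2) l ->
  eigenvalue (laplacian w mu rho) z -> (w full + \sum_i w (co i))%:C%C - l <= z.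
Proof.
move=> hrho irr nt h1 h2; have l0 := rbound_ge0 h1.
rewrite (laplacianE hmu hrho i0l irr nt hw).
(* If one projection vanishes then all do, and the Laplacian is the scalar W, which is at least W -
   l since l >= 0. *)
have [P0|P0] := eqVneq (haar_avg (mu (co i0)) rho) 0.
  rewrite [X in _ - X]big1 ?subr0 => [/eigenvalueP[v hv v0]|i _]; last first.
    by rewrite (avg_swap hmu hrho i0) P0 mulmx0 mul0mx scaler0.
  move: hv; rewrite mul_mx_scalar => /eqP; rewrite -subr_eq0 -scalerBl scaler_eq0.
  by rewrite (negbTE v0) orbF subr_eq0 => /eqP <-; rewrite gerBl.
have [x [y [c [hx hxy hc]]]] := irr_frame hmu hrho i0l irr nt P0.
rewrite [X in _ - X](eq_bigr (fun i => wco i *: (x i *m y i))) => [|i _]; last by rewrite hx.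
exact: (frame_lower wco_ge0 hxy hc l0 h1 h2).
Qed.

Lemma laplacian_attained d (rho : M -> 'M[C]_d) (a : nat) (l : C) :
  i0 = 0%N :> nat -> il = n.-1 :> nat -> (0 < a)%N ->
  is_rep rho -> has_highest_weight rho (wt_c0c n a%:Z) ->
  eigenvalue (gramS wco ((-1) ^+ a * mom a)) l -> rbound ((-1) ^+ a * mom a) l ->
  eigenvalue (laplacian w mu rho) ((w full + \sum_i w (co i))%:C%C - l).
Proof.
move=> vi0 vil a0 hrho hwt el hl; have irr := hwt.1.
rewrite (laplacianE hmu hrho i0l irr (hw_nontrivial i0l vi0 vil hwt a0) hw).
have [x [y [hx hxy]]] := hw_frame hmu i0l vi0 vil hrho hwt.
rewrite [X in _ - X](eq_bigr (fun i => wco i *: (x i *m y i))) => [|i _]; last by rewrite hx.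
exact: (frame_attained wco_ge0 hxy _ irr.1 el hl).
Qed.

Lemma rbound_exists c : c^* = c -> exists2 l : R,
  eigenvalue (gramS wco c) (l%:C)%C & rbound c (l%:C)%C.
Proof.
move=> hc; have n0 : (0 < n)%N by apply: leq_ltn_trans (ltn_ord i0).
exact: (rayleigh n0 (gramS_star wco_ge0 hc)).
Qed.

Lemma mom_conj k : (mom k)^* = mom k.
Proof. by apply: CrealP; apply: ger0_real; exact: moment_ge0. Qed.

Lemma mom_sign_conj k : ((-1) ^+ k * mom k)^* = (-1) ^+ k * mom k.
Proof. by rewrite rmorphM /= mom_conj rmorphXn rmorphN rmorph1. Qed.

(** With l1 and l2 the largest eigenvalues of S_c at c = -b_1 and c = b_2, values realized by
    degrees 1 and 2, the minimum is W - max(l1, l2), attained by the representation of the larger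
    one. *)
Lemma lambda_min_pair d1 (rho1 : M -> 'M[C]_d1) d2 (rho2 : M -> 'M[C]_d2) :
  i0 = 0%N :> nat -> il = n.-1 :> nat ->
  is_rep rho1 -> has_highest_weight rho1 (wt_c0c n 1%N%:Z) ->
  is_rep rho2 -> has_highest_weight rho2 (wt_c0c n 2%N%:Z) ->
  exists m : R,
    (forall (d : nat) (rho : M -> 'M[C]_d) z,
        is_rep rho -> irreducible rho -> nontrivial rho ->
        eigenvalue (laplacian w mu rho) z -> (m%:C)%C <= z) /\
    (eigenvalue (laplacian w mu rho1) (m%:C)%C \/
     eigenvalue (laplacian w mu rho2) (m%:C)%C).
Proof.
move=> vi0 vil hr1 hw1 hr2 hw2.
have [l1 e1 b1] := rbound_exists (mom_sign_conj 1).
have [l2 e2 b2] := rbound_exists (mom_sign_conj 2).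
have m1 : (-1) ^+ 1 * mom 1%N = - mom 1%N by rewrite expr1 mulN1r.
have m2 : (-1) ^+ 2 * mom 2 = mom 2 by rewrite sqrrN expr1n mul1r.
pose W := w full + \sum_i w (co i).
have eW (l : R) : ((W - l)%:C)%C = (W%:C)%C - (l%:C)%C by rewrite rmorphB.
have low (l : R) : l1 <= l -> l2 <= l -> forall d (rho : M -> 'M[C]_d) z,
    is_rep rho -> irreducible rho -> nontrivial rho ->
    eigenvalue (laplacian w mu rho) z -> ((W - l)%:C)%C <= z.
  move=> h1 h2 d rho z hr irr nt; rewrite eW; apply: laplacian_lower => //.
    by rewrite -m1; apply: rbound_le b1; rewrite lecR.
  by rewrite -m2; apply: rbound_le b2; rewrite lecR.
have [l12|/ltW l21] := leP l1 l2.
  exists (W - l2); split; first exact: low.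
  by right; rewrite eW; exact: (laplacian_attained vi0 vil _ hr2 hw2 e2 b2).
exists (W - l1); split; first exact: low.
by left; rewrite eW; exact: (laplacian_attained vi0 vil _ hr1 hw1 e1 b1).
Qed.

End LowestEigenvalue.

Unset Implicit Arguments.
Unset Strict Implicit.

Theorem theorem1p5 (R : realType) (n : nat) (hn : (2 <= n)%N)
  (w : {set 'I_n} -> R)
  (hw0 : forall B, 0 <= w B)
  (hw : forall B : {set 'I_n}, (#|B| < n - 1)%N -> w B = 0)
  (mu : {set 'I_n} -> probability (mxT R n) R)
  (hmu : forall B, is_haar B (mu B))
  (d1 : nat) (rho1 : 'M[R[i]]_n -> 'M[R[i]]_d1)
  (hrho1 : is_rep rho1) (hw1 : has_highest_weight rho1 (wt_c0c n 1))
  (d2 : nat) (rho2 : 'M[R[i]]_n -> 'M[R[i]]_d2)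
  (hrho2 : is_rep rho2) (hw2 : has_highest_weight rho2 (wt_c0c n 2)) :
  exists m : R,
    is_lambda_min (laplacian w mu (dsum rho1 rho2)) m /\
    (forall (d : nat) (rho : 'M[R[i]]_n -> 'M[R[i]]_d),
        is_rep rho -> irreducible rho -> nontrivial rho ->
        forall x : R, is_lambda_min (laplacian w mu rho) x -> m <= x) /\
    (exists (d : nat) (rho : 'M[R[i]]_n -> 'M[R[i]]_d),
        is_rep rho /\ irreducible rho /\ nontrivial rho /\
        is_lambda_min (laplacian w mu rho) m).
Proof.
have n0 : (0 < n)%N by exact: ltnW.
have n1 : (n.-1 < n)%N by rewrite prednK.
pose i0 : 'I_n := Ordinal n0; pose il : 'I_n := Ordinal n1.
have i0l : i0 != il.
  by apply/eqP => /(congr1 val) /= e; move: hn; rewrite -(prednK n0) -e.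
have vi0 : i0 = 0%N :> nat by [].
have vil : il = n.-1 :> nat by [].
have nt1 := hw_nontrivial i0l vi0 vil (a := 1) hw1 isT.
have nt2 := hw_nontrivial i0l vi0 vil (a := 2) hw2 isT.
have [m [low att]] := lambda_min_pair hmu i0l hw0 hw vi0 vil hrho1 hw1 hrho2 hw2.
have low1 z := low _ rho1 z hrho1 hw1.1 nt1.
have low2 z := low _ rho2 z hrho2 hw2.1 nt2.
exists m; split.
  rewrite laplacian_dsum//; split; first by apply/eigenvalue_block.
  by move=> y /eigenvalue_block[]; [exact: low1|exact: low2].
split.
  move=> d rho hrho irr nt x [ex _]; rewrite -lecR.
  exact: (low _ _ _ hrho irr nt ex).
case: att => att; [exists d1, rho1|exists d2, rho2].
  by split=> //; split; [exact: hw1.1|split].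
by split=> //; split; [exact: hw2.1|split].
Qed.
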